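(* Let $\varphi,\psi:\mathbb D\to\mathbb D$ be two commuting parabolic holomorphic self-maps. Suppose that a holomorphic function $h:\mathbb D\to\mathbb C$ satisfies $h\circ\varphi=h+c_1$ and $h\circ\psi=h+c_2$ for some $(c_1,c_2)\in\mathbb C^2\setminus\{(0,0)\}$. Then $c_1\neq0$ and $c_2/c_1=c_{\varphi,\psi}$. Moreover, if $\varphi$ is of positive hyperbolic step and $c_{\varphi,\psi}\notin\mathbb Q$, then there exists $c_0\in\mathbb C$ such that $$h=c_1\,\beta_{\varphi,\psi}\circ h_\varphi+c_0.$$
   Context: $\mathbb D$ is the open unit disc, $\mathbb H=\{w\in\mathbb C:\operatorname{Im}w>0\}$. A holomorphic self-map $\varphi$ of $\mathbb D$ is parabolic if its Denjoy–Wolff point (locally uniform limit of the iterates) $\tau$ lies on $\partial\mathbb D$ and the angular derivative satisfies $\varphi'(\tau)=1$. It is of positive (resp. zero) hyperbolic step if $\lim_{n}\rho_{\mathbb D}(\varphi^{\circ n}(z_0),\varphi^{\circ(n+1)}(z_0))$ is positive (resp. zero) for some (equivalently, every) $z_0\in\mathbb D$, where $\rho_{\mathbb D}$ is the hyperbolic distance. Canonical model. A domain $V\subset\mathbb D$ is $\varphi$-absorbing if $\varphi(V)\subset V$ and $\mathbb D=\bigcup_{n}(\varphi^{\circ n})^{-1}(V)$. For $\varphi$ parabolic there is a unique triple $(S_\varphi,h_\varphi,z\mapsto z+1)$, the canonical holomorphic model, such that $h_\varphi:\mathbb D\to S_\varphi$ is holomorphic, $h_\varphi\circ\varphi=h_\varphi+1$,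 $S_\varphi=\bigcup_{n\ge0}(h_\varphi(\mathbb D)-n)$, $h_\varphi$ is injective on some $\varphi$-absorbing domain, and: if $\varphi$ has zero hyperbolic step, then $S_\varphi=\mathbb C$ and $h_\varphi(0)=0$; if $\varphi$ has positive hyperbolic step, then $S_\varphi\in\{\mathbb H,-\mathbb H\}$ and $\operatorname{Re}h_\varphi(0)=0$. $h_\varphi$ is called the Koenigs function. Simultaneous linearization coefficient and function. Let $\psi$ be a holomorphic self-map of $\mathbb D$ commuting with $\varphi$. If $\varphi$ has zero hyperbolic step, it is known that $h_\varphi\circ\psi=h_\varphi+c$ for a unique constant $c\in\mathbb C$, and $c_{\varphi,\psi}:=c$. If $\varphi$ has positive hyperbolic step, consider for a constant $c\in\mathbb C$ and a holomorphic $\beta:S_\varphi\to\mathbb C$ the system: $\beta(w+1)=\beta(w)+1$ for all $w\in S_\varphi$; $\beta\circ h_\varphi\circ\varphi=\beta\circ h_\varphi+1$; $\beta\circ h_\varphi\circ\psi=\beta\circ h_\varphi+c$. There is a unique $c=c_{\varphi,\psi}\in\mathbb C$ for which a holomorphic solution $\beta$ exists. In both cases $c_{\varphi,\psi}$ is called the simultaneous linearization coefficient of $\psi$ w.r.t. $\varphi$. For $\varphi$ of positive hyperbolic step and $c_{\varphi,\psi}\notin\mathbb Q$, the simultaneous linearization function $\beta_{\varphi,\psi}$ is the unique holomorphic solution $\beta:S_\varphi\to\mathbb C$ of the system with $c=c_{\varphi,\psi}$ satisfying $\beta(w)-w\to0$ as $|\operatorname{Im}w|\to+\infty$, $w\in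 S_\varphi$. *)

(* Defs.v *)
From Stdlib Require Import Reals QArith Qreals.
From Coquelicot Require Import Coquelicot.
Open Scope C_scope.

(* Maps defined on a subset U of the plane are represented by total functions
   C -> C, and only their values on U are ever constrained. *)

Definition unit_disc (z : C) : Prop := (Cmod z < 1)%R.
Definition upper_half_plane (w : C) : Prop := (0 < Im w)%R.
Definition lower_half_plane (w : C) : Prop := (Im w < 0)%R.

(* Complex differentiability at every point.  Only used for open U, so the values
   of f outside U are irrelevant. *)
Definition holomorphic_on (U : C -> Prop) (f : C -> C) : Prop :=
  forall z, U z -> @ex_derive C_AbsRing C_NormedModule f z.

Definition holomorphic_self_map (f : C -> C) : Prop :=
  holomorphic_on unit_disc f /\ forall z, unit_disc z -> unit_disc (f z).

Definition commuting (f g : C -> C) : Prop :=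
  forall z, unit_disc z -> f (g z) = g (f z).

Definition iterate (n : nat) (f : C -> C) (z : C) : C := Nat.iter n f z.

Definition denjoy_wolff_point (f : C -> C) (tau : C) : Prop :=
  forall z0, unit_disc z0 ->
  exists r : R, (0 < r)%R /\
  forall eps : R, (0 < eps)%R ->
  exists N : nat, forall (n : nat) (z : C), (N <= n)%nat ->
    unit_disc z -> (Cmod (z - z0) < r)%R -> (Cmod (iterate n f z - tau) < eps)%R.

(* For M <= 1 and |tau| = 1 this set is empty, so quantifying over all real M
   amounts to quantifying over M > 1. *)
Definition stolz_region (tau : C) (M : R) (z : C) : Prop :=
  unit_disc z /\ (Cmod (z - tau) < M * (1 - Cmod z))%R.

Definition angular_limit (f : C -> C) (tau l : C) : Prop :=
  forall M : R,
    filterlim f (within (stolz_region tau M) (locally tau)) (locally l).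

Definition angular_derivative (f : C -> C) (tau l : C) : Prop :=
  exists sigma : C,
    angular_limit f tau sigma /\
    angular_limit (fun z => (f z - sigma) / (z - tau)) tau l.

Definition parabolic (f : C -> C) : Prop :=
  holomorphic_self_map f /\
  exists tau : C,
    denjoy_wolff_point f tau /\ Cmod tau = 1%R /\ angular_derivative f tau 1.

(* Normalized to have curvature -4; the hyperbolic step notions below do not depend
   on the normalization. *)
Definition hyperbolic_distance (z w : C) : R :=
  let t := Cmod ((z - w) / (1 - Cconj w * z)) in
  (/ 2 * ln ((1 + t) / (1 - t)))%R.

Definition hyperbolic_step_at (f : C -> C) (z0 : C) (l : R) : Prop :=
  is_lim_seq
    (fun n => hyperbolic_distance (iterate n f z0) (iterate (n + 1) f z0)) l.

Definition positive_hyperbolic_step (f : C -> C) : Prop :=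
  exists z0 : C, unit_disc z0 /\
  exists l : R, (0 < l)%R /\ hyperbolic_step_at f z0 l.

Definition zero_hyperbolic_step (f : C -> C) : Prop :=
  exists z0 : C, unit_disc z0 /\ hyperbolic_step_at f z0 0.

Definition connected_set (U : C -> Prop) : Prop :=
  forall A B : C -> Prop, open A -> open B ->
    (forall z, U z -> A z \/ B z) ->
    (exists z, U z /\ A z) -> (exists z, U z /\ B z) ->
    exists z, U z /\ A z /\ B z.

Definition planar_domain (U : C -> Prop) : Prop :=
  open U /\ connected_set U /\ exists z, U z.

Definition absorbing (f : C -> C) (V : C -> Prop) : Prop :=
  planar_domain V /\
  (forall z, V z -> unit_disc z) /\
  (forall z, V z -> V (f z)) /\
  (forall z, unit_disc z -> exists n : nat, V (iterate n f z)).

(* (U, k, w |-> w + 1) is the canonical holomorphic model of f, and k is the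
   Koenigs function of f. *)
Record canonical_model (f : C -> C) (U : C -> Prop) (k : C -> C) : Prop := {
  koenigs_holomorphic : holomorphic_on unit_disc k;
  koenigs_into : forall z, unit_disc z -> U (k z);
  koenigs_abel : forall z, unit_disc z -> k (f z) = k z + 1;
  base_space_union :
    forall w, U w <-> exists (n : nat) (z : C), unit_disc z /\ w = k z - INR n;
  koenigs_injective :
    exists V, absorbing f V /\
      forall z1 z2, V z1 -> V z2 -> k z1 = k z2 -> z1 = z2;
  zero_step_normalization :
    zero_hyperbolic_step f -> (forall w, U w) /\ k 0 = 0;
  positive_step_normalization :
    positive_hyperbolic_step f ->
    ((forall w, U w <-> upper_half_plane w) \/
     (forall w, U w <-> lower_half_plane w)) /\
    Re (k 0) = 0%R
}.

Record linearization_system (f g : C -> C) (U : C -> Prop) (k : C -> C)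
    (c : C) (beta : C -> C) : Prop := {
  lin_holomorphic : holomorphic_on U beta;
  lin_translation : forall w, U w -> beta (w + 1) = beta w + 1;
  lin_first : forall z, unit_disc z -> beta (k (f z)) = beta (k z) + 1;
  lin_second : forall z, unit_disc z -> beta (k (g z)) = beta (k z) + c
}.

(* c is the coefficient c_{f,g}, where (U, k) is the canonical model of f.  Its
   uniqueness is a theorem and not part of the definition. *)
Definition linearization_coefficient (f g : C -> C) (U : C -> Prop)
    (k : C -> C) (c : C) : Prop :=
  (zero_hyperbolic_step f -> forall z, unit_disc z -> k (g z) = k z + c) /\
  (positive_hyperbolic_step f ->
     exists beta, linearization_system f g U k c beta).

(* beta is the function beta_{f,g}, for f of positive hyperbolic step and c = c_{f,g}
   irrational. *)
Definition linearization_function (f g : C -> C) (U : C -> Prop)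
    (k : C -> C) (c : C) (beta : C -> C) : Prop :=
  linearization_system f g U k c beta /\
  forall eps : R, (0 < eps)%R ->
  exists M : R, forall w, U w -> (M < Rabs (Im w))%R ->
    (Cmod (beta w - w) < eps)%R.

Definition rational (c : C) : Prop := exists q : Q, c = RtoC (Q2R q).

(* Main.v *)
(* All the rigidity comes from primitives of [k b'] on the disc, where [b o phi = b + 1] and
   [b o psi = b + c] ([b] is the Koenigs function, or [beta] composed with it), and
   [k = h - c1 b] satisfies [k o phi = k], [k o psi = k + d] with [d = c2 - c1 c].  A primitive
   [P] of [k b'] satisfies [P o phi = P + I] and [P o psi = P + d b + J], and [phi o psi = psi o phi]
   forces [d = 0] as in the Heisenberg group.  Existence of [b] requires the hyperbolic step of
   [phi] to be zero or positive, i.e. the limit defining it to exist (Schwarz-Pick).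

   For positive step, [k] descends to a function [K] of period 1 on the half-plane.  The same
   argument applied to [k exp(2 i pi n b)], on which [psi] acts with multiplier
   [exp(2 i pi n c) <> 1], shows that all Fourier modes of [K] with respect to [d beta] of index
   [n <> 0] vanish.  High in the half-plane [beta] is close to the identity, so Cauchy's formula
   on the cylinder expresses [K] through these modes: [K] is constant there, then everywhere. *)

Require Import Defs.
From Stdlib Require Import Reals Lra Lia ZArith QArith Qreals ClassicalEpsilon.
From Coquelicot Require Import Coquelicot.
Open Scope C_scope.

(** * Complex differentiation *)

(** Functional equations integrate well: on a convex domain a primitive exists, each relation for an
    integrand gives one for its primitive up to a constant, and the constants can be compared at the
    single point 0. For the same reason every contour integral below is the increment of a primitive
    over a period, so that only convex domains occur and no winding number has to be discussed.

    The positive step is treated in two passes because the kernel built on [beta] is usable only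
    where equal values of [exp (2 i pi beta)] occur at integer distance and [beta'] does not vanish.
    Far from the real axis both follow from the smallness of [beta w - w]; near the axis neither is
    known. Hence [beta] serves only to show that [K] is constant far away, and the identity replaces
    it as coordinate in the second pass.

    The Koenigs function need not be injective either, so the descent from [k] to [K] goes through
    its local inverses on an absorbing domain. *)

Lemma im_le_Cmod (z : C) : (Rabs (Im z) <= Cmod z)%R.
Proof. apply Rle_trans with (2 := Rmax_Cmod z), Rmax_r. Qed.

Lemma Cmod_le_re_im (z : C) : (Cmod z <= Rabs (Re z) + Rabs (Im z))%R.
Proof.
  replace z with (RtoC (Re z) + Ci * RtoC (Im z)) at 1
    by (destruct z as [x y]; unfold Re, Im, Ci, RtoC, Cplus, Cmult; simpl; f_equal; ring).
  apply Rle_trans with (1 := Cmod_triangle _ _).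
  rewrite Cmod_mult, Cmod_Ci, !Cmod_R. lra.
Qed.

Lemma Cmod_triangle_minus (a b c : C) : (Cmod (a - c) <= Cmod (a - b) + Cmod (b - c))%R.
Proof. replace (a - c) with ((a - b) + (b - c)) by ring. apply Cmod_triangle. Qed.

Lemma Cmod_minus_sym (a b : C) : Cmod (a - b) = Cmod (b - a).
Proof. rewrite <- Cmod_opp. f_equal. ring. Qed.

Lemma Cmod_triangle_inv (a b : C) : (Cmod a - Cmod b <= Cmod (a - b))%R.
Proof. pose proof (Cmod_triangle (a - b) b) as H. replace (a - b + b) with a in H by ring. lra. Qed.

Lemma Ceq_small (a b : C) (K : R) :
  (forall eps : R, (0 < eps)%R -> (Cmod (a - b) <= K * eps)%R) -> a = b.
Proof.
  intros H. apply Ceq_minus, Cmod_eq_0.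
  pose proof (Cmod_ge_0 (a - b)) as H0.
  destruct (Rle_lt_or_eq_dec _ _ H0) as [Hp | He]; [exfalso | now symmetry].
  assert (HK : (0 < Rabs K + 1)%R) by (pose proof (Rabs_pos K); lra).
  set (e := (Cmod (a - b) / (2 * (Rabs K + 1)))%R).
  assert (He : (0 < e)%R) by (apply Rdiv_lt_0_compat; lra).
  specialize (H e He).
  assert (K * e <= (Rabs K + 1) * e)%R
    by (apply Rmult_le_compat_r; [lra | pose proof (Rle_abs K); lra]).
  assert ((Rabs K + 1) * e = Cmod (a - b) / 2)%R by (unfold e; field; lra).
  lra.
Qed.

Definition Ccont (f : C -> C) (z : C) : Prop :=
  forall eps : R, (0 < eps)%R -> exists d : R, (0 < d)%R /\
    forall w, (Cmod (w - z) < d)%R -> (Cmod (f w - f z) < eps)%R.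

(** The bound is multiplied out, so that [w = z] needs no exception, and discs for [Cmod] replace
    the coordinatewise balls of the uniform structure on [C]. *)
Definition Cder (f : C -> C) (z l : C) : Prop :=
  forall eps : R, (0 < eps)%R -> exists d : R, (0 < d)%R /\
    forall w, (Cmod (w - z) < d)%R ->
      (Cmod (f w - f z - l * (w - z)) <= eps * Cmod (w - z))%R.

(** Coordinatewise balls and Euclidean discs compare up to a factor [sqrt 2]; the radius [d / 2]
    absorbs it because [sqrt 2 < 2]. *)
Lemma locally_C_Cmod (z : C) (P : C -> Prop) :
  @locally C_UniformSpace z P <->
  exists d : R, (0 < d)%R /\ forall w, (Cmod (w - z) < d)%R -> P w.
Proof.
  split.
  - intros [d Hd]. exists d. split; [apply cond_pos |].
    intros w Hw. apply Hd, C_NormedModule_mixin_compat1, Hw.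
  - intros [d [Hd H]].
    assert (Hs : (0 < d / 2)%R) by lra.
    exists (mkposreal _ Hs). intros w Hw. apply H.
    apply Rlt_le_trans with (1 := C_NormedModule_mixin_compat2 _ _ _ Hw).
    simpl. pose proof (sqrt_pos 2). pose proof (sqrt_def 2 ltac:(lra)). nra.
Qed.

Lemma open_C (U : C -> Prop) (z : C) : open U -> U z ->
  exists d : R, (0 < d)%R /\ forall w, (Cmod (w - z) < d)%R -> U w.
Proof. intros HU Hz. apply locally_C_Cmod, HU, Hz. Qed.

Lemma ex_derive_Cder (f : C -> C) (z : C) :
  @ex_derive C_AbsRing C_NormedModule f z <-> exists l, Cder f z l.
Proof.
  split.
  - intros [l [_ H]]. exists l. intros eps Heps.
    specialize (H z (fun P HP => HP) (mkposreal eps Heps)).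
    destruct H as [d Hd]. exists d. split; [apply cond_pos |].
    intros w Hw. specialize (Hd w Hw).
    change (Cmod (f w - f z - (w - z) * l) <= eps * Cmod (w - z))%R in Hd.
    now rewrite (Cmult_comm l).
  - intros [l H]. exists l. split; [apply is_linear_scal_l |].
    intros x Hx eps.
    apply (@is_filter_lim_locally_unique C_AbsRing (AbsRing_NormedModule C_AbsRing)) in Hx.
    subst x. destruct (H eps (cond_pos eps)) as [d [Hd Hw]].
    exists (mkposreal d Hd). intros w Hw'. specialize (Hw w Hw').
    change (Cmod (f w - f z - (w - z) * l) <= eps * Cmod (w - z))%R.
    now rewrite (Cmult_comm _ l).
Qed.

(* Caratheodory's form of differentiability, which reduces the differentiation rules to
   algebra and continuity. *)
Lemma Cder_Carath (f : C -> C) (z l : C) : Cder f z l <->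
  exists q, Ccont q z /\ q z = l /\ forall w, f w = f z + q w * (w - z).
Proof.
  split.
  - intros H.
    exists (fun w => if Ceq_dec w z then l else (f w - f z) / (w - z)).
    split; [| split].
    + intros eps Heps. destruct (H (eps / 2)%R ltac:(lra)) as [d [Hd Hw]].
      exists d. split; [exact Hd |]. intros w Hwz.
      destruct (Ceq_dec z z) as [_ | n]; [| now contradiction n].
      destruct (Ceq_dec w z) as [e | n].
      * replace (l - l) with (RtoC 0) by ring. rewrite Cmod_0. exact Heps.
      * specialize (Hw w Hwz). pose proof (Cminus_eq_contra _ _ n) as nz.
        replace ((f w - f z) / (w - z) - l) with ((f w - f z - l * (w - z)) / (w - z))
          by (field; exact nz).
        rewrite Cmod_div by exact nz.
        pose proof (proj1 (Cmod_gt_0 _) nz) as Hp.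
        apply Rle_lt_trans with (eps / 2)%R; [| lra].
        apply Rmult_le_reg_r with (Cmod (w - z)); [exact Hp |].
        unfold Rdiv. rewrite Rmult_assoc, Rinv_l; lra.
    + destruct (Ceq_dec z z) as [_ | n]; [reflexivity | now contradiction n].
    + intros w. destruct (Ceq_dec w z) as [e | n].
      * subst w. ring.
      * field. apply Cminus_eq_contra, n.
  - intros [q [Hq [<- Hf]]] eps Heps.
    destruct (Hq eps Heps) as [d [Hd Hw]]. exists d. split; [exact Hd |].
    intros w Hwz. rewrite (Hf w).
    replace (f z + q w * (w - z) - f z - q z * (w - z)) with ((q w - q z) * (w - z)) by ring.
    rewrite Cmod_mult. apply Rmult_le_compat_r; [apply Cmod_ge_0 |]. left. now apply Hw.
Qed.

Lemma Ccont_const (c z : C) : Ccont (fun _ => c) z.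
Proof.
  intros eps Heps. exists 1%R. split; [lra |]. intros w _.
  replace (c - c) with (RtoC 0) by ring. now rewrite Cmod_0.
Qed.

Lemma Ccont_id (z : C) : Ccont (fun w => w) z.
Proof. intros eps Heps. exists eps. now split. Qed.

Lemma Ccont_loc (f g : C -> C) (z : C) (d : R) : (0 < d)%R ->
  (forall w, (Cmod (w - z) < d)%R -> f w = g w) -> Ccont f z -> Ccont g z.
Proof.
  intros Hd H Hf eps Heps. destruct (Hf eps Heps) as [d' [Hd' Hw]].
  exists (Rmin d d'). split; [now apply Rmin_pos |]. intros w Hwz.
  assert (Hz : (Cmod (z - z) < d)%R)
    by (replace (z - z) with (RtoC 0) by ring; now rewrite Cmod_0).
  rewrite <- (H z Hz), <- (H w).
  - apply Hw. apply Rlt_le_trans with (1 := Hwz), Rmin_r.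
  - apply Rlt_le_trans with (1 := Hwz), Rmin_l.
Qed.

Lemma Ccont_plus (f g : C -> C) (z : C) :
  Ccont f z -> Ccont g z -> Ccont (fun w => f w + g w) z.
Proof.
  intros Hf Hg eps Heps.
  destruct (Hf (eps / 2)%R ltac:(lra)) as [d1 [Hd1 H1]].
  destruct (Hg (eps / 2)%R ltac:(lra)) as [d2 [Hd2 H2]].
  exists (Rmin d1 d2). split; [now apply Rmin_pos |]. intros w Hw.
  specialize (H1 w (Rlt_le_trans _ _ _ Hw (Rmin_l _ _))).
  specialize (H2 w (Rlt_le_trans _ _ _ Hw (Rmin_r _ _))).
  replace (f w + g w - (f z + g z)) with ((f w - f z) + (g w - g z)) by ring.
  pose proof (Cmod_triangle (f w - f z) (g w - g z)). lra.
Qed.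

Lemma Ccont_mult (f g : C -> C) (z : C) :
  Ccont f z -> Ccont g z -> Ccont (fun w => f w * g w) z.
Proof.
  intros Hf Hg eps Heps.
  set (A := (Cmod (f z) + Cmod (g z) + 1)%R).
  pose proof (Cmod_ge_0 (f z)) as Pf. pose proof (Cmod_ge_0 (g z)) as Pg.
  set (e := Rmin 1 (eps / (2 * A))).
  assert (He : (0 < e)%R)
    by (apply Rmin_pos; [lra | apply Rdiv_lt_0_compat; unfold A; lra]).
  assert (He1 : (e <= 1)%R) by apply Rmin_l.
  assert (HeA : (e * A <= eps / 2)%R).
  { apply Rle_trans with (eps / (2 * A) * A)%R.
    - apply Rmult_le_compat_r; [unfold A; lra | apply Rmin_r].
    - right. field. unfold A. lra. }
  destruct (Hf e He) as [d1 [Hd1 H1]]. destruct (Hg e He) as [d2 [Hd2 H2]].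
  exists (Rmin d1 d2). split; [now apply Rmin_pos |]. intros w Hw.
  specialize (H1 w (Rlt_le_trans _ _ _ Hw (Rmin_l _ _))).
  specialize (H2 w (Rlt_le_trans _ _ _ Hw (Rmin_r _ _))).
  replace (f w * g w - f z * g z)
    with ((f w - f z) * (g w - g z) + (f z * (g w - g z) + g z * (f w - f z))) by ring.
  eapply Rle_lt_trans; [apply Cmod_triangle |].
  eapply Rle_lt_trans; [apply Rplus_le_compat_l, Cmod_triangle |].
  rewrite !Cmod_mult.
  pose proof (Cmod_ge_0 (f w - f z)). pose proof (Cmod_ge_0 (g w - g z)).
  unfold A in HeA.
  assert (Cmod (f w - f z) * Cmod (g w - g z) <= e * 1)%R by (apply Rmult_le_compat; lra).
  assert (Cmod (f z) * Cmod (g w - g z) <= Cmod (f z) * e)%R by (apply Rmult_le_compat_l; lra).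
  assert (Cmod (g z) * Cmod (f w - f z) <= Cmod (g z) * e)%R by (apply Rmult_le_compat_l; lra).
  lra.
Qed.

Lemma Ccont_comp (f g : C -> C) (z : C) :
  Ccont g z -> Ccont f (g z) -> Ccont (fun w => f (g w)) z.
Proof.
  intros Hg Hf eps Heps. destruct (Hf eps Heps) as [d [Hd H]].
  destruct (Hg d Hd) as [d' [Hd' H']]. exists d'. split; [exact Hd' |]. intros w Hw.
  now apply H, H'.
Qed.

Lemma Ccont_neq_0 (f : C -> C) (z : C) : Ccont f z -> f z <> 0 ->
  exists d : R, (0 < d)%R /\ forall w, (Cmod (w - z) < d)%R -> (Cmod (f z) / 2 < Cmod (f w))%R.
Proof.
  intros Hf Hz. pose proof (proj1 (Cmod_gt_0 _) Hz) as Hp.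
  destruct (Hf (Cmod (f z) / 2)%R ltac:(lra)) as [d [Hd H]].
  exists d. split; [exact Hd |]. intros w Hw. specialize (H w Hw).
  rewrite Cmod_minus_sym in H. pose proof (Cmod_triangle_inv (f z) (f w)). lra.
Qed.

Lemma Ccont_inv (f : C -> C) (z : C) :
  Ccont f z -> f z <> 0 -> Ccont (fun w => / f w) z.
Proof.
  intros Hf Hz eps Heps. pose proof (proj1 (Cmod_gt_0 _) Hz) as Hp.
  destruct (Ccont_neq_0 f z Hf Hz) as [d1 [Hd1 H1]].
  set (m := Cmod (f z)) in *.
  destruct (Hf (eps * (m * m / 2))%R ltac:(apply Rmult_lt_0_compat; nra)) as [d2 [Hd2 H2]].
  exists (Rmin d1 d2). split; [now apply Rmin_pos |]. intros w Hw.
  specialize (H1 w (Rlt_le_trans _ _ _ Hw (Rmin_l _ _))).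
  specialize (H2 w (Rlt_le_trans _ _ _ Hw (Rmin_r _ _))).
  assert (nw : f w <> 0) by (apply Cmod_gt_0; lra).
  replace (/ f w - / f z) with ((f z - f w) / (f w * f z)) by (field; split; assumption).
  rewrite Cmod_div, Cmod_mult, Cmod_minus_sym by now apply Cmult_neq_0.
  fold m. apply Rmult_lt_reg_r with (Cmod (f w) * m)%R; [nra |].
  unfold Rdiv. rewrite Rmult_assoc, Rinv_l by nra.
  assert (eps * (m * m / 2) < eps * (Cmod (f w) * m))%R by (apply Rmult_lt_compat_l; nra).
  lra.
Qed.

Lemma Cder_cont (f : C -> C) (z l : C) : Cder f z l -> Ccont f z.
Proof.
  intros H. apply Cder_Carath in H as [q [Hq [_ Hf]]].
  apply Ccont_loc with (f := fun w => f z + q w * (w + - z)) (d := 1%R).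
  - lra.
  - intros w _. now rewrite (Hf w).
  - apply Ccont_plus; [apply Ccont_const |].
    apply Ccont_mult; [exact Hq |]. apply Ccont_plus; [apply Ccont_id | apply Ccont_const].
Qed.

Lemma Cder_loc (f g : C -> C) (z l : C) (d : R) : (0 < d)%R ->
  (forall w, (Cmod (w - z) < d)%R -> f w = g w) -> Cder f z l -> Cder g z l.
Proof.
  intros Hd H Hf eps Heps. destruct (Hf eps Heps) as [d' [Hd' Hw]].
  exists (Rmin d d'). split; [now apply Rmin_pos |]. intros w Hwz.
  assert (Hz : (Cmod (z - z) < d)%R)
    by (replace (z - z) with (RtoC 0) by ring; now rewrite Cmod_0).
  rewrite <- (H z Hz), <- (H w).
  - apply Hw. apply Rlt_le_trans with (1 := Hwz), Rmin_r.
  - apply Rlt_le_trans with (1 := Hwz), Rmin_l.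
Qed.

Lemma Cder_ext (f g : C -> C) (z l : C) :
  (forall w, f w = g w) -> Cder f z l -> Cder g z l.
Proof. intros H. apply Cder_loc with (d := 1%R); [lra | intros w _; apply H]. Qed.

Lemma Cder_eq (f : C -> C) (z l l' : C) : l = l' -> Cder f z l -> Cder f z l'.
Proof. now intros ->. Qed.

Lemma Cder_const (c z : C) : Cder (fun _ => c) z 0.
Proof.
  apply Cder_Carath. exists (fun _ => RtoC 0).
  split; [apply Ccont_const | split; [reflexivity | intros; ring]].
Qed.

Lemma Cder_id (z : C) : Cder (fun w => w) z 1.
Proof.
  apply Cder_Carath. exists (fun _ => RtoC 1).
  split; [apply Ccont_const | split; [reflexivity | intros; ring]].
Qed.

Lemma Cder_plus (f g : C -> C) (z k l : C) :
  Cder f z k -> Cder g z l -> Cder (fun w => f w + g w) z (k + l).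
Proof.
  rewrite !Cder_Carath. intros [p [Hp [<- Hf]]] [q [Hq [<- Hg]]].
  exists (fun w => p w + q w). split; [now apply Ccont_plus | split; [reflexivity |]].
  intros w. rewrite (Hf w), (Hg w). ring.
Qed.

Lemma Cder_mult (f g : C -> C) (z k l : C) :
  Cder f z k -> Cder g z l -> Cder (fun w => f w * g w) z (k * g z + f z * l).
Proof.
  intros Df Dg. pose proof (Cder_cont _ _ _ Dg) as Cg. revert Df Dg.
  rewrite !Cder_Carath. intros [p [Hp [<- Hf]]] [q [Hq [<- Hg]]].
  exists (fun w => p w * g w + f z * q w). split; [| split; [reflexivity |]].
  - apply Ccont_plus; [now apply Ccont_mult |].
    apply Ccont_mult; [apply Ccont_const | exact Hq].
  - intros w. rewrite (Hf w) at 1. rewrite (Hg w). ring.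
Qed.

Lemma Cder_comp (f g : C -> C) (z k l : C) :
  Cder g z l -> Cder f (g z) k -> Cder (fun w => f (g w)) z (k * l).
Proof.
  intros Dg. pose proof (Cder_cont _ _ _ Dg) as Cg. revert Dg.
  rewrite !Cder_Carath. intros [q [Hq [<- Hg]]] [p [Hp [<- Hf]]].
  exists (fun w => p (g w) * q w). split; [| split; [reflexivity |]].
  - apply Ccont_mult; [now apply Ccont_comp | exact Hq].
  - intros w. rewrite (Hf (g w)). rewrite (Hg w) at 2. ring.
Qed.

(** If [q] is the slope function of [f], that of [/ f] is [- q w / (f w * f z)]. It represents [/ f]
    only near [z], where [f] does not vanish. *)
Lemma Cder_inv (f : C -> C) (z l : C) :
  Cder f z l -> f z <> 0 -> Cder (fun w => / f w) z (- l / (f z * f z)).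
Proof.
  intros Df Hz. pose proof (Cder_cont _ _ _ Df) as Cf.
  destruct (Ccont_neq_0 f z Cf Hz) as [d [Hd Hw]].
  apply Cder_Carath in Df as [q [Hq [<- Hf]]].
  apply Cder_loc with (f := fun w => / f z + (-1) * q w * / f w * / f z * (w - z)) (d := d).
  - exact Hd.
  - intros w Hwz. specialize (Hw w Hwz). pose proof (Cmod_ge_0 (f z)).
    assert (f w <> 0) by (apply Cmod_gt_0; lra).
    assert (E : q w * (w - z) = f w - f z) by (rewrite (Hf w); ring).
    transitivity (/ f z + -1 * (q w * (w - z)) * / f w * / f z); [ring |].
    rewrite E. field; split; assumption.
  - apply Cder_Carath. exists (fun w => (-1) * q w * / f w * / f z). split; [| split].
    + repeat apply Ccont_mult; try apply Ccont_const; try exact Hq. now apply Ccont_inv.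
    + field. exact Hz.
    + intros w. ring.
Qed.

Lemma Cder_scal (c : C) (f : C -> C) (z l : C) : Cder f z l -> Cder (fun w => c * f w) z (c * l).
Proof.
  intros H. eapply Cder_eq; [| exact (Cder_mult _ _ _ _ _ (Cder_const c z) H)]. cbv beta. ring.
Qed.

Lemma Cder_minus (f g : C -> C) (z k l : C) :
  Cder f z k -> Cder g z l -> Cder (fun w => f w - g w) z (k - l).
Proof.
  intros Hf Hg. apply Cder_ext with (f := fun w => f w + (-1) * g w); [intros; ring |].
  eapply Cder_eq; [| apply Cder_plus; [exact Hf | apply Cder_scal, Hg]]. ring.
Qed.

Lemma Cder_div (f g : C -> C) (z k l : C) : g z <> 0 ->
  Cder f z k -> Cder g z l -> Cder (fun w => f w / g w) z ((k * g z - f z * l) / (g z * g z)).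
Proof.
  intros Hz Hf Hg. eapply Cder_eq; [| apply (Cder_mult _ _ _ _ _ Hf (Cder_inv _ _ _ Hg Hz))].
  field. exact Hz.
Qed.

Lemma Cder_shift (f : C -> C) (c z l : C) : Cder f (z + c) l -> Cder (fun w => f (w + c)) z l.
Proof.
  intros H. apply Cder_eq with (l * (1 + 0)); [ring |].
  apply (Cder_comp f (fun w => w + c)); [| exact H].
  apply Cder_plus; [apply Cder_id | apply Cder_const].
Qed.

Lemma Cder_unique (f : C -> C) (z k l : C) : Cder f z k -> Cder f z l -> k = l.
Proof.
  intros Hk Hl. apply Ceq_small with 2%R. intros eps Heps.
  destruct (Hk eps Heps) as [d1 [Hd1 H1]]. destruct (Hl eps Heps) as [d2 [Hd2 H2]].
  set (h := (Rmin d1 d2 / 2)%R).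
  assert (Hm : (0 < Rmin d1 d2)%R) by now apply Rmin_pos.
  assert (Hh : (0 < h)%R) by (unfold h; lra).
  assert (E : Cmod (z + RtoC h - z) = h).
  { replace (z + RtoC h - z) with (RtoC h) by ring. rewrite Cmod_R. apply Rabs_right. lra. }
  specialize (H1 (z + RtoC h)). specialize (H2 (z + RtoC h)). rewrite E in H1, H2.
  specialize (H1 ltac:(pose proof (Rmin_l d1 d2); unfold h; lra)).
  specialize (H2 ltac:(pose proof (Rmin_r d1 d2); unfold h; lra)).
  apply Rmult_le_reg_r with h; [exact Hh |].
  rewrite <- E at 1. rewrite <- Cmod_mult.
  replace ((k - l) * (z + RtoC h - z))
    with ((f (z + RtoC h) - f z - l * (z + RtoC h - z))
          - (f (z + RtoC h) - f z - k * (z + RtoC h - z))) by ring.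
  pose proof (Cmod_triangle (f (z + RtoC h) - f z - l * (z + RtoC h - z))
    (- (f (z + RtoC h) - f z - k * (z + RtoC h - z)))) as T.
  rewrite Cmod_opp in T. unfold Cminus at 1. lra.
Qed.

(** * Segment integrals, Goursat's theorem and primitives *)

Lemma norm_C_R (x : C) : @norm R_AbsRing C_R_NormedModule x = Cmod x.
Proof. symmetry. exact (Cmod_norm x). Qed.

Lemma curve_dist (a b : C) (s t : R) :
  Cmod (a + RtoC s * (b - a) - (a + RtoC t * (b - a))) = (Rabs (s - t) * Cmod (b - a))%R.
Proof.
  replace (a + RtoC s * (b - a) - (a + RtoC t * (b - a))) with (RtoC (s - t) * (b - a))
    by (rewrite RtoC_minus; ring).
  now rewrite Cmod_mult, Cmod_R.
Qed.

Lemma curve_small (a b : C) (s t d : R) : (0 < d)%R ->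
  (Rabs (s - t) < d / (Cmod (b - a) + 1))%R ->
  (Cmod (a + RtoC s * (b - a) - (a + RtoC t * (b - a))) < d)%R.
Proof.
  intros Hd H. rewrite curve_dist. pose proof (Cmod_ge_0 (b - a)).
  pose proof (Rabs_pos (s - t)).
  apply Rle_lt_trans with (Rabs (s - t) * (Cmod (b - a) + 1))%R; [nra |].
  apply Rlt_le_trans with (d / (Cmod (b - a) + 1) * (Cmod (b - a) + 1))%R.
  - apply Rmult_lt_compat_r; lra.
  - right. field. lra.
Qed.

Lemma curve_continuous (f : C -> C) (a b c : C) (t : R) :
  Ccont f (a + RtoC t * (b - a)) ->
  @continuous R_UniformSpace C_R_NormedModule (fun t => c * f (a + RtoC t * (b - a))) t.
Proof.
  intros Hf. apply filterlim_locally. intros eps.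
  destruct (Ccont_mult (fun _ => c) f _ (Ccont_const c _) Hf eps (cond_pos eps))
    as [d [Hd H]].
  assert (He : (0 < d / (Cmod (b - a) + 1))%R)
    by (pose proof (Cmod_ge_0 (b - a)); apply Rdiv_lt_0_compat; lra).
  exists (mkposreal _ He). intros s Hs.
  apply C_NormedModule_mixin_compat1.
  apply (H (a + RtoC s * (b - a))), curve_small; [exact Hd | exact Hs].
Qed.

Lemma curve_is_derive (F : C -> C) (a b l : C) (t : R) :
  Cder F (a + RtoC t * (b - a)) l ->
  @is_derive R_AbsRing C_R_NormedModule (fun t => F (a + RtoC t * (b - a))) t ((b - a) * l).
Proof.
  intros HF. split; [apply is_linear_scal_l |].
  intros x Hx eps.
  apply (@is_filter_lim_locally_unique R_AbsRing (AbsRing_NormedModule R_AbsRing)) in Hx.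
  subst x. pose proof (Cmod_ge_0 (b - a)) as P.
  assert (He : (0 < eps / (Cmod (b - a) + 1))%R)
    by (apply Rdiv_lt_0_compat; [apply cond_pos | lra]).
  destruct (HF _ He) as [d [Hd H]].
  assert (Hd' : (0 < d / (Cmod (b - a) + 1))%R) by (apply Rdiv_lt_0_compat; lra).
  exists (mkposreal _ Hd'). intros s Hs. rewrite norm_C_R.
  pose proof (curve_small a b s t d Hd Hs) as Hs'. specialize (H _ Hs').
  change (Rle (Cmod (F (a + RtoC s * (b - a)) - F (a + RtoC t * (b - a))
    - @scal R_Ring C_R_ModuleSpace (s - t)%R ((b - a) * l))) (eps * Rabs (s - t))).
  rewrite curve_dist in H. rewrite scal_R_Cmult.
  replace (l * (a + RtoC s * (b - a) - (a + RtoC t * (b - a))))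
    with (RtoC (s - t) * ((b - a) * l)) in H by (rewrite RtoC_minus; ring).
  apply Rle_trans with (1 := H).
  pose proof (Rabs_pos (s - t)). pose proof (cond_pos eps).
  replace (eps / (Cmod (b - a) + 1) * (Rabs (s - t) * Cmod (b - a)))%R
    with (eps * Rabs (s - t) * (Cmod (b - a) / (Cmod (b - a) + 1)))%R by (field; lra).
  rewrite <- (Rmult_1_r (eps * Rabs (s - t))) at 2.
  apply Rmult_le_compat_l; [nra |].
  apply Rmult_le_reg_r with (Cmod (b - a) + 1)%R; [lra |].
  unfold Rdiv. rewrite Rmult_assoc, Rinv_l; lra.
Qed.

Definition seg (f : C -> C) (a b : C) : C :=
  @RInt C_R_CompleteNormedModule (fun t => (b - a) * f (a + RtoC t * (b - a))) 0 1.

Definition Ccont_seg (f : C -> C) (a b : C) : Prop :=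
  forall t : R, (0 <= t <= 1)%R -> Ccont f (a + RtoC t * (b - a)).

Lemma seg_ex_RInt (f : C -> C) (a b c : C) (u v : R) : (0 <= u <= 1)%R -> (0 <= v <= 1)%R ->
  Ccont_seg f a b ->
  @ex_RInt C_R_NormedModule (fun t => c * f (a + RtoC t * (b - a))) u v.
Proof.
  intros Hu Hv Hf.
  apply (@ex_RInt_continuous C_R_CompleteNormedModule).
  intros t Ht. apply curve_continuous, Hf.
  pose proof (Rmin_glb _ _ _ (proj1 Hu) (proj1 Hv)).
  pose proof (Rmax_lub _ _ _ (proj2 Hu) (proj2 Hv)). lra.
Qed.

Lemma seg_is_RInt (f : C -> C) (a b : C) : Ccont_seg f a b ->
  @is_RInt C_R_NormedModule (fun t => (b - a) * f (a + RtoC t * (b - a))) 0 1 (seg f a b).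
Proof.
  intros Hf. apply (@RInt_correct C_R_CompleteNormedModule).
  apply seg_ex_RInt; [lra | lra | exact Hf].
Qed.

(** The fundamental theorem of calculus with an error: [F'] only has to approximate [f] on the
    segment. A quadratic [F] gives the local estimate in Goursat's theorem, a linear one the
    derivative of a primitive. *)
Lemma seg_approx (f F F' : C -> C) (a b : C) (M : R) :
  Ccont_seg f a b -> Ccont_seg F' a b ->
  (forall t : R, (0 <= t <= 1)%R ->
     Cder F (a + RtoC t * (b - a)) (F' (a + RtoC t * (b - a))) /\
     (Cmod (f (a + RtoC t * (b - a))%C - F' (a + RtoC t * (b - a))%C) <= M)%R) ->
  (Cmod (seg f a b - (F b - F a)) <= M * Cmod (b - a))%R.
Proof.
  intros Hf HF' H.
  assert (E0 : a + RtoC 0 * (b - a) = a) by ring.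
  assert (E1 : a + RtoC 1 * (b - a) = b) by ring.
  assert (HI : @is_RInt C_R_NormedModule (fun t => (b - a) * F' (a + RtoC t * (b - a))) 0 1
    (minus (F (a + RtoC 1 * (b - a))) (F (a + RtoC 0 * (b - a))))).
  { apply (@is_RInt_derive C_R_CompleteNormedModule (fun t => F (a + RtoC t * (b - a)))).
    - intros t Ht. rewrite Rmin_left, Rmax_right in Ht by lra.
      apply curve_is_derive, H, Ht.
    - intros t Ht. rewrite Rmin_left, Rmax_right in Ht by lra.
      apply curve_continuous, HF', Ht. }
  rewrite E0, E1 in HI.
  pose proof (is_RInt_minus _ _ _ _ _ _ (seg_is_RInt f a b Hf) HI) as HJ.
  apply (@norm_RInt_le_const C_R_NormedModule _ _ _ _ (M * Cmod (b - a))%R) in HJ.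
  - rewrite norm_C_R in HJ. rewrite Rminus_0_r, Rmult_1_l in HJ. exact HJ.
  - lra.
  - intros t Ht. rewrite norm_C_R. destruct (H t Ht) as [_ Hb].
    change (Rle (Cmod ((b - a) * f (a + RtoC t * (b - a)) - (b - a) * F' (a + RtoC t * (b - a))))
      (M * Cmod (b - a))).
    replace ((b - a) * f (a + RtoC t * (b - a)) - (b - a) * F' (a + RtoC t * (b - a)))
      with ((f (a + RtoC t * (b - a)) - F' (a + RtoC t * (b - a))) * (b - a)) by ring.
    rewrite Cmod_mult. apply Rmult_le_compat_r; [apply Cmod_ge_0 | exact Hb].
Qed.

(** Brings integrals over other parameter intervals back to [[0, 1]], for reversing and halving
    segments. *)
Lemma RInt_affine (F : R -> C) (u v w : R) : w = (u + v)%R ->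
  @ex_RInt C_R_NormedModule F v w ->
  @RInt C_R_CompleteNormedModule F v w
  = @RInt C_R_CompleteNormedModule (fun t => RtoC u * F (u * t + v)%R) 0 1.
Proof.
  intros -> [l Hl]. symmetry.
  pose proof (@is_RInt_unique C_R_CompleteNormedModule _ _ _ _ Hl) as E.
  etransitivity; [| symmetry; exact E].
  apply (@is_RInt_unique C_R_CompleteNormedModule).
  apply (@is_RInt_ext C_R_NormedModule) with (f := fun y => scal u (F (u * y + v)%R)).
  - intros x _. apply scal_R_Cmult.
  - apply (@is_RInt_comp_lin C_R_NormedModule). now rewrite Rmult_0_r, Rplus_0_l, Rmult_1_r.
Qed.

Lemma seg_swap (f : C -> C) (a b : C) : Ccont_seg f a b -> seg f b a = - seg f a b.
Proof.
  intros Hf. pose proof (seg_is_RInt f a b Hf) as HI.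
  apply (@is_RInt_swap C_R_NormedModule) in HI.
  change (- seg f a b) with (@opp C_R_NormedModule (seg f a b)).
  rewrite <- (@is_RInt_unique C_R_CompleteNormedModule _ _ _ _ HI).
  rewrite (RInt_affine _ (-1)).
  - apply (@RInt_ext C_R_CompleteNormedModule). intros t _.
    change ((a - b) * f (b + RtoC t * (a - b)) =
      RtoC (-1) * ((b - a) * f (a + RtoC (-1 * t + 1)%R * (b - a)))).
    rewrite RtoC_plus, RtoC_mult.
    replace (a + (RtoC (-1) * RtoC t + RtoC 1) * (b - a)) with (b + RtoC t * (a - b)) by ring.
    ring.
  - ring.
  - eexists. exact HI.
Qed.

Lemma seg_mid (f : C -> C) (a b : C) : Ccont_seg f a b ->
  seg f a b = seg f a ((a + b) / 2) + seg f ((a + b) / 2) b.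
Proof.
  intros Hf.
  pose proof (@RInt_Chasles C_R_CompleteNormedModule
    (fun t => (b - a) * f (a + RtoC t * (b - a))) 0 (/ 2) 1
    (seg_ex_RInt f a b _ 0 (/ 2) ltac:(lra) ltac:(lra) Hf)
    (seg_ex_RInt f a b _ (/ 2) 1 ltac:(lra) ltac:(lra) Hf)) as HC.
  unfold seg at 1. rewrite <- HC.
  change plus with Cplus. f_equal.
  - rewrite (RInt_affine _ (/ 2)).
    + apply (@RInt_ext C_R_CompleteNormedModule). intros t _.
      change (RtoC (/ 2) * ((b - a) * f (a + RtoC (/ 2 * t + 0) * (b - a))) =
        ((a + b) / 2 - a) * f (a + RtoC t * ((a + b) / 2 - a))).
      rewrite RtoC_plus, RtoC_mult, RtoC_inv by lra.
      replace (a + (/ RtoC 2 * RtoC t + RtoC 0) * (b - a)) with (a + RtoC t * ((a + b) / 2 - a))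
        by field. field.
    + ring.
    + apply seg_ex_RInt; [lra | lra | exact Hf].
  - rewrite (RInt_affine _ (/ 2)).
    + apply (@RInt_ext C_R_CompleteNormedModule). intros t _.
      change (RtoC (/ 2) * ((b - a) * f (a + RtoC (/ 2 * t + / 2) * (b - a))) =
        (b - (a + b) / 2) * f ((a + b) / 2 + RtoC t * (b - (a + b) / 2))).
      rewrite RtoC_plus, RtoC_mult, RtoC_inv by lra.
      replace (a + (/ RtoC 2 * RtoC t + / RtoC 2) * (b - a))
        with ((a + b) / 2 + RtoC t * (b - (a + b) / 2)) by field. field.
    + field.
    + apply seg_ex_RInt; [lra | lra | exact Hf].
Qed.

(** * Goursat's theorem by subdivision of triangles *)

Definition convex_set (U : C -> Prop) : Prop :=
  forall a b (t : R), U a -> U b -> (0 <= t <= 1)%R -> U (a + RtoC t * (b - a)).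

Definition differentiable_on (U : C -> Prop) (f : C -> C) : Prop :=
  forall z, U z -> exists l, Cder f z l.

Lemma pow_half_pos (n : nat) : (0 < (/ 2) ^ n)%R.
Proof. apply pow_lt. lra. Qed.

Lemma pow_half_small (e : R) : (0 < e)%R -> exists n, ((/ 2) ^ n < e)%R.
Proof.
  intros He. destruct (pow_lt_1_zero (/ 2)) with (y := e) as [N HN].
  - rewrite Rabs_right; lra.
  - exact He.
  - exists N. specialize (HN N (le_n N)). rewrite Rabs_right in HN; [exact HN |].
    left. apply pow_half_pos.
Qed.

(** The intervals of radius [(/ 2) ^ n] around [u n] are nested; [L] is the supremum of their left
    ends. *)
Lemma dyadic_limit (u : nat -> R) :
  (forall n, Rabs (u (S n) - u n) <= (/ 2) ^ (S n))%R ->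
  exists L, forall n, (Rabs (u n - L) <= (/ 2) ^ n)%R.
Proof.
  intros Hu.
  assert (Hm : forall n k, (u n - (/ 2) ^ n <= u (n + k)%nat - (/ 2) ^ (n + k) /\
    u (n + k)%nat + (/ 2) ^ (n + k) <= u n + (/ 2) ^ n)%R).
  { intros n k. induction k as [| k IH].
    - rewrite Nat.add_0_r. lra.
    - rewrite Nat.add_succ_r. specialize (Hu (n + k)%nat). apply Rabs_le_between in Hu.
      simpl in Hu |- *. lra. }
  assert (Hc : forall n m, (u n - (/ 2) ^ n <= u m + (/ 2) ^ m)%R).
  { intros n m. pose proof (pow_half_pos (n + m)).
    pose proof (proj1 (Hm n m)). pose proof (proj2 (Hm m n)).
    rewrite (Nat.add_comm m n) in H1. lra. }
  destruct (completeness (fun x => exists n, x = (u n - (/ 2) ^ n)%R)) as [L [HL1 HL2]].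
  - exists (u 0%nat + (/ 2) ^ 0)%R. intros x [n ->]. apply Hc.
  - exists (u 0%nat - (/ 2) ^ 0)%R. now exists 0%nat.
  - exists L. intros n. apply Rabs_le_between.
    assert (u n - (/ 2) ^ n <= L)%R by (apply HL1; now exists n).
    assert (L <= u n + (/ 2) ^ n)%R by (apply HL2; intros x [m ->]; apply Hc).
    lra.
Qed.

(* The triple [(s, t, l)] stands for the triangle with vertices of affine coordinates
   [(s, t)], [(s + l, t)] and [(s, t + l)] in a fixed triangle; [l < 0] for the middle
   triangle of a subdivision. *)
Definition subtriangle (s t l : R) : Prop :=
  (0 <= s /\ 0 <= t /\ 0 <= s + l /\ 0 <= t + l /\ s + t <= 1 /\ s + t + l <= 1)%R.

(** Goursat's argument for an abstract additive triangle functional. One of the four pieces keeps at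
    least a quarter of the modulus, while the local bound is quadratic in the size: [4 ^ n] cancels
    [(/ 2) ^ n * (/ 2) ^ n] and only [eps] remains. *)
Lemma quadrisection (tau : R -> R -> R -> C) :
  (forall s t l, subtriangle s t l ->
     tau s t l = tau s t (l / 2)%R + tau (s + l / 2)%R t (l / 2)%R
       + tau s (t + l / 2)%R (l / 2)%R + tau (s + l / 2)%R (t + l / 2)%R (- (l / 2))%R) ->
  (forall s0 t0, (0 <= s0)%R -> (0 <= t0)%R -> (s0 + t0 <= 1)%R ->
     forall eps, (0 < eps)%R -> exists d, (0 < d)%R /\
     forall s t l, subtriangle s t l -> (Rabs (s - s0) <= Rabs l)%R ->
       (Rabs (t - t0) <= Rabs l)%R -> (Rabs l < d)%R ->
       (Cmod (tau s t l) <= eps * (Rabs l * Rabs l))%R) ->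
  tau 0%R 0%R 1%R = 0.
Proof.
  intros Hsub Hloc.
  (* Bundling each triangle with its admissibility lets choice produce a total successor function
     [next]. *)
  set (X := {p : R * R * R | subtriangle (fst (fst p)) (snd (fst p)) (snd p)}).
  set (S1 := fun x : X => fst (fst (proj1_sig x))).
  set (T1 := fun x : X => snd (fst (proj1_sig x))).
  set (L1 := fun x : X => snd (proj1_sig x)).
  set (V := fun x : X => Cmod (tau (S1 x) (T1 x) (L1 x))).
  assert (step : forall x : X, exists y : X, (V x <= 4 * V y /\ Rabs (L1 y) = Rabs (L1 x) / 2 /\
    Rabs (S1 y - S1 x) <= Rabs (L1 x) / 2 /\ Rabs (T1 y - T1 x) <= Rabs (L1 x) / 2)%R).
  { intros [[[s t] l] Hx]. unfold V, S1, T1, L1 in *. simpl in *.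
    assert (Al : (Rabs (l / 2) = Rabs l / 2)%R)
      by (unfold Rdiv; rewrite Rabs_mult, (Rabs_right (/ 2)); lra).
    assert (B0 : forall r : R, (Rabs (r - r) <= Rabs l / 2)%R)
      by (intros r; rewrite Rminus_diag, Rabs_R0; pose proof (Rabs_pos l); lra).
    assert (B1 : forall r : R, (Rabs (r + l / 2 - r) <= Rabs l / 2)%R)
      by (intros r; replace (r + l / 2 - r)%R with (l / 2)%R by ring; lra).
    assert (H1 : subtriangle s t (l / 2)) by (unfold subtriangle in *; lra).
    assert (H2 : subtriangle (s + l / 2) t (l / 2)) by (unfold subtriangle in *; lra).
    assert (H3 : subtriangle s (t + l / 2) (l / 2)) by (unfold subtriangle in *; lra).
    assert (H4 : subtriangle (s + l / 2) (t + l / 2) (- (l / 2)))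
      by (unfold subtriangle in *; lra).
    assert (HT : (Cmod (tau s t l) <= Cmod (tau s t (l / 2)%R) + Cmod (tau (s + l / 2)%R t (l / 2)%R)
      + Cmod (tau s (t + l / 2)%R (l / 2)%R)
      + Cmod (tau (s + l / 2)%R (t + l / 2)%R (- (l / 2))%R))%R).
    { rewrite (Hsub s t l Hx).
      eapply Rle_trans; [apply Cmod_triangle |]. apply Rplus_le_compat_r.
      eapply Rle_trans; [apply Cmod_triangle |]. apply Rplus_le_compat_r.
      apply Cmod_triangle. }
    destruct (Rle_dec (Cmod (tau s t l)) (4 * Cmod (tau s t (l / 2)%R))) as [Y | N1].
    { exists (exist _ (s, t, (l / 2)%R) H1). simpl. auto. }
    destruct (Rle_dec (Cmod (tau s t l)) (4 * Cmod (tau (s + l / 2)%R t (l / 2)%R))) as [Y | N2].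
    { exists (exist _ ((s + l / 2)%R, t, (l / 2)%R) H2). simpl. auto. }
    destruct (Rle_dec (Cmod (tau s t l)) (4 * Cmod (tau s (t + l / 2)%R (l / 2)%R))) as [Y | N3].
    { exists (exist _ (s, (t + l / 2)%R, (l / 2)%R) H3). simpl. auto. }
    (* If the three corner pieces are all below a quarter, the triangle inequality leaves the middle
       one. *)
    exists (exist _ ((s + l / 2)%R, (t + l / 2)%R, (- (l / 2))%R) H4). simpl.
    rewrite Rabs_Ropp. repeat split; auto. lra. }
  set (next := fun x => proj1_sig (constructive_indefinite_description _ (step x))).
  assert (Hnext : forall x, (V x <= 4 * V (next x) /\ Rabs (L1 (next x)) = Rabs (L1 x) / 2 /\
    Rabs (S1 (next x) - S1 x) <= Rabs (L1 x) / 2 /\ Rabs (T1 (next x) - T1 x) <= Rabs (L1 x) / 2)%R)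
    by (intros x; exact (proj2_sig (constructive_indefinite_description _ (step x)))).
  assert (Hx0 : subtriangle 0 0 1) by (unfold subtriangle; lra).
  set (x := fun n => Nat.iter n next (exist _ (0%R, 0%R, 1%R) Hx0 : X)).
  assert (HL : forall n, Rabs (L1 (x n)) = ((/ 2) ^ n)%R).
  { induction n as [| n IH].
    - unfold L1, x. simpl. apply Rabs_R1.
    - simpl. rewrite (proj1 (proj2 (Hnext (x n)))). rewrite IH. field. }
  assert (HV : forall n, (V (x 0%nat) <= 4 ^ n * V (x n))%R).
  { induction n as [| n IH]; [simpl; lra |].
    apply Rle_trans with (1 := IH). simpl. pose proof (proj1 (Hnext (x n))).
    replace (4 * 4 ^ n * V (next (x n)))%R with (4 ^ n * (4 * V (next (x n))))%R by ring.
    apply Rmult_le_compat_l; [apply pow_le; lra | exact H]. }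
  destruct (dyadic_limit (fun n => S1 (x n))) as [s0 Hs0].
  { intros n. eapply Rle_trans; [apply (proj1 (proj2 (proj2 (Hnext (x n))))) |].
    rewrite HL. simpl. lra. }
  destruct (dyadic_limit (fun n => T1 (x n))) as [t0 Ht0].
  { intros n. eapply Rle_trans; [apply (proj2 (proj2 (proj2 (Hnext (x n))))) |].
    rewrite HL. simpl. lra. }
  assert (Hin : forall n, subtriangle (S1 (x n)) (T1 (x n)) (L1 (x n)))
    by (intros n; exact (proj2_sig (x n))).
  assert (lim0 : forall r, (forall n, - (2 * (/ 2) ^ n) <= r)%R -> (0 <= r)%R).
  { intros r Hr. destruct (Rle_lt_dec 0 r) as [| Hneg]; [assumption |].
    destruct (pow_half_small (- r / 2) ltac:(lra)) as [n Hn]. specialize (Hr n). lra. }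
  assert (P1 : (0 <= s0)%R).
  { apply lim0. intros n. specialize (Hs0 n). apply Rabs_le_between in Hs0.
    destruct (Hin n). pose proof (pow_half_pos n). lra. }
  assert (P2 : (0 <= t0)%R).
  { apply lim0. intros n. specialize (Ht0 n). apply Rabs_le_between in Ht0.
    destruct (Hin n) as (_ & ? & _). pose proof (pow_half_pos n). lra. }
  assert (P3 : (0 <= 1 - s0 - t0)%R).
  { apply lim0. intros n. specialize (Ht0 n). specialize (Hs0 n).
    apply Rabs_le_between in Ht0. apply Rabs_le_between in Hs0.
    destruct (Hin n) as (_ & _ & _ & _ & ? & _). lra. }
  apply Ceq_small with 1%R. intros eps Heps.
  replace (tau 0%R 0%R 1%R - 0) with (tau 0%R 0%R 1%R) by ring.
  destruct (Hloc s0 t0 P1 P2 ltac:(lra) eps Heps) as [d [Hd H]].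
  destruct (pow_half_small d Hd) as [n Hn].
  rewrite <- HL in Hn. specialize (H _ _ _ (Hin n)).
  rewrite !HL in H. rewrite HL in Hn. specialize (H (Hs0 n) (Ht0 n) Hn).
  specialize (HV n). change (V (x 0%nat)) with (Cmod (tau 0%R 0%R 1%R)) in HV.
  apply Rle_trans with (1 := HV).
  apply Rle_trans with (4 ^ n * (eps * ((/ 2) ^ n * (/ 2) ^ n)))%R.
  - apply Rmult_le_compat_l; [apply pow_le; lra | exact H].
  - right. rewrite <- Rpow_mult_distr.
    replace (4 ^ n * (eps * (/ 2 * / 2) ^ n))%R with (eps * (4 ^ n * (/ 2 * / 2) ^ n))%R by ring.
    rewrite <- Rpow_mult_distr. replace (4 * (/ 2 * / 2))%R with 1%R by field.
    rewrite pow1. ring.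
Qed.

Lemma curve_ball (a b p : C) (t r : R) : (0 <= t <= 1)%R ->
  (Cmod (a - p) <= r)%R -> (Cmod (b - p) <= r)%R ->
  (Cmod (a + RtoC t * (b - a) - p) <= r)%R.
Proof.
  intros Ht Ha Hb.
  replace (a + RtoC t * (b - a) - p) with (RtoC (1 - t) * (a - p) + RtoC t * (b - p))
    by (rewrite RtoC_minus; ring).
  eapply Rle_trans; [apply Cmod_triangle |].
  rewrite !Cmod_mult, !Cmod_R, !Rabs_right by lra. nra.
Qed.

(** Near [p] the function is affine up to [eps * r], and the increments of the quadratic primitive
    of the affine part cancel around a triangle. The factor 2 comes from [Cmod (b - a) <= 2 * r]. *)
Lemma seg_local (f : C -> C) (a b p l : C) (d eps r : R) : (0 < eps)%R ->
  (forall w, (Cmod (w - p) < d)%R ->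
     (Cmod (f w - f p - l * (w - p)) <= eps * Cmod (w - p))%R) ->
  (Cmod (a - p) <= r)%R -> (Cmod (b - p) <= r)%R -> (r < d)%R -> Ccont_seg f a b ->
  (Cmod (seg f a b - ((f p * b + l / 2 * ((b - p) * (b - p)))
      - (f p * a + l / 2 * ((a - p) * (a - p))))) <= 2 * eps * (r * r))%R.
Proof.
  intros Heps Hf Ha Hb Hr Hc.
  pose proof (seg_approx f (fun z => f p * z + l / 2 * ((z - p) * (z - p)))
    (fun z => f p + l * (z - p)) a b (eps * r) Hc) as H.
  eapply Rle_trans; [apply H |].
  - intros t _. apply Ccont_plus; [apply Ccont_const |].
    apply Ccont_mult; [apply Ccont_const |]. apply Ccont_plus; [apply Ccont_id | apply Ccont_const].
  - intros t Ht. split.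
    + set (z := a + RtoC t * (b - a)).
      assert (D : Cder (fun z => z - p) z (1 - 0)) by (apply Cder_minus; [apply Cder_id | apply Cder_const]).
      eapply Cder_eq; [| apply Cder_plus; apply Cder_scal; [apply Cder_id | exact (Cder_mult _ _ _ _ _ D D)]].
      cbv beta. field.
    + pose proof (curve_ball a b p t r Ht Ha Hb) as Hz.
      set (z := a + RtoC t * (b - a)) in *.
      replace (f z - (f p + l * (z - p))) with (f z - f p - l * (z - p)) by ring.
      eapply Rle_trans; [apply Hf; lra |]. apply Rmult_le_compat_l; lra.
  - pose proof (Cmod_triangle_minus b p a) as Hba. rewrite (Cmod_minus_sym p a) in Hba.
    pose proof (Cmod_ge_0 (a - p)).
    replace (2 * eps * (r * r))%R with (eps * r * (2 * r))%R by ring.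
    apply Rmult_le_compat_l; [apply Rmult_le_pos |]; lra.
Qed.

Lemma goursat (U : C -> Prop) (f : C -> C) (a b c : C) :
  convex_set U -> differentiable_on U f -> U a -> U b -> U c ->
  seg f a b + seg f b c + seg f c a = 0.
Proof.
  intros HU Hf Ha Hb Hc.
  assert (Hcs : forall x y, U x -> U y -> Ccont_seg f x y).
  { intros x y Hx Hy t Ht. destruct (Hf _ (HU x y t Hx Hy Ht)) as [l Hl].
    exact (Cder_cont _ _ _ Hl). }
  set (P := fun s t : R => a + RtoC s * (b - a) + RtoC t * (c - a)).
  assert (HP : forall s t, (0 <= s)%R -> (0 <= t)%R -> (s + t <= 1)%R -> U (P s t)).
  (* A point of the triangle lies on a segment from [a] to a point of the side from [b] to [c], so
     convexity is used twice; [s + t = 0] is the vertex [a], where that point is undetermined. *)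
  { intros s t Hs Ht Hst. destruct (Req_dec (s + t) 0) as [E | N].
    - unfold P. replace s with 0%R by lra. replace t with 0%R by lra.
      replace (a + RtoC 0 * (b - a) + RtoC 0 * (c - a)) with a by ring. exact Ha.
    - assert (Hq : U (b + RtoC (t / (s + t)) * (c - b))).
      { apply HU; [assumption | assumption | split].
        - apply Rdiv_le_0_compat; lra.
        - apply Rmult_le_reg_r with (s + t)%R; [lra |].
          unfold Rdiv. rewrite Rmult_assoc, Rinv_l; lra. }
      pose proof (HU a _ (s + t)%R Ha Hq ltac:(lra)) as H.
      replace (P s t) with (a + RtoC (s + t) * (b + RtoC (t / (s + t)) * (c - b) - a)); [exact H |].
      unfold P. rewrite RtoC_div, RtoC_plus by exact N.
      field. rewrite <- RtoC_plus. intros E. now apply RtoC_inj in E. }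
  set (tau := fun s t l : R => seg f (P s t) (P (s + l)%R t) + seg f (P (s + l)%R t) (P s (t + l)%R)
    + seg f (P s (t + l)%R) (P s t)).
  assert (P0 : P 0%R 0%R = a) by (unfold P; ring).
  assert (Pb : P (0 + 1)%R 0%R = b) by (unfold P; rewrite Rplus_0_l; ring).
  assert (Pc : P 0%R (0 + 1)%R = c) by (unfold P; rewrite Rplus_0_l; ring).
  transitivity (tau 0%R 0%R 1%R); [unfold tau; now rewrite P0, Pb, Pc |].
  apply quadrisection.
  - intros s t l Hstl. unfold subtriangle in Hstl. unfold tau.
    assert (R2 : RtoC 2 <> 0) by (intros E; apply RtoC_inj in E; lra).
    assert (E1 : (P s t + P (s + l)%R t) / 2 = P (s + l / 2)%R t).
    { unfold P. rewrite !RtoC_plus, RtoC_div by lra. field. }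
    assert (E2 : (P (s + l)%R t + P s (t + l)%R) / 2 = P (s + l / 2)%R (t + l / 2)%R).
    { unfold P. rewrite !RtoC_plus, RtoC_div by lra. field. }
    assert (E3 : (P s (t + l)%R + P s t) / 2 = P s (t + l / 2)%R).
    { unfold P. rewrite !RtoC_plus, RtoC_div by lra. field. }
    replace (s + l / 2 + l / 2)%R with (s + l)%R by field.
    replace (t + l / 2 + l / 2)%R with (t + l)%R by field.
    replace (s + l / 2 + - (l / 2))%R with s by field.
    replace (t + l / 2 + - (l / 2))%R with t by field.
    assert (UA : U (P s t)) by (apply HP; lra).
    assert (UB : U (P (s + l)%R t)) by (apply HP; lra).
    assert (UC : U (P s (t + l)%R)) by (apply HP; lra).
    assert (UM1 : U (P (s + l / 2)%R t)) by (apply HP; lra).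
    assert (UM2 : U (P (s + l / 2)%R (t + l / 2)%R)) by (apply HP; lra).
    assert (UM3 : U (P s (t + l / 2)%R)) by (apply HP; lra).
    rewrite (seg_mid f (P s t) (P (s + l)%R t)), (seg_mid f (P (s + l)%R t)),
      (seg_mid f (P s (t + l)%R)) by now apply Hcs.
    rewrite E1, E2, E3.
    rewrite (seg_swap f (P s (t + l / 2)%R) (P (s + l / 2)%R t)) by now apply Hcs.
    rewrite (seg_swap f (P (s + l / 2)%R t) (P (s + l / 2)%R (t + l / 2)%R)) by now apply Hcs.
    rewrite (seg_swap f (P s (t + l / 2)%R) (P (s + l / 2)%R (t + l / 2)%R)) by now apply Hcs.
    ring.
  - intros s0 t0 Hs0 Ht0 Hst eps Heps.
    destruct (Hf _ (HP s0 t0 Hs0 Ht0 Hst)) as [l0 Hl0].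
    set (D := (Cmod (b - a) + Cmod (c - a) + 1)%R).
    pose proof (Cmod_ge_0 (b - a)) as Pba. pose proof (Cmod_ge_0 (c - a)) as Pca.
    assert (HD : (0 < D)%R) by (unfold D; lra).
    (* [24 = 3 * 2 * 4]: three sides, the factor 2 of [seg_local], and the square of the 2 in the
       radius [2 * (Rabs l * D)]. *)
    destruct (Hl0 (eps / (24 * (D * D)))%R ltac:(apply Rdiv_lt_0_compat; nra)) as [d [Hd H]].
    exists (d / (2 * D))%R. split; [apply Rdiv_lt_0_compat; lra |].
    intros s t l Hstl Hs Ht Hl. unfold subtriangle in Hstl.
    pose proof (Rabs_pos l) as Pl.
    assert (HlD : (2 * (Rabs l * D) < d)%R).
    { apply Rmult_lt_compat_r with (r := (2 * D)%R) in Hl; [| lra].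
      replace (d / (2 * D) * (2 * D))%R with d in Hl by (field; lra). lra. }
    assert (HPd : forall s' t', (Rabs (s' - s0) <= 2 * Rabs l)%R -> (Rabs (t' - t0) <= 2 * Rabs l)%R ->
      (Cmod (P s' t' - P s0 t0) <= 2 * (Rabs l * D))%R).
    { intros s' t' H1 H2.
      replace (P s' t' - P s0 t0) with (RtoC (s' - s0) * (b - a) + RtoC (t' - t0) * (c - a))
        by (unfold P; rewrite !RtoC_minus; ring).
      eapply Rle_trans; [apply Cmod_triangle |]. rewrite !Cmod_mult, !Cmod_R. unfold D. nra. }
    assert (Hsl : (Rabs (s + l - s0) <= 2 * Rabs l)%R).
    { replace (s + l - s0)%R with ((s - s0) + l)%R by ring.
      pose proof (Rabs_triang (s - s0) l). lra. }
    assert (Htl : (Rabs (t + l - t0) <= 2 * Rabs l)%R).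
    { replace (t + l - t0)%R with ((t - t0) + l)%R by ring.
      pose proof (Rabs_triang (t - t0) l). lra. }
    assert (DA : (Cmod (P s t - P s0 t0) <= 2 * (Rabs l * D))%R) by (apply HPd; lra).
    assert (DB : (Cmod (P (s + l)%R t - P s0 t0) <= 2 * (Rabs l * D))%R) by (apply HPd; lra).
    assert (DC : (Cmod (P s (t + l)%R - P s0 t0) <= 2 * (Rabs l * D))%R) by (apply HPd; lra).
    assert (UA : U (P s t)) by (apply HP; lra).
    assert (UB : U (P (s + l)%R t)) by (apply HP; lra).
    assert (UC : U (P s (t + l)%R)) by (apply HP; lra).
    assert (He : (0 < eps / (24 * (D * D)))%R) by (apply Rdiv_lt_0_compat; nra).
    pose proof (seg_local f _ _ _ l0 d _ _ He H DA DB HlD (Hcs _ _ UA UB)) as S1.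
    pose proof (seg_local f _ _ _ l0 d _ _ He H DB DC HlD (Hcs _ _ UB UC)) as S2.
    pose proof (seg_local f _ _ _ l0 d _ _ He H DC DA HlD (Hcs _ _ UC UA)) as S3.
    unfold tau.
    replace (eps * (Rabs l * Rabs l))%R with
      (3 * (2 * (eps / (24 * (D * D))) * (2 * (Rabs l * D) * (2 * (Rabs l * D)))))%R by (field; lra).
    match type of S1 with (Cmod ?x <= _)%R => set (x1 := x) in * end.
    match type of S2 with (Cmod ?x <= _)%R => set (x2 := x) in * end.
    match type of S3 with (Cmod ?x <= _)%R => set (x3 := x) in * end.
    match goal with |- (Cmod ?x <= _)%R => replace x with (x1 + x2 + x3) by (unfold x1, x2, x3; ring) end.
    pose proof (Cmod_triangle (x1 + x2) x3). pose proof (Cmod_triangle x1 x2). lra.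
Qed.

(** Integrate from a base point [z0]. Goursat's theorem on the triangle [z0], [z], [w] turns the
    increment of the integral into [seg f z w], which continuity of [f] at [z] compares with
    [f z * (w - z)]. *)
Lemma primitive (U : C -> Prop) (f : C -> C) :
  open U -> convex_set U -> differentiable_on U f ->
  exists F, forall z, U z -> Cder F z (f z).
Proof.
  intros HO HU Hf.
  destruct (classic (exists z0, U z0)) as [[z0 Hz0] | N].
  2: { exists (fun _ => 0). intros z Hz. contradiction N. now exists z. }
  assert (Hcs : forall x y, U x -> U y -> Ccont_seg f x y).
  { intros x y Hx Hy t Ht. destruct (Hf _ (HU x y t Hx Hy Ht)) as [l Hl].
    exact (Cder_cont _ _ _ Hl). }
  exists (fun z => seg f z0 z). intros z Hz eps Heps.
  destruct (Hf z Hz) as [l Hl]. destruct (Cder_cont _ _ _ Hl eps Heps) as [d1 [Hd1 H1]].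
  destruct (open_C U z HO Hz) as [d2 [Hd2 H2]].
  exists (Rmin d1 d2). split; [now apply Rmin_pos |]. intros w Hw.
  assert (Uw : U w) by (apply H2, Rlt_le_trans with (1 := Hw), Rmin_r).
  replace (seg f z0 w - seg f z0 z) with (seg f z w).
  2: { pose proof (goursat U f z0 z w HU Hf Hz0 Hz Uw) as G.
       rewrite (seg_swap f z0 w) in G by now apply Hcs.
       replace (seg f z w) with (seg f z0 z + seg f z w + - seg f z0 w + (seg f z0 w - seg f z0 z)) by ring.
       rewrite G. ring. }
  replace (seg f z w - f z * (w - z)) with (seg f z w - (f z * w - f z * z)) by ring.
  apply (seg_approx f (fun v => f z * v) (fun _ => f z)).
  - now apply Hcs.
  - intros t _. apply Ccont_const.
  - intros t Ht. split.
    + eapply Cder_eq; [| apply Cder_scal, Cder_id]. ring.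
    + left. apply H1. apply Rle_lt_trans with (Cmod (w - z)).
      * apply curve_ball; [exact Ht | | lra].
        replace (z - z) with (RtoC 0) by ring. rewrite Cmod_0. apply Cmod_ge_0.
      * apply Rlt_le_trans with (1 := Hw), Rmin_l.
Qed.

(** The real mean value theorem applies to the component of [F] in the direction [u = F b - F a],
    whose increment is the square of [Cmod u]. Unlike [seg_approx], this asks for no continuity of
    [F']. *)
Lemma mean_value_ineq (F F' : C -> C) (a b : C) (M : R) :
  (forall t : R, (0 <= t <= 1)%R ->
     Cder F (a + RtoC t * (b - a)) (F' (a + RtoC t * (b - a))) /\
     (Cmod (F' (a + RtoC t * (b - a))%C) <= M)%R) ->
  (Cmod (F b - F a) <= M * Cmod (b - a))%R.
Proof.
  intros H. set (u := F b - F a).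
  set (g := fun t : R => Re (Cconj u * F (a + RtoC t * (b - a)))).
  set (dg := fun t : R => Re ((b - a) * (Cconj u * F' (a + RtoC t * (b - a))))).
  assert (Hg : forall t, (0 <= t <= 1)%R -> is_derive g t (dg t)).
  { intros t Ht.
    pose proof (curve_is_derive (fun z => Cconj u * F z) a b _ t
      (Cder_scal (Cconj u) F _ _ (proj1 (H t Ht)))) as D.
    apply (filterdiff_comp' _ (fst : C_R_NormedModule -> R_NormedModule) t _ _ D
      (filterdiff_linear _ is_linear_fst)). }
  destruct (MVT_gen g 0 1 dg) as [t [Ht E]].
  - intros t Ht. rewrite Rmin_left, Rmax_right in Ht by lra. apply Hg. lra.
  - intros t Ht. rewrite Rmin_left, Rmax_right in Ht by lra.
    apply continuity_pt_filterlim, (ex_derive_continuous g). eexists. apply Hg. lra.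
  - rewrite Rmin_left, Rmax_right in Ht by lra.
    assert (E' : (g 1 - g 0 = Cmod u * Cmod u)%R).
    { unfold g. replace (a + RtoC 1 * (b - a)) with b by ring.
      replace (a + RtoC 0 * (b - a)) with a by ring.
      transitivity (Re (Cconj u * u)).
      - replace (Cconj u * u) with (Cconj u * F b + - (Cconj u * F a)) by (unfold u; ring).
        rewrite re_plus, re_opp. ring.
      - rewrite Cmult_comm, <- Cmod2_conj, re_RtoC. ring. }
    rewrite E' in E. clear E'. rewrite Rminus_0_r, Rmult_1_r in E.
    pose proof (re_le_Cmod ((b - a) * (Cconj u * F' (a + RtoC t * (b - a))))) as B.
    rewrite !Cmod_mult, Cmod_conj in B. destruct (H t Ht) as [_ HM].
    pose proof (Rle_abs (dg t)) as B'. unfold dg in B' at 2.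
    pose proof (Cmod_ge_0 (b - a)). pose proof (Cmod_ge_0 u).
    assert (Cmod (b - a) * (Cmod u * Cmod (F' (a + RtoC t * (b - a))%C)) <= Cmod (b - a) * (Cmod u * M))%R
      by (repeat (apply Rmult_le_compat_l; [assumption |]); exact HM).
    destruct (Req_dec (Cmod u) 0) as [Z | NZ].
    + rewrite Z. apply Rmult_le_pos; [| assumption].
      apply Rle_trans with (2 := HM), Cmod_ge_0.
    + apply Rmult_le_reg_l with (Cmod u); lra.
Qed.

Lemma constant_of_Cder_0 (U : C -> Prop) (F : C -> C) (a b : C) :
  convex_set U -> (forall z, U z -> Cder F z 0) -> U a -> U b -> F a = F b.
Proof.
  intros HU HF Ha Hb. apply Ceq_small with 1%R. intros eps Heps.
  eapply Rle_trans; [apply (mean_value_ineq F (fun _ => 0) b a 0) |].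
  - intros t Ht. split; [apply HF, HU; assumption | rewrite Cmod_0; lra].
  - lra.
Qed.

(** * Cauchy's estimates *)

Definition Cexp (z : C) : C := RtoC (exp (Re z)) * (cos (Im z), sin (Im z)).

Definition i2pi : C := RtoC (2 * PI) * Ci.

Lemma Cexp_plus (a b : C) : Cexp (a + b) = Cexp a * Cexp b.
Proof.
  unfold Cexp. rewrite re_plus, im_plus, exp_plus, RtoC_mult.
  replace ((cos (Im a + Im b), sin (Im a + Im b)) : C)
    with ((cos (Im a), sin (Im a)) * (cos (Im b), sin (Im b))).
  - ring.
  - rewrite cos_plus, sin_plus. unfold Cmult; simpl. f_equal; ring.
Qed.

Lemma Cmod_Cexp (z : C) : Cmod (Cexp z) = exp (Re z).
Proof.
  unfold Cexp. rewrite Cmod_mult, Cmod_R, Rabs_right by (left; apply exp_pos).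
  replace (Cmod (cos (Im z), sin (Im z))) with 1%R; [ring |].
  unfold Cmod; simpl. replace (cos (Im z) * (cos (Im z) * 1) + sin (Im z) * (sin (Im z) * 1))%R
    with (Rsqr (sin (Im z)) + Rsqr (cos (Im z)))%R by (unfold Rsqr; ring).
  now rewrite sin2_cos2, sqrt_1.
Qed.

Lemma Cexp_0 : Cexp 0 = 1.
Proof. unfold Cexp, Re, Im; simpl. rewrite exp_0, cos_0, sin_0. apply Cmult_1_l. Qed.

Lemma Cexp_opp (z : C) : Cexp z * Cexp (- z) = 1.
Proof. rewrite <- Cexp_plus. replace (z + - z) with (RtoC 0) by ring. apply Cexp_0. Qed.

Lemma Cexp_i2pi : Cexp i2pi = 1.
Proof.
  unfold Cexp, i2pi, Ci, Re, Im; simpl.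
  replace (2 * PI * 0 - 0 * 1)%R with 0%R by ring.
  replace (2 * PI * 1 + 0 * 0)%R with (2 * PI)%R by ring.
  rewrite exp_0, cos_2PI, sin_2PI. apply Cmult_1_l.
Qed.

Lemma Cexp_period (z : C) : Cexp (z + i2pi) = Cexp z.
Proof. rewrite Cexp_plus, Cexp_i2pi. ring. Qed.

Lemma Cmod_i2pi : Cmod i2pi = (2 * PI)%R.
Proof.
  unfold i2pi. rewrite Cmod_mult, Cmod_R, Cmod_Ci, Rmult_1_r.
  apply Rabs_right. pose proof PI_RGT_0. lra.
Qed.

Lemma i2pi_neq_0 : i2pi <> 0.
Proof. apply Cmod_gt_0. rewrite Cmod_i2pi. pose proof PI_RGT_0. lra. Qed.

Lemma derivable_pt_lim_at_0 (f : R -> R) (l : R) : derivable_pt_lim f 0 l ->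
  forall eps : R, (0 < eps)%R -> exists d : R, (0 < d)%R /\
    forall x, (Rabs x < d)%R -> (Rabs (f x - f 0 - l * x) <= eps * Rabs x)%R.
Proof.
  intros H eps Heps. destruct (H eps Heps) as [d Hd]. exists d. split; [apply cond_pos |].
  intros x Hx. destruct (Req_dec x 0) as [-> | N].
  - replace (f 0 - f 0 - l * 0)%R with 0%R by ring. rewrite Rabs_R0. lra.
  - specialize (Hd x N Hx). rewrite Rplus_0_l in Hd.
    replace (f x - f 0 - l * x)%R with (((f x - f 0) / x - l) * x)%R by (field; exact N).
    rewrite Rabs_mult. apply Rmult_le_compat_r; [apply Rabs_pos | lra].
Qed.

Lemma Cder_Cexp_0 : Cder Cexp 0 1.
Proof.
  intros eps Heps.
  destruct (derivable_pt_lim_at_0 exp 1 derivable_pt_lim_exp_0 (eps / 8)%R ltac:(lra)) as [d1 [Hd1 H1]].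
  destruct (derivable_pt_lim_at_0 cos 0) with (eps := (eps / 8)%R) as [d2 [Hd2 H2]].
  { pose proof (derivable_pt_lim_cos 0) as D. rewrite sin_0, Ropp_0 in D. exact D. }
  { lra. }
  destruct (derivable_pt_lim_at_0 sin 1) with (eps := (eps / 8)%R) as [d3 [Hd3 H3]].
  { pose proof (derivable_pt_lim_sin 0) as D. rewrite cos_0 in D. exact D. }
  { lra. }
  (* The bound 1 keeps [Rabs (1 + x) <= 2], and [eps / 8] controls the mixed term [x * y] below. *)
  exists (Rmin (Rmin 1 (eps / 8)) (Rmin d1 (Rmin d2 d3))). split.
  { repeat apply Rmin_pos; lra. }
  intros h Hh. replace (h - 0) with h in * by ring.
  pose proof (Rmin_l (Rmin 1 (eps / 8)) (Rmin d1 (Rmin d2 d3))).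
  pose proof (Rmin_r (Rmin 1 (eps / 8)) (Rmin d1 (Rmin d2 d3))).
  pose proof (Rmin_l 1 (eps / 8)). pose proof (Rmin_r 1 (eps / 8)).
  pose proof (Rmin_l d1 (Rmin d2 d3)). pose proof (Rmin_r d1 (Rmin d2 d3)).
  pose proof (Rmin_l d2 d3). pose proof (Rmin_r d2 d3).
  pose proof (re_le_Cmod h) as Bx. pose proof (im_le_Cmod h) as By.
  rewrite Cexp_0. set (x := Re h) in *. set (y := Im h) in *. set (m := Cmod h) in *.
  specialize (H1 x ltac:(lra)). specialize (H2 y ltac:(lra)). specialize (H3 y ltac:(lra)).
  rewrite exp_0 in H1. rewrite cos_0 in H2. rewrite sin_0 in H3.
  set (u := (cos y, sin y) : C).
  assert (Eh : h = RtoC x + RtoC y * Ci)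
    by (unfold x, y, Re, Im, RtoC, Ci, Cplus, Cmult; destruct h; simpl; f_equal; ring).
  (* The three terms are the error of the real exponential, the error of [cos y + i sin y], and a
     product of second order. *)
  replace (Cexp h - 1 - 1 * h) with
    (RtoC (exp x - 1 - x) * u + (RtoC (1 + x) * (u - 1 - RtoC y * Ci) + RtoC x * RtoC y * Ci)).
  2: { change (Cexp h) with (RtoC (exp x) * u). rewrite !RtoC_minus, RtoC_plus, Cmult_1_l, Eh. ring. }
  eapply Rle_trans; [apply Cmod_triangle |].
  eapply Rle_trans; [apply Rplus_le_compat_l, Cmod_triangle |].
  rewrite !Cmod_mult, !Cmod_R, Cmod_Ci.
  assert (Hu : Cmod u = 1%R).
  { pose proof (Cmod_Cexp (0, y)) as E. unfold Cexp, Re, Im in E; simpl in E. fold u in E.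
    rewrite Cmod_mult, Cmod_R, exp_0, Rabs_R1, Rmult_1_l in E. exact E. }
  rewrite Hu.
  assert (Hu' : (Cmod (u - 1 - RtoC y * Ci) <= eps / 4 * m)%R).
  { eapply Rle_trans; [apply Cmod_le_re_im |].
    unfold u, Re, Im, Ci, RtoC, Cminus, Cplus, Copp, Cmult; simpl.
    replace (cos y + - (1) + - (y * 0 - 0 * 1))%R with (cos y - 1 - 0 * y)%R by ring.
    replace (sin y + -0 + - (y * 1 + 0 * 0))%R with (sin y - 0 - 1 * y)%R by ring. nra. }
  assert (Ha : (Rabs (1 + x) <= 2)%R)
    by (pose proof (Rabs_triang 1 x); rewrite Rabs_R1 in *; lra).
  assert (P0 : (0 <= m)%R) by apply Cmod_ge_0.
  replace (exp x - 1 - x)%R with (exp x - 1 - 1 * x)%R by ring.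
  pose proof (Rabs_pos x). pose proof (Rabs_pos y). pose proof (Rabs_pos (1 + x)).
  pose proof (Cmod_ge_0 (u - 1 - RtoC y * Ci)).
  assert (Rabs (exp x - 1 - 1 * x) <= eps / 8 * m)%R by nra.
  assert (Rabs (1 + x) * Cmod (u - 1 - RtoC y * Ci) <= 2 * (eps / 4 * m))%R
    by (apply Rmult_le_compat; lra).
  assert (Rabs x * Rabs y <= eps / 8 * m)%R by (apply Rmult_le_compat; lra).
  lra.
Qed.

Lemma Cder_Cexp (z : C) : Cder Cexp z (Cexp z).
Proof.
  apply Cder_ext with (f := fun w => Cexp z * Cexp (w + - z)).
  - intros w. rewrite <- Cexp_plus. f_equal. ring.
  - eapply Cder_eq; [| apply Cder_scal, Cder_shift].
    2: { replace (z + - z) with (RtoC 0) by ring. apply Cder_Cexp_0. }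
    ring.
Qed.

Lemma Cder_Cexp_comp (f : C -> C) (z l : C) :
  Cder f z l -> Cder (fun w => Cexp (f w)) z (Cexp (f z) * l).
Proof. intros H. apply (Cder_comp Cexp f); [exact H | apply Cder_Cexp]. Qed.

(** * Circles in the logarithmic coordinate *)

Definition left_half_plane (s : R) (u : C) : Prop := (Re u < s)%R.

Lemma left_half_plane_open (s : R) : open (left_half_plane s).
Proof.
  intros u Hu. apply locally_C_Cmod. exists (s - Re u)%R. unfold left_half_plane in *.
  split; [lra |]. intros w Hw. pose proof (re_le_Cmod (w - u)) as H.
  unfold Cminus in H. rewrite re_plus, re_opp in H.
  pose proof (Rle_abs (Re w + - Re u)). unfold Cminus in Hw. lra.
Qed.

Lemma Re_curve (a b : C) (t : R) : Re (a + RtoC t * (b - a)) = ((1 - t) * Re a + t * Re b)%R.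
Proof. unfold Cminus. rewrite re_plus, re_scal_l, re_plus, re_opp. ring. Qed.

Lemma Im_curve (a b : C) (t : R) : Im (a + RtoC t * (b - a)) = ((1 - t) * Im a + t * Im b)%R.
Proof. unfold Cminus. rewrite im_plus, im_scal_l, im_plus, im_opp. ring. Qed.

Lemma left_half_plane_convex (s : R) : convex_set (left_half_plane s).
Proof.
  intros a b t Ha Hb Ht. unfold left_half_plane in *. rewrite Re_curve.
  destruct (Req_dec t 0) as [-> | N]; [lra |]. nra.
Qed.

Lemma Re_i2pi : Re i2pi = 0%R.
Proof. unfold i2pi. rewrite re_mult_Ci, im_RtoC. ring. Qed.

Lemma Re_plus_i2pi (u : C) : Re (u + i2pi) = Re u.
Proof. rewrite re_plus, Re_i2pi. ring. Qed.

Lemma Re_vertical (u : C) (t : R) : Re (u + RtoC t * (u + i2pi - u)) = Re u.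
Proof. rewrite Re_curve, Re_plus_i2pi. ring. Qed.

Lemma vertical_dist (u : C) : Cmod (u + i2pi - u) = (2 * PI)%R.
Proof. replace (u + i2pi - u) with i2pi by ring. apply Cmod_i2pi. Qed.

(** This plays the part of deforming a circle centred at [a] into a smaller one: [Re u] is the
    logarithm of the radius. *)
Lemma period_constant (s : R) (G g : C -> C) (u v : C) :
  (forall w, left_half_plane s w -> Cder G w (g w)) ->
  (forall w, g (w + i2pi) = g w) ->
  left_half_plane s u -> left_half_plane s v ->
  G (u + i2pi) - G u = G (v + i2pi) - G v.
Proof.
  intros HG Hg Hu Hv.
  apply (constant_of_Cder_0 (left_half_plane s) (fun w => G (w + i2pi) - G w));
    [apply left_half_plane_convex | | exact Hu | exact Hv].
  intros z Hz. eapply Cder_eq; [| apply Cder_minus; [apply Cder_shift, HG | apply HG, Hz]].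
  - rewrite Hg. ring.
  - unfold left_half_plane. now rewrite Re_plus_i2pi.
Qed.

Definition disc (a : C) (r : R) (z : C) : Prop := (Cmod (z - a) < r)%R.

Lemma exp_ball (a : C) (s : R) (u : C) : left_half_plane s u -> disc a (exp s) (a + Cexp u).
Proof.
  intros Hu. unfold disc. replace (a + Cexp u - a) with (Cexp u) by ring.
  rewrite Cmod_Cexp. now apply exp_increasing.
Qed.

Lemma Cder_exp_coord (f : C -> C) (a u l : C) :
  Cder f (a + Cexp u) l -> Cder (fun w => f (a + Cexp w)) u (l * Cexp u).
Proof.
  intros H. apply (Cder_comp f (fun w => a + Cexp w)); [| exact H].
  eapply Cder_eq; [| apply Cder_plus; [apply Cder_const | apply Cder_Cexp]]. ring.
Qed.

(* In the coordinate [u = log (z - a)] circles centred at [a] become vertical segments, so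
   that contour integrals are increments of a primitive over the period [2 i pi]. *)
Lemma exp_primitive (n : C) (f : C -> C) (a : C) (s : R) :
  differentiable_on (disc a (exp s)) f ->
  exists G, forall u, left_half_plane s u -> Cder G u (Cexp (n * u) * f (a + Cexp u)).
Proof.
  intros Hf. apply primitive; [apply left_half_plane_open | apply left_half_plane_convex |].
  intros u Hu. destruct (Hf _ (exp_ball a s u Hu)) as [l Hl].
  eexists. apply Cder_mult.
  - apply Cder_Cexp_comp, Cder_scal, Cder_id.
  - apply Cder_exp_coord, Hl.
Qed.

(** Cauchy's formula for the derivative at [a]: under [z = a + exp u], the form [exp (- u) du]
    becomes [dz / (z - a) ^ 2]. The increment is moved to a circle so small that [f] is affine there
    up to [eps]. *)
Lemma cauchy_increment (f G : C -> C) (a l : C) (s : R) (u : C) :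
  Cder f a l ->
  (forall u, left_half_plane s u -> Cder G u (Cexp ((-1) * u) * f (a + Cexp u))) ->
  left_half_plane s u -> G (u + i2pi) - G u = i2pi * l.
Proof.
  intros Hl HG Hu. apply Ceq_small with (2 * PI)%R. intros eps Heps.
  destruct (Hl eps Heps) as [d [Hd H]].
  (* [x < s] stays in the domain of [G], and [x < ln d] makes the radius smaller than [d]. *)
  set (x := Rmin (s - 1) (ln d - 1)).
  set (v := RtoC x).
  assert (Rv : Re v = x) by reflexivity.
  assert (Hv : left_half_plane s v)
    by (unfold left_half_plane; rewrite Rv; unfold x; pose proof (Rmin_l (s - 1) (ln d - 1)); lra).
  rewrite (period_constant s G (fun u => Cexp ((-1) * u) * f (a + Cexp u)) u v HG); try assumption.
  2: { intros w. rewrite Cexp_period.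
       replace (-1 * (w + i2pi)) with (-1 * w + - i2pi) by ring.
       rewrite Cexp_plus. replace (Cexp (- i2pi)) with (RtoC 1); [ring |].
       rewrite <- (Cexp_opp i2pi), Cexp_i2pi. ring. }
  (* The term added to [G] cancels the affine part [f a + l * Cexp w] of [f]. Over the period its
     exponential contributes nothing and its linear part contributes [- i2pi * l]. *)
  pose proof (mean_value_ineq
    (fun w => G w + (Cexp ((-1) * w) * f a - l * w))
    (fun w => Cexp ((-1) * w) * (f (a + Cexp w) - f a - l * Cexp w)) v (v + i2pi) eps) as B.
  rewrite vertical_dist, Rmult_comm in B.
  match type of B with _ -> (Cmod ?z <= _)%R =>
    replace (G (v + i2pi) - G v - i2pi * l) with z end.
  - apply B. clear B. intros t Ht.
    set (w := v + RtoC t * (v + i2pi - v)).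
    assert (Rw : Re w = x) by (unfold w; now rewrite Re_vertical).
    assert (Hw : left_half_plane s w) by (unfold left_half_plane in *; now rewrite Rw, <- Rv).
    assert (E : Cexp w * Cexp (-1 * w) = 1)
      by (replace (-1 * w) with (- w) by ring; apply Cexp_opp).
    split.
    + eapply Cder_eq; [| apply Cder_plus; [apply HG, Hw | apply Cder_minus]].
      2: { apply Cder_mult; [apply Cder_Cexp_comp, Cder_scal, Cder_id | apply Cder_const]. }
      2: { apply Cder_scal, Cder_id. }
      cbv beta.
      replace (Cexp (-1 * w) * (f (a + Cexp w) - f a - l * Cexp w))
        with (Cexp (-1 * w) * (f (a + Cexp w) - f a) - l * (Cexp w * Cexp (-1 * w))) by ring.
      rewrite E. ring.
    + rewrite Cmod_mult. specialize (H (a + Cexp w)).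
      replace (a + Cexp w - a) with (Cexp w) in H by ring.
      assert (B : (Cmod (Cexp w) < d)%R).
      { rewrite Cmod_Cexp, Rw. rewrite <- (exp_ln d Hd). apply exp_increasing.
        unfold x. pose proof (Rmin_r (s - 1) (ln d - 1)). lra. }
      specialize (H B).
      assert (E' : (Cmod (Cexp w) * Cmod (Cexp (-1 * w)) = 1)%R)
        by (rewrite <- Cmod_mult, E; apply Cmod_1).
      pose proof (Cmod_ge_0 (Cexp (-1 * w))).
      apply Rle_trans with (Cmod (Cexp (-1 * w)) * (eps * Cmod (Cexp w)))%R.
      * now apply Rmult_le_compat_l.
      * right. replace eps with (eps * 1)%R at 2 by ring. rewrite <- E'. ring.
  - replace (-1 * (v + i2pi)) with (-1 * v + - i2pi) by ring.
    rewrite Cexp_plus. replace (Cexp (- i2pi)) with (RtoC 1); [ring |].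
    rewrite <- (Cexp_opp i2pi), Cexp_i2pi. ring.
Qed.

Definition circle_pt (a : C) (r t : R) : C := a + RtoC r * Cexp (RtoC t * i2pi).

Lemma circle_pt_dist (a : C) (r t : R) : (0 <= r)%R -> Cmod (circle_pt a r t - a) = r.
Proof.
  intros Hr. unfold circle_pt.
  replace (a + RtoC r * Cexp (RtoC t * i2pi) - a) with (RtoC r * Cexp (RtoC t * i2pi)) by ring.
  rewrite Cmod_mult, Cmod_R, Cmod_Cexp, re_scal_l, Re_i2pi, Rmult_0_r, exp_0, Rmult_1_r.
  apply Rabs_right. lra.
Qed.

Lemma exp_circle_pt (a : C) (r t : R) : (0 < r)%R ->
  a + Cexp (RtoC (ln r) + RtoC t * (RtoC (ln r) + i2pi - RtoC (ln r))) = circle_pt a r t.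
Proof.
  intros Hr. unfold circle_pt. f_equal.
  replace (RtoC (ln r) + i2pi - RtoC (ln r)) with i2pi by ring.
  rewrite Cexp_plus. f_equal. unfold Cexp, Re, Im; simpl.
  rewrite exp_ln, cos_0, sin_0 by exact Hr. apply Cmult_1_r.
Qed.

Lemma increment_bound (g D : C -> C) (a : C) (r s M : R) : (0 < r < exp s)%R ->
  (forall u, left_half_plane s u -> Cder D u (Cexp ((-1) * u) * g (a + Cexp u))) ->
  (forall t, (0 <= t <= 1)%R -> (Cmod (g (circle_pt a r t)) <= M)%R) ->
  (Cmod (D (RtoC (ln r) + i2pi)%C - D (RtoC (ln r))) <= 2 * PI * (M / r))%R.
Proof.
  intros [Hr Hrs] HD HM.
  rewrite Rmult_comm, <- (vertical_dist (RtoC (ln r))).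
  apply (mean_value_ineq D (fun u => Cexp ((-1) * u) * g (a + Cexp u))).
  intros t Ht.
  pose proof (exp_circle_pt a r t Hr) as E.
  set (w := RtoC (ln r) + RtoC t * (RtoC (ln r) + i2pi - RtoC (ln r))) in *.
  assert (Rw : Re w = ln r) by (unfold w; now rewrite Re_vertical).
  split.
  - apply HD. unfold left_half_plane. rewrite Rw. rewrite <- (ln_exp s). now apply ln_increasing.
  - rewrite Cmod_mult, Cmod_Cexp, E.
    replace (Re (-1 * w)) with (- ln r)%R by (rewrite re_scal_l, Rw; ring).
    rewrite exp_Ropp, exp_ln by exact Hr. unfold Rdiv. rewrite Rmult_comm.
    apply Rmult_le_compat_r; [left; now apply Rinv_0_lt_compat | now apply HM].
Qed.

Lemma cauchy_estimate (f : C -> C) (a l : C) (r R0 M : R) : (0 < r < R0)%R ->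
  differentiable_on (disc a R0) f -> Cder f a l ->
  (forall t, (0 <= t <= 1)%R -> (Cmod (f (circle_pt a r t)) <= M)%R) ->
  (Cmod l <= M / r)%R.
Proof.
  intros [Hr HR] Hf Hl HM.
  assert (HR0 : exp (ln R0) = R0) by (apply exp_ln; lra).
  destruct (exp_primitive (-1) f a (ln R0)) as [G HG]; [now rewrite HR0 |].
  pose proof (increment_bound f G a r (ln R0) M ltac:(lra) HG HM) as B.
  rewrite (cauchy_increment f G a l (ln R0)) in B; try assumption.
  2: { unfold left_half_plane. apply ln_increasing; lra. }
  rewrite Cmod_mult, Cmod_i2pi in B. pose proof PI_RGT_0.
  apply Rmult_le_reg_l with (2 * PI)%R; lra.
Qed.

(** Cauchy's estimate for [(z - a) * f z], whose derivative at [a] is [f a] and whose modulus on the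
    circle is [r * Cmod (f z)]. *)
Lemma mean_bound (f : C -> C) (a : C) (r R0 M : R) : (0 < r < R0)%R ->
  differentiable_on (disc a R0) f ->
  (forall t, (0 <= t <= 1)%R -> (Cmod (f (circle_pt a r t)) <= M)%R) ->
  (Cmod (f a) <= M)%R.
Proof.
  intros Hr Hf HM.
  assert (H : forall z l, Cder f z l ->
    Cder (fun w => (w - a) * f w) z ((1 - 0) * f z + (z - a) * l)).
  { intros z l Hl. apply (Cder_mult (fun w => w - a)); [| exact Hl].
    apply Cder_minus; [apply Cder_id | apply Cder_const]. }
  replace M with (r * M / r)%R by (field; lra).
  apply cauchy_estimate with (f := fun z => (z - a) * f z) (a := a) (R0 := R0); [exact Hr | | |].
  - intros z Hz. destruct (Hf z Hz) as [l Hl]. eexists. apply H, Hl.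
  - destruct (Hf a) as [l Hl].
    { unfold disc. replace (a - a) with (RtoC 0) by ring. rewrite Cmod_0. lra. }
    eapply Cder_eq; [| apply H, Hl]. ring.
  - intros t Ht. rewrite Cmod_mult, circle_pt_dist by lra.
    apply Rmult_le_compat_l; [lra | now apply HM].
Qed.

(** The minimum principle, obtained from [mean_bound] for [/ f]. *)
Lemma mean_bound_below (f : C -> C) (a : C) (r R0 m : R) : (0 < r < R0)%R -> (0 < m)%R ->
  differentiable_on (disc a R0) f -> (forall z, disc a R0 z -> f z <> 0) ->
  (forall t, (0 <= t <= 1)%R -> (m <= Cmod (f (circle_pt a r t)))%R) ->
  (m <= Cmod (f a))%R.
Proof.
  intros Hr Hm Hf Hnz HM.
  assert (Ha : disc a R0 a)
    by (unfold disc; replace (a - a) with (RtoC 0) by ring; rewrite Cmod_0; lra).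
  pose proof (proj1 (Cmod_gt_0 _) (Hnz a Ha)) as P.
  assert (B : (Cmod (/ f a) <= / m)%R).
  { apply (mean_bound (fun z => / f z) a r R0); [exact Hr | |].
    - intros z Hz. destruct (Hf z Hz) as [l Hl]. eexists. apply Cder_inv; [exact Hl | now apply Hnz].
    - intros t Ht. rewrite Cmod_inv.
      + apply Rinv_le_contravar; [exact Hm | now apply HM].
      + apply Hnz. unfold disc. rewrite circle_pt_dist; lra. }
  rewrite Cmod_inv in B by now apply Hnz.
  apply Rinv_le_contravar in B; [| now apply Rinv_0_lt_compat].
  now rewrite !Rinv_inv in B.
Qed.

Lemma circle_pt_lipschitz (a : C) (r t t' : R) : (0 <= r)%R ->
  (Cmod (circle_pt a r t - circle_pt a r t') <= 2 * PI * r * Rabs (t - t'))%R.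
Proof.
  intros Hr. pose proof PI_RGT_0 as HPI.
  eapply Rle_trans.
  - apply (mean_value_ineq (fun z => a + RtoC r * Cexp (z * i2pi))
      (fun z => RtoC r * (Cexp (z * i2pi) * (1 * i2pi + z * 0)))
      (RtoC t') (RtoC t) (2 * PI * r)).
    intros s Hs. set (z := RtoC t' + RtoC s * (RtoC t - RtoC t')). split.
    + apply Cder_eq with (0 + RtoC r * (Cexp (z * i2pi) * (1 * i2pi + z * 0))); [ring |].
      apply Cder_plus; [apply Cder_const | apply Cder_scal, (Cder_Cexp_comp (fun z => z * i2pi))].
      apply Cder_mult; [apply Cder_id | apply Cder_const].
    + replace (1 * i2pi + z * 0) with i2pi by ring.
      rewrite !Cmod_mult, Cmod_i2pi, Cmod_R, Cmod_Cexp, Rabs_right by lra.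
      assert (Ez : z = RtoC (t' + s * (t - t')))
        by (unfold z; rewrite RtoC_plus, RtoC_mult, RtoC_minus; reflexivity).
      rewrite Ez, re_scal_l, Re_i2pi, Rmult_0_r, exp_0. lra.
  - rewrite <- RtoC_minus, Cmod_R. lra.
Qed.

(** The point [w] may lie off the circle, because circles are later compared with their small
    translates. *)
Lemma circle_unif_cont (f : C -> C) (a : C) (r : R) : (0 <= r)%R ->
  (forall t, (0 <= t <= 1)%R -> Ccont f (circle_pt a r t)) ->
  forall eps : R, (0 < eps)%R -> exists d : R, (0 < d)%R /\
  forall t w, (0 <= t <= 1)%R -> (Cmod (w - circle_pt a r t) < d)%R ->
    (Cmod (f w - f (circle_pt a r t)) < eps)%R.
Proof.
  intros Hr Hf eps Heps. pose proof PI_RGT_0 as HPI.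
  assert (Hex : forall t, exists d : R, (0 < d)%R /\ ((0 <= t <= 1)%R ->
    forall w, (Cmod (w - circle_pt a r t) < d)%R ->
      (Cmod (f w - f (circle_pt a r t)) < eps / 2)%R)).
  { intros t. destruct (classic (0 <= t <= 1)%R) as [Ht | N].
    - destruct (Hf t Ht (eps / 2)%R ltac:(lra)) as [d [Hd H]]. now exists d.
    - exists 1%R. split; [lra | contradiction]. }
  set (d0 := fun t => proj1_sig (constructive_indefinite_description _ (Hex t))).
  assert (Hd0 : forall t, (0 < d0 t)%R /\ ((0 <= t <= 1)%R ->
    forall w, (Cmod (w - circle_pt a r t) < d0 t)%R ->
      (Cmod (f w - f (circle_pt a r t)) < eps / 2)%R))
    by (intros t; exact (proj2_sig (constructive_indefinite_description _ (Hex t)))).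
  (* A parameter change below [d0 t / L] moves the point of the circle by less than [d0 t / 2], and
     [w] is within another [d0 t / 2] of it. *)
  set (L := (2 * (2 * PI * r + 1))%R).
  assert (HL : (2 <= L)%R) by (unfold L; nra).
  assert (Hp : forall t, (0 < d0 t / L)%R)
    by (intros t; apply Rdiv_lt_0_compat; [apply Hd0 | lra]).
  destruct (compactness_value_1d 0 1 (fun t => mkposreal _ (Hp t))) as [d Hd].
  exists d. split; [apply cond_pos |]. intros t w Ht Hw.
  destruct (NNPP _ (Hd t Ht)) as [t0 [Ht0 [H1 H2]]]. simpl in H1, H2.
  destruct (Hd0 t0) as [P0 H0]. specialize (H0 Ht0).
  assert (B1 : (Cmod (circle_pt a r t - circle_pt a r t0) < d0 t0 / 2)%R).
  { eapply Rle_lt_trans; [now apply circle_pt_lipschitz |].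
    apply Rle_lt_trans with ((2 * PI * r + 1) * Rabs (t - t0))%R;
      [pose proof (Rabs_pos (t - t0)); lra |].
    apply Rmult_lt_compat_l with (r := (2 * PI * r + 1)%R) in H1; [| unfold L in HL; lra].
    replace ((2 * PI * r + 1) * (d0 t0 / L))%R with (d0 t0 / 2)%R in H1
      by (unfold L in *; field; lra). exact H1. }
  assert (B2 : (d0 t0 / L <= d0 t0 / 2)%R)
    by (apply Rmult_le_compat_l; [lra | apply Rinv_le_contravar; lra]).
  pose proof (Cmod_triangle_minus w (circle_pt a r t) (circle_pt a r t0)) as T1.
  pose proof (H0 (circle_pt a r t) ltac:(lra)) as C1.
  pose proof (H0 w ltac:(lra)) as C2.
  pose proof (Cmod_triangle_minus (f w) (f (circle_pt a r t0)) (f (circle_pt a r t))) as T2.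
  rewrite (Cmod_minus_sym (f (circle_pt a r t0))) in T2. lra.
Qed.

(** * Higher derivatives and injective functions *)

Lemma disc_open (a : C) (r : R) : open (disc a r).
Proof.
  intros z Hz. apply locally_C_Cmod. exists (r - Cmod (z - a))%R. unfold disc in *.
  split; [lra |]. intros w Hw. pose proof (Cmod_triangle_minus w z a). lra.
Qed.

Lemma disc_convex (a : C) (r : R) : convex_set (disc a r).
Proof.
  intros u v t Hu Hv Ht. unfold disc in *.
  apply Rle_lt_trans with (Rmax (Cmod (u - a)) (Cmod (v - a))).
  - apply curve_ball; [exact Ht | apply Rmax_l | apply Rmax_r].
  - now apply Rmax_lub_lt.
Qed.

Lemma disc_center (a : C) (r : R) : (0 < r)%R -> disc a r a.
Proof. intros Hr. unfold disc. replace (a - a) with (RtoC 0) by ring. now rewrite Cmod_0. Qed.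

(** Choice makes the derivative a total function that can itself be differentiated; its value is
    arbitrary where no derivative exists. *)
Definition Cd (f : C -> C) (z : C) : C := epsilon (inhabits (RtoC 0)) (Cder f z).

Lemma Cd_correct (U : C -> Prop) (f : C -> C) (z : C) :
  differentiable_on U f -> U z -> Cder f z (Cd f z).
Proof. intros Hf Hz. apply (epsilon_spec (inhabits (RtoC 0)) (Cder f z)), Hf, Hz. Qed.

(** [f' w - f' a] is the derivative at [a] of [f (z + (w - a)) - f z]. Cauchy's estimate bounds it
    by the size of this difference on a circle, which is small by uniform continuity. *)
Lemma deriv_continuous (f f' : C -> C) (a : C) (R0 : R) : (0 < R0)%R ->
  (forall z, disc a R0 z -> Cder f z (f' z)) -> Ccont f' a.
Proof.
  intros HR Hf eps Heps.
  destruct (circle_unif_cont f a (R0 / 2) ltac:(lra)) with (eps := (eps / 2 * (R0 / 2))%R)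
    as [d [Hd H]].
  { intros t _. eapply Cder_cont, Hf. unfold disc. rewrite circle_pt_dist; lra. }
  { nra. }
  exists (Rmin d (R0 / 4)). split; [apply Rmin_pos; lra |]. intros w Hw.
  pose proof (Rmin_l d (R0 / 4)). pose proof (Rmin_r d (R0 / 4)).
  apply Rle_lt_trans with (eps / 2 * (R0 / 2) / (R0 / 2))%R.
  2: { replace (eps / 2 * (R0 / 2) / (R0 / 2))%R with (eps / 2)%R by (field; lra). lra. }
  assert (HD : forall z, disc a (3 * R0 / 4) z ->
    Cder (fun v => f (v + (w - a)) - f v) z (f' (z + (w - a)) - f' z)).
  { intros z Hz. unfold disc in Hz. apply Cder_minus.
    - apply Cder_shift, Hf. unfold disc.
      replace (z + (w - a) - a) with ((z - a) + (w - a)) by ring.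
      pose proof (Cmod_triangle (z - a) (w - a)). lra.
    - apply Hf. unfold disc. lra. }
  apply cauchy_estimate with (f := fun z => f (z + (w - a)) - f z) (a := a) (R0 := (3 * R0 / 4)%R).
  - lra.
  - intros z Hz. eexists. now apply HD.
  - eapply Cder_eq; [| apply HD, disc_center; lra].
    replace (a + (w - a)) with w by ring. reflexivity.
  - intros t Ht. left. apply H; [exact Ht |].
    replace (circle_pt a (R0 / 2) t + (w - a) - circle_pt a (R0 / 2) t) with (w - a) by ring. lra.
Qed.

Lemma increment_approx (f f' : C -> C) (z h : C) (eps : R) :
  (forall v, (Cmod (v - z) <= Cmod h)%R -> Cder f v (f' v) /\ (Cmod (f' v - f' z) <= eps)%R) ->
  (Cmod (f (z + h)%C - f z - h * f' z) <= eps * Cmod h)%R.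
Proof.
  intros H.
  pose proof (mean_value_ineq (fun v => f v - f' z * v) (fun v => f' v - f' z * 1) z (z + h) eps) as B.
  replace (z + h - z) with h in B by ring.
  replace (f (z + h) - f z - h * f' z) with (f (z + h) - f' z * (z + h) - (f z - f' z * z)) by ring.
  apply B. intros t Ht.
  destruct (H (z + RtoC t * h)) as [H1 H2].
  { replace (z + RtoC t * h - z) with (RtoC t * h) by ring.
    rewrite Cmod_mult, Cmod_R, Rabs_right by lra. pose proof (Cmod_ge_0 h). nra. }
  split.
  - apply Cder_minus; [exact H1 | apply Cder_scal, Cder_id].
  - now rewrite Cmult_1_r.
Qed.

(** The candidate [l] is Cauchy's formula applied to [f'] on a circle. Then [f' w - f' a - l * h] is
    the Cauchy integral of [f (z + h) - f z - h * f' z], which is uniformly small compared with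
    [Cmod h] on that circle. *)
Lemma deriv_differentiable (f f' : C -> C) (a : C) (R0 : R) : (0 < R0)%R ->
  (forall z, disc a R0 z -> Cder f z (f' z)) -> exists l, Cder f' a l.
Proof.
  intros HR Hf. set (s := ln (3 * R0 / 4)).
  assert (Hs : exp s = (3 * R0 / 4)%R) by (apply exp_ln; lra).
  destruct (exp_primitive (-2) f a s) as [G2 HG2].
  { intros z Hz. unfold disc in Hz. eexists. apply Hf. unfold disc. lra. }
  destruct (exp_primitive (-1) f a s) as [G1 HG1].
  { intros z Hz. unfold disc in Hz. eexists. apply Hf. unfold disc. lra. }
  (* [H] is a primitive of [exp (- u) * f' (a + exp u)], obtained by parts because [f'] is
     not yet known to be differentiable. *)
  set (H := fun u => Cexp (-2 * u) * f (a + Cexp u) + 2 * G2 u).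
  assert (HH : forall u, left_half_plane s u -> Cder H u (Cexp (-1 * u) * f' (a + Cexp u))).
  { intros u Hu. pose proof (exp_ball a s u Hu) as Hb. unfold disc in Hb.
    eapply Cder_eq; [| apply Cder_plus; [apply Cder_mult |]].
    2: apply (Cder_Cexp_comp (fun u => -2 * u)), Cder_scal, Cder_id.
    2: apply Cder_exp_coord, Hf; unfold disc; lra.
    2: apply Cder_scal, HG2, Hu.
    cbv beta. replace (-2 * u) with (- u + - u) by ring. replace (-1 * u) with (- u) by ring.
    rewrite Cexp_plus. pose proof (Cexp_opp u) as E.
    transitivity ((Cexp u * Cexp (- u)) * Cexp (- u) * f' (a + Cexp u)); [ring |].
    rewrite E. ring. }
  set (u0 := RtoC (ln (R0 / 2))).
  assert (Hu0 : left_half_plane s u0)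
    by (unfold left_half_plane, u0, s, Re; simpl; apply ln_increasing; lra).
  set (l := (H (u0 + i2pi) - H u0) / i2pi).
  exists l. intros eps Heps.
  destruct (circle_unif_cont f' a (R0 / 2) ltac:(lra)) with (eps := (eps * (R0 / 2))%R)
    as [d [Hd HU]].
  { intros t _. apply (deriv_continuous f f' _ (R0 / 2)); [lra |].
    intros z Hz. apply Hf. unfold disc in *.
    pose proof (Cmod_triangle_minus z (circle_pt a (R0 / 2) t) a) as T.
    rewrite circle_pt_dist in T; lra. }
  { nra. }
  exists (Rmin d (R0 / 4)). split; [apply Rmin_pos; lra |]. intros w Hw.
  pose proof (Rmin_l d (R0 / 4)). pose proof (Rmin_r d (R0 / 4)).
  set (h := w - a) in *.
  assert (Hsh : forall z, disc a (exp s) z -> disc a R0 (z + h)).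
  { intros z Hz. unfold disc in *. replace (z + h - a) with ((z - a) + h) by ring.
    pose proof (Cmod_triangle (z - a) h). lra. }
  destruct (exp_primitive (-1) (fun z => f (z + h)) a s) as [Gh HGh].
  { intros z Hz. eexists. apply Cder_shift, Hf, Hsh, Hz. }
  pose proof PI_RGT_0 as HPI.
  assert (Eh : Gh (u0 + i2pi) - Gh u0 = i2pi * f' w).
  { apply (cauchy_increment (fun z => f (z + h)) Gh a (f' w) s); [| exact HGh | exact Hu0].
    apply Cder_shift. replace w with (a + h) by (unfold h; ring).
    apply Hf, Hsh, disc_center. rewrite Hs. lra. }
  assert (E1 : G1 (u0 + i2pi) - G1 u0 = i2pi * f' a).
  { apply (cauchy_increment f G1 a (f' a) s); [| exact HG1 | exact Hu0].
    apply Hf, disc_center, HR. }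
  assert (El : H (u0 + i2pi) - H u0 = i2pi * l) by (unfold l; field; apply i2pi_neq_0).
  pose proof (increment_bound (fun z => f (z + h) - f z - h * f' z)
    (fun u => Gh u - G1 u - h * H u) a (R0 / 2) s (eps * (R0 / 2) * Cmod h)) as B.
  fold u0 in B. cbv beta in B.
  replace (Gh (u0 + i2pi) - G1 (u0 + i2pi) - h * H (u0 + i2pi) - (Gh u0 - G1 u0 - h * H u0))
    with (i2pi * (f' w - f' a - l * h)) in B.
  2: { transitivity ((Gh (u0 + i2pi) - Gh u0) - (G1 (u0 + i2pi) - G1 u0) - h * (H (u0 + i2pi) - H u0));
       [rewrite Eh, E1, El |]; ring. }
  rewrite Cmod_mult, Cmod_i2pi in B.
  replace (2 * PI * (eps * (R0 / 2) * Cmod h / (R0 / 2)))%R with (2 * PI * (eps * Cmod h))%R in B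
    by (field; lra).
  apply Rmult_le_reg_l with (2 * PI)%R; [lra |]. apply B.
  - lra.
  - intros u Hu. eapply Cder_eq; [| apply Cder_minus; [apply Cder_minus |]].
    2: apply HGh, Hu. 2: apply HG1, Hu. 2: apply Cder_scal, HH, Hu. ring.
  - intros t Ht. apply increment_approx. intros v Hv.
    split.
    + apply Hf. unfold disc. pose proof (Cmod_triangle_minus v (circle_pt a (R0 / 2) t) a) as T.
      rewrite circle_pt_dist in T; lra.
    + left. apply HU; [exact Ht | lra].
Qed.

Lemma Cd_differentiable (U : C -> Prop) (f : C -> C) :
  open U -> differentiable_on U f -> differentiable_on U (Cd f).
Proof.
  intros HU Hf a Ha. destruct (open_C U a HU Ha) as [d [Hd H]].
  apply (deriv_differentiable f (Cd f) a d Hd).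
  intros z Hz. apply (Cd_correct U); [exact Hf | now apply H].
Qed.

Definition diff_quot (f : C -> C) (a l z : C) : C :=
  if Ceq_dec z a then l else (f z - f a) / (z - a).

Lemma diff_quot_center (f : C -> C) (a l : C) : diff_quot f a l a = l.
Proof. unfold diff_quot. destruct (Ceq_dec a a) as [_ | n]; [reflexivity | now contradiction n]. Qed.

Lemma diff_quot_neq (f : C -> C) (a l z : C) : z <> a -> diff_quot f a l z = (f z - f a) / (z - a).
Proof. intros H. unfold diff_quot. now destruct (Ceq_dec z a). Qed.

(** Removability of the singularity: by the expansion of [f] to second order, the derivative at [a]
    is half of the second derivative of [f]. *)
Lemma diff_quot_differentiable (U : C -> Prop) (f : C -> C) (a l : C) :
  open U -> U a -> differentiable_on U f -> Cder f a l ->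
  differentiable_on U (diff_quot f a l).
Proof.
  intros HU Ha Hf Hl z Hz. destruct (Ceq_dec z a) as [-> | N].
  - destruct (Cd_differentiable U f HU Hf a Ha) as [l2 H2].
    assert (El : Cd f a = l) by (apply (Cder_unique f a); [now apply (Cd_correct U) | exact Hl]).
    exists (l2 / 2). intros eps Heps.
    destruct (H2 eps Heps) as [d1 [Hd1 H1]]. destruct (open_C U a HU Ha) as [d2 [Hd2 HU2]].
    exists (Rmin d1 d2). split; [now apply Rmin_pos |]. intros w Hw.
    pose proof (Rmin_l d1 d2). pose proof (Rmin_r d1 d2).
    rewrite diff_quot_center. destruct (Ceq_dec w a) as [-> | Nw].
    { rewrite diff_quot_center. replace (l - l - l2 / 2 * (a - a)) with (RtoC 0) by ring.
      rewrite Cmod_0. pose proof (Cmod_ge_0 (a - a)). nra. }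
    rewrite (diff_quot_neq _ _ _ _ Nw). pose proof (Cminus_eq_contra _ _ Nw) as nz.
    (* The Taylor remainder is at most [eps] times the square of [Cmod (w - a)], and division by
       [w - a] uses up one factor. *)
    pose proof (mean_value_ineq (fun v => f v - l * v - l2 / 2 * ((v - a) * (v - a)))
      (fun v => Cd f v - l - l2 * (v - a)) a w (eps * Cmod (w - a))) as B.
    replace ((f w - f a) / (w - a) - l - l2 / 2 * (w - a)) with
      ((f w - l * w - l2 / 2 * ((w - a) * (w - a)) - (f a - l * a - l2 / 2 * ((a - a) * (a - a))))
       / (w - a)) by (field; exact nz).
    rewrite Cmod_div by exact nz. pose proof (proj1 (Cmod_gt_0 _) nz) as P.
    apply Rmult_le_reg_r with (Cmod (w - a)); [exact P |].
    unfold Rdiv. rewrite Rmult_assoc, Rinv_l, Rmult_1_r by lra.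
    apply B. intros t Ht.
    assert (Hv : (Cmod (a + RtoC t * (w - a) - a) <= Cmod (w - a))%R).
    { apply curve_ball; [exact Ht | | lra].
      replace (a - a) with (RtoC 0) by ring. rewrite Cmod_0. lra. }
    set (v := a + RtoC t * (w - a)) in *. split.
    + eapply Cder_eq; [| apply Cder_minus; [apply Cder_minus |]].
      2: apply (Cd_correct U); [exact Hf | apply HU2; lra].
      2: apply Cder_scal, Cder_id.
      2: apply Cder_scal, (Cder_mult (fun v => v - a) (fun v => v - a)).
      2, 3: apply Cder_minus; [apply Cder_id | apply Cder_const].
      field.
    + rewrite <- El. eapply Rle_trans; [apply H1; lra |]. apply Rmult_le_compat_l; lra.
  - destruct (Hf z Hz) as [k Hk].
    pose proof (proj1 (Cmod_gt_0 _) (Cminus_eq_contra _ _ N)) as P.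
    eexists. apply Cder_loc with (f := fun w => (f w - f a) / (w - a)) (d := Cmod (z - a)).
    + exact P.
    + intros w Hw. symmetry. apply diff_quot_neq. intros ->. rewrite Cmod_minus_sym in Hw. lra.
    + apply Cder_div; [now apply Cminus_eq_contra | |].
      * apply Cder_minus; [exact Hk | apply Cder_const].
      * apply Cder_minus; [apply Cder_id | apply Cder_const].
Qed.

Lemma circle_lower_bound (f : C -> C) (a : C) (r : R) : (0 <= r)%R ->
  (forall t, (0 <= t <= 1)%R -> Ccont f (circle_pt a r t)) ->
  (forall t, (0 <= t <= 1)%R -> f (circle_pt a r t) <> 0) ->
  exists m, (0 < m)%R /\ forall t, (0 <= t <= 1)%R -> (m <= Cmod (f (circle_pt a r t)))%R.
Proof.
  intros Hr Hc Hnz.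
  destruct (continuity_ab_min (fun t => Cmod (f (circle_pt a r t))) 0 1) as [t0 [H0 Ht0]].
  - lra.
  - intros t Ht eps Heps. destruct (Hc t Ht eps Heps) as [d [Hd H]].
    pose proof PI_RGT_0 as HPI.
    assert (HL : (0 < 2 * PI * r + 1)%R) by nra.
    exists (d / (2 * PI * r + 1))%R. split; [apply Rdiv_lt_0_compat; lra |].
    intros s [_ Hs]. simpl in *. unfold Rdist in *.
    apply Rle_lt_trans with (Cmod (f (circle_pt a r s) - f (circle_pt a r t))).
    + apply Rabs_le. pose proof (Cmod_triangle_inv (f (circle_pt a r s)) (f (circle_pt a r t))).
      pose proof (Cmod_triangle_inv (f (circle_pt a r t)) (f (circle_pt a r s))) as H2.
      rewrite Cmod_minus_sym in H2. lra.
    + apply H. eapply Rle_lt_trans; [now apply circle_pt_lipschitz |].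
      pose proof (Rabs_pos (s - t)).
      apply Rle_lt_trans with ((2 * PI * r + 1) * Rabs (s - t))%R; [lra |].
      apply Rmult_lt_compat_l with (r := (2 * PI * r + 1)%R) in Hs; [| exact HL].
      replace ((2 * PI * r + 1) * (d / (2 * PI * r + 1)))%R with d in Hs by (field; lra). exact Hs.
  - exists (Cmod (f (circle_pt a r t0))). split; [apply Cmod_gt_0, Hnz, Ht0 | exact H0].
Qed.

(** * Injective functions and their local inverses *)

Definition injective_on (U : C -> Prop) (f : C -> C) : Prop :=
  forall z w, U z -> U w -> f z = f w -> z = w.

Lemma circle_pt_neq (a : C) (r t : R) : (0 < r)%R -> circle_pt a r t <> a.
Proof.
  intros Hr E. pose proof (circle_pt_dist a r t ltac:(lra)) as H. rewrite E in H.
  replace (a - a) with (RtoC 0) in H by ring. rewrite Cmod_0 in H. lra.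
Qed.

Lemma injective_circle_gap (f : C -> C) (a : C) (r R0 : R) : (0 < r < R0)%R ->
  differentiable_on (disc a R0) f -> injective_on (disc a R0) f ->
  exists m, (0 < m)%R /\ forall t, (0 <= t <= 1)%R -> (m <= Cmod (f (circle_pt a r t) - f a))%R.
Proof.
  intros Hr Hf Hinj.
  assert (Hin : forall t, disc a R0 (circle_pt a r t))
    by (intros t; unfold disc; rewrite circle_pt_dist; lra).
  apply (circle_lower_bound (fun z => f z - f a)); [lra | |].
  - intros t _. destruct (Hf _ (Hin t)) as [l Hl].
    eapply Cder_cont, Cder_minus; [exact Hl | apply Cder_const].
  - intros t _ E. apply Ceq_minus in E.
    apply (circle_pt_neq a r t); [lra |].
    apply Hinj; [apply Hin | apply disc_center; lra | exact E].
Qed.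

(* By the minimum principle for the difference quotients based at [w] near [a], the values
   [f' w] are zero or bounded away from zero; hence if [f' a = 0] then [f' = 0] near [a]. *)
Lemma injective_deriv_neq_0 (f : C -> C) (a l : C) (R0 : R) : (0 < R0)%R ->
  differentiable_on (disc a R0) f -> injective_on (disc a R0) f -> Cder f a l -> l <> 0.
Proof.
  intros HR Hf Hinj Hl El. set (r := (R0 / 4)%R).
  destruct (injective_circle_gap f a r R0 ltac:(unfold r; lra) Hf Hinj) as [m [Hm Hgap]].
  assert (Hc : forall z, disc a R0 z -> Ccont f z)
    by (intros z Hz; destruct (Hf z Hz) as [k Hk]; exact (Cder_cont _ _ _ Hk)).
  assert (Ha : disc a R0 a) by now apply disc_center.
  destruct (circle_unif_cont f a r) with (eps := (m / 4)%R) as [d1 [Hd1 H1]].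
  { unfold r. lra. }
  { intros t _. apply Hc. unfold disc. rewrite circle_pt_dist; unfold r; lra. }
  { lra. }
  destruct (Hc a Ha (m / 4)%R ltac:(lra)) as [d2 [Hd2 H2]].
  assert (Hcd : Ccont (Cd f) a).
  { apply (deriv_continuous f _ a R0 HR). intros z Hz. now apply (Cd_correct (disc a R0)). }
  assert (E0 : Cd f a = 0).
  { rewrite <- El. apply (Cder_unique f a); [| exact Hl]. now apply (Cd_correct (disc a R0)). }
  (* When the centre moves from [a] to [w], the gap [m] loses at most [m / 4] at each of its two
     ends; [r] is the denominator of the difference quotient. *)
  set (mu := (m / 2 / r)%R).
  assert (Hmu : (0 < mu)%R) by (apply Rdiv_lt_0_compat; unfold r; lra).
  destruct (Hcd mu Hmu) as [d3 [Hd3 H3]].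
  set (d := Rmin (Rmin d1 d2) (Rmin d3 (R0 / 2))).
  assert (Hd : (0 < d)%R) by (unfold d; repeat apply Rmin_pos; lra).
  assert (Hdd : (d <= d1 /\ d <= d2 /\ d <= d3 /\ d <= R0 / 2)%R).
  { pose proof (Rmin_l (Rmin d1 d2) (Rmin d3 (R0 / 2))).
    pose proof (Rmin_r (Rmin d1 d2) (Rmin d3 (R0 / 2))).
    pose proof (Rmin_l d1 d2). pose proof (Rmin_r d1 d2).
    pose proof (Rmin_l d3 (R0 / 2)). pose proof (Rmin_r d3 (R0 / 2)). unfold d. lra. }
  assert (HZ : forall w, disc a d w -> Cd f w = 0).
  { intros w Hw. unfold disc in Hw. destruct (Ceq_dec (Cd f w) 0) as [| N]; [assumption |].
    exfalso.
    assert (Hsub : forall z, disc w (R0 / 2) z -> disc a R0 z).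
    { intros z Hz. unfold disc in *. pose proof (Cmod_triangle_minus z w a). lra. }
    assert (Hwin : disc a R0 w) by (unfold disc; lra).
    assert (B : (mu <= Cmod (diff_quot f w (Cd f w) w))%R).
    { apply mean_bound_below with (r := r) (R0 := (R0 / 2)%R).
      - unfold r. lra.
      - exact Hmu.
      - apply diff_quot_differentiable; [apply disc_open | apply disc_center; lra | |].
        + intros z Hz. apply Hf, Hsub, Hz.
        + now apply (Cd_correct (disc a R0)).
      - intros z Hz. destruct (Ceq_dec z w) as [-> | Nz]; [now rewrite diff_quot_center |].
        rewrite diff_quot_neq by exact Nz. intros E.
        assert (E' : f z - f w = 0).
        { replace (f z - f w) with ((f z - f w) / (z - w) * (z - w))
            by (field; now apply Cminus_eq_contra). rewrite E. ring. }
        apply Ceq_minus in E'. apply Nz, Hinj; [now apply Hsub | exact Hwin | exact E'].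
      - intros t Ht. assert (Nw : circle_pt w r t <> w) by (apply circle_pt_neq; unfold r; lra).
        rewrite (diff_quot_neq _ _ _ _ Nw), Cmod_div by now apply Cminus_eq_contra.
        rewrite circle_pt_dist by (unfold r; lra). unfold mu.
        apply Rmult_le_compat_r; [left; apply Rinv_0_lt_compat; unfold r; lra |].
        assert (B1 : (Cmod (f (circle_pt w r t) - f (circle_pt a r t)) < m / 4)%R).
        { apply H1; [exact Ht |]. unfold circle_pt.
          replace (w + RtoC r * Cexp (RtoC t * i2pi) - (a + RtoC r * Cexp (RtoC t * i2pi)))
            with (w - a) by ring. lra. }
        assert (B2 : (Cmod (f w - f a) < m / 4)%R) by (apply H2; lra).
        specialize (Hgap t Ht).
        pose proof (Cmod_triangle_minus (f (circle_pt a r t)) (f (circle_pt w r t)) (f a)) as T1.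
        pose proof (Cmod_triangle_minus (f (circle_pt w r t)) (f w) (f a)) as T2.
        rewrite (Cmod_minus_sym (f (circle_pt a r t)) (f (circle_pt w r t))) in T1. lra. }
    rewrite diff_quot_center in B. specialize (H3 w ltac:(lra)). rewrite E0 in H3.
    replace (Cd f w - 0) with (Cd f w) in H3 by ring. lra. }
  (* With [f'] zero on a whole disc, [f] is constant there, and any second point contradicts
     injectivity. *)
  set (b := a + RtoC (d / 2)).
  assert (Hb : Cmod (b - a) = (d / 2)%R).
  { unfold b. replace (a + RtoC (d / 2) - a) with (RtoC (d / 2)) by ring.
    rewrite Cmod_R. apply Rabs_right. lra. }
  assert (Eb : f b = f a).
  { apply (constant_of_Cder_0 (disc a d)); [apply disc_convex | | unfold disc; lra | now apply disc_center].
    intros z Hz. rewrite <- (HZ z Hz). apply (Cd_correct (disc a R0)); [exact Hf |].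
    unfold disc in *. lra. }
  assert (E : b = a) by (apply Hinj; [unfold disc; lra | exact Ha | exact Eb]).
  rewrite E in Hb. replace (a - a) with (RtoC 0) in Hb by ring. rewrite Cmod_0 in Hb. lra.
Qed.

(** If the value [w] were omitted, the minimum principle for [f - w] would keep [f a] at distance at
    least [m / 2] from [w], where [m] is the gap between [f a] and the image of a circle. *)
Lemma injective_open (f : C -> C) (a : C) (r R0 : R) : (0 < r <= R0)%R ->
  differentiable_on (disc a R0) f -> injective_on (disc a R0) f ->
  exists rho, (0 < rho)%R /\
    forall w, (Cmod (w - f a) < rho)%R -> exists z, disc a r z /\ f z = w.
Proof.
  intros Hr Hf Hinj.
  destruct (injective_circle_gap f a (r / 2) R0 ltac:(lra) Hf Hinj) as [m [Hm Hgap]].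
  exists (m / 2)%R. split; [lra |]. intros w Hw.
  apply NNPP. intros N.
  assert (B : (m / 2 <= Cmod (f a - w))%R).
  { apply (mean_bound_below (fun z => f z - w) a (r / 2) r); [lra | lra | | |].
    - intros z Hz. destruct (Hf z) as [l Hl]; [unfold disc in *; lra |].
      eexists. apply Cder_minus; [exact Hl | apply Cder_const].
    - intros z Hz E. apply N. exists z. split; [exact Hz |]. now apply Ceq_minus.
    - intros t Ht. specialize (Hgap t Ht).
      pose proof (Cmod_triangle_minus (f (circle_pt a (r / 2) t)) w (f a)). lra. }
  rewrite Cmod_minus_sym in B. lra.
Qed.

(** If [q] is the slope function of [f] at [a], that of [g] at [f a] is [/ q (g w)]. Its continuity
    needs that of [g], from [injective_open], and [q a <> 0], from [injective_deriv_neq_0]. *)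
Lemma inverse_Cder (f g : C -> C) (a l : C) (R0 rho : R) : (0 < R0)%R -> (0 < rho)%R ->
  differentiable_on (disc a R0) f -> injective_on (disc a R0) f -> Cder f a l ->
  (forall w, (Cmod (w - f a) < rho)%R -> disc a R0 (g w) /\ f (g w) = w) ->
  Cder g (f a) (/ l).
Proof.
  intros HR Hrho Hf Hinj Hl Hg.
  assert (Nl : l <> 0) by exact (injective_deriv_neq_0 f a l R0 HR Hf Hinj Hl).
  assert (Ha : disc a R0 a) by now apply disc_center.
  assert (Ega : g (f a) = a).
  { destruct (Hg (f a)) as [H1 H2].
    - replace (f a - f a) with (RtoC 0) by ring. now rewrite Cmod_0.
    - now apply Hinj. }
  assert (Hc : Ccont g (f a)).
  { intros eps Heps.
    assert (Hm : (0 < Rmin eps R0)%R) by now apply Rmin_pos.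
    destruct (injective_open f a (Rmin eps R0) R0) as [rho' [Hrho' H]];
      [split; [exact Hm | apply Rmin_r] | exact Hf | exact Hinj |].
    exists (Rmin rho rho'). split; [now apply Rmin_pos |]. intros w Hw.
    destruct (H w (Rlt_le_trans _ _ _ Hw (Rmin_r _ _))) as [z [Hz E]].
    destruct (Hg w (Rlt_le_trans _ _ _ Hw (Rmin_l _ _))) as [H1 H2].
    assert (Ez : g w = z).
    { apply Hinj; [exact H1 | | congruence].
      unfold disc in *. pose proof (Rmin_r eps R0). lra. }
    rewrite Ega, Ez. unfold disc in Hz. pose proof (Rmin_l eps R0). lra. }
  apply Cder_Carath in Hl as [q [Hq [Eq Hfq]]].
  assert (Hqg : Ccont (fun w => q (g w)) (f a)) by (apply Ccont_comp; [exact Hc | now rewrite Ega]).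
  assert (Nq : q (g (f a)) <> 0) by now rewrite Ega, Eq.
  destruct (Ccont_neq_0 _ _ Hqg Nq) as [d [Hd H]].
  apply Cder_loc with (f := fun w => a + / q (g w) * (w - f a)) (d := Rmin d rho).
  - now apply Rmin_pos.
  - intros w Hw. specialize (H w (Rlt_le_trans _ _ _ Hw (Rmin_l _ _))).
    destruct (Hg w (Rlt_le_trans _ _ _ Hw (Rmin_r _ _))) as [_ E].
    pose proof (Hfq (g w)) as E'. rewrite E in E'.
    rewrite E' at 2. pose proof (Cmod_ge_0 (q (g (f a)))).
    field. apply Cmod_gt_0. lra.
  - apply Cder_Carath. exists (fun w => / q (g w)). split; [| split].
    + now apply Ccont_inv.
    + cbv beta. now rewrite Ega, Eq.
    + intros w. ring.
Qed.

(** * The Schwarz-Pick lemma and the hyperbolic step *)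

Lemma holomorphic_differentiable (U : C -> Prop) (f : C -> C) :
  holomorphic_on U f -> differentiable_on U f.
Proof. intros H z Hz. now apply ex_derive_Cder, H. Qed.

Lemma unit_disc_disc (z : C) : unit_disc z <-> disc 0 1 z.
Proof. unfold unit_disc, disc. now replace (z - 0) with z by ring. Qed.

Lemma unit_disc_open : open unit_disc.
Proof.
  intros z Hz. apply unit_disc_disc in Hz.
  destruct (open_C _ z (disc_open 0 1) Hz) as [d [Hd H]].
  apply locally_C_Cmod. exists d. split; [exact Hd |].
  intros w Hw. now apply <- unit_disc_disc; apply H.
Qed.

Lemma unit_disc_convex : convex_set unit_disc.
Proof.
  intros a b t Ha Hb Ht. apply unit_disc_disc.
  apply disc_convex; [now apply -> unit_disc_disc | now apply -> unit_disc_disc | exact Ht].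
Qed.

(** The disc automorphism taking [a] to 0; its modulus is the quantity [t] in
    [hyperbolic_distance]. *)
Definition mob (a z : C) : C := (z - a) / (1 - Cconj a * z).

Lemma Cmod_conj_mult_lt (a z : C) : unit_disc a -> unit_disc z -> (Cmod (Cconj a * z) <= Cmod a)%R.
Proof.
  unfold unit_disc. intros Ha Hz. rewrite Cmod_mult, Cmod_conj.
  pose proof (Cmod_ge_0 a). nra.
Qed.

Lemma mob_denom (a z : C) : unit_disc a -> unit_disc z ->
  (0 < 1 - Cmod a <= Cmod (1 - Cconj a * z))%R.
Proof.
  intros Ha Hz. pose proof (Cmod_conj_mult_lt a z Ha Hz).
  pose proof (Cmod_triangle_inv 1 (Cconj a * z)) as T. rewrite Cmod_1 in T.
  unfold unit_disc in Ha. lra.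
Qed.

Lemma mob_denom_neq_0 (a z : C) : unit_disc a -> unit_disc z -> 1 - Cconj a * z <> 0.
Proof. intros Ha Hz. apply Cmod_gt_0. pose proof (mob_denom a z Ha Hz). lra. Qed.

Lemma mob_defect (a z : C) : unit_disc a -> unit_disc z ->
  (1 - Cmod (mob a z) ^ 2 =
     (1 - Cmod a ^ 2) * (1 - Cmod z ^ 2) / Cmod (1 - Cconj a * z) ^ 2)%R.
Proof.
  intros Ha Hz. pose proof (mob_denom a z Ha Hz) as P. unfold mob.
  rewrite Cmod_div by now apply mob_denom_neq_0.
  assert (E : (Cmod (1 - Cconj a * z) ^ 2 - Cmod (z - a) ^ 2
    = (1 - Cmod a ^ 2) * (1 - Cmod z ^ 2))%R).
  { rewrite !Cmod2_alt. destruct a as [a1 a2], z as [z1 z2].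
    unfold Re, Im, Cconj, RtoC, Cminus, Cplus, Copp, Cmult; simpl. ring. }
  rewrite <- E. field. lra.
Qed.

Lemma mob_unit_disc (a z : C) : unit_disc a -> unit_disc z -> unit_disc (mob a z).
Proof.
  intros Ha Hz. pose proof (mob_defect a z Ha Hz) as E. pose proof (mob_denom a z Ha Hz) as P.
  unfold unit_disc in *. pose proof (Cmod_ge_0 a). pose proof (Cmod_ge_0 z).
  assert (Q : (0 < (1 - Cmod a ^ 2) * (1 - Cmod z ^ 2) / Cmod (1 - Cconj a * z) ^ 2)%R).
  { apply Rdiv_lt_0_compat; [apply Rmult_lt_0_compat; nra | apply pow_lt; lra]. }
  pose proof (Cmod_ge_0 (mob a z)). nra.
Qed.

Lemma mob_boundary (a : C) (q : R) : unit_disc a -> (0 <= q < 1)%R ->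
  exists s, (0 < s < 1)%R /\ forall z, (s <= Cmod z < 1)%R -> (q <= Cmod (mob a z))%R.
Proof.
  intros Ha Hq. set (d := (1 - Cmod a)%R). pose proof (Cmod_ge_0 a) as Pa.
  assert (Hd : (0 < d <= 1)%R) by (unfold d, unit_disc in *; lra).
  (* [Cmod z >= 1 - eta] gives [1 - Cmod z ^ 2 <= 2 * eta], and [mob_defect] divides this by at
     least [d ^ 2]. *)
  set (eta := ((1 - q ^ 2) * d ^ 2 / 2)%R).
  assert (Hdd : (0 < d ^ 2 <= 1)%R) by nra.
  assert (Hqq : (0 < 1 - q ^ 2 <= 1)%R) by nra.
  assert (Heta : (0 < eta < 1)%R) by (unfold eta; nra).
  exists (1 - eta)%R. split; [lra |]. intros z Hz.
  assert (Hzd : unit_disc z) by (unfold unit_disc; lra).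
  pose proof (mob_defect a z Ha Hzd) as E. pose proof (mob_denom a z Ha Hzd) as P. fold d in P.
  assert (B : (1 - Cmod (mob a z) ^ 2 <= 1 - q ^ 2)%R).
  { rewrite E. assert (Pd : (d ^ 2 <= Cmod (1 - Cconj a * z) ^ 2)%R) by (apply pow_incr; lra).
    apply Rmult_le_reg_r with (Cmod (1 - Cconj a * z) ^ 2)%R; [lra |].
    unfold Rdiv. rewrite Rmult_assoc, Rinv_l, Rmult_1_r by lra.
    apply Rle_trans with (1 * (2 * eta))%R.
    - apply Rmult_le_compat; unfold unit_disc in *; nra.
    - replace (1 * (2 * eta))%R with ((1 - q ^ 2) * d ^ 2)%R by (unfold eta; field).
      apply Rmult_le_compat_l; lra. }
  pose proof (Cmod_ge_0 (mob a z)). nra.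
Qed.

Lemma Cder_mob (a z : C) : unit_disc a -> unit_disc z -> exists l, Cder (mob a) z l.
Proof.
  intros Ha Hz. eexists. apply Cder_div; [now apply mob_denom_neq_0 | |].
  - apply Cder_minus; [apply Cder_id | apply Cder_const].
  - apply Cder_minus; [apply Cder_const | apply Cder_scal, Cder_id].
Qed.

(** The automorphism [mob (- z0)] takes 0 to [z0], which reduces the claim to [mean_bound] on a
    circle centred at 0. The bound is asymptotic because [g] need not extend to the unit circle. *)
Lemma disc_max_principle (g : C -> C) (M : R) (z0 : C) :
  differentiable_on unit_disc g -> unit_disc z0 ->
  (forall eps, (0 < eps)%R -> exists s, (0 <= s < 1)%R /\
     forall z, (s <= Cmod z < 1)%R -> (Cmod (g z) <= M + eps)%R) ->
  (Cmod (g z0) <= M)%R.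
Proof.
  intros Hg Hz0 HM. apply le_epsilon. intros eps Heps.
  destruct (HM eps Heps) as [s [Hs H]].
  assert (Hz0' : unit_disc (- z0)) by (unfold unit_disc; now rewrite Cmod_opp).
  destruct (mob_boundary (- z0) s Hz0' Hs) as [r [Hr Hmob]].
  assert (E0 : mob (- z0) 0 = z0).
  { unfold mob. field. }
  rewrite <- E0.
  apply (mean_bound (fun z => g (mob (- z0) z)) 0 r 1); [exact Hr | |].
  - intros z Hz. apply unit_disc_disc in Hz.
    destruct (Cder_mob _ z Hz0' Hz) as [l Hl].
    destruct (Hg (mob (- z0) z)) as [k Hk]; [now apply mob_unit_disc |].
    eexists. apply Cder_comp; [exact Hl | exact Hk].
  - intros t Ht. pose proof (circle_pt_dist 0 r t ltac:(lra)) as E.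
    replace (circle_pt 0 r t - 0) with (circle_pt 0 r t) in E by ring.
    apply H. split.
    + apply Hmob. lra.
    + apply mob_unit_disc; [exact Hz0' | unfold unit_disc; lra].
Qed.

(** The quotient of [mob (f z1) (f z)] by [mob z1 z] has a removable singularity at [z1]. Near the
    unit circle its numerator has modulus at most 1 and its denominator modulus close to 1, so the
    maximum principle applies. *)
Lemma schwarz_pick (f : C -> C) (z1 z2 : C) : holomorphic_self_map f ->
  unit_disc z1 -> unit_disc z2 -> (Cmod (mob (f z1) (f z2)) <= Cmod (mob z1 z2))%R.
Proof.
  intros [Hf Hmap] H1 H2. apply holomorphic_differentiable in Hf.
  set (F := fun z => mob (f z1) (f z)).
  assert (HF : differentiable_on unit_disc F).
  { intros z Hz. destruct (Hf z Hz) as [l Hl].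
    destruct (Cder_mob (f z1) (f z) (Hmap _ H1) (Hmap _ Hz)) as [k Hk].
    eexists. apply (Cder_comp (mob (f z1)) f); [exact Hl | exact Hk]. }
  assert (F1 : F z1 = 0).
  { unfold F, mob. field. apply mob_denom_neq_0; now apply Hmap. }
  destruct (HF z1 H1) as [l Hl].
  (* The quotient of [F] by [mob z1], with its singularity absorbed in the difference quotient. *)
  set (g := fun z => diff_quot F z1 l z * (1 - Cconj z1 * z)).
  assert (Hgq : forall z, unit_disc z -> z <> z1 -> g z = F z / mob z1 z).
  { intros z Hz Nz. unfold g. rewrite diff_quot_neq by exact Nz. rewrite F1. unfold mob at 1.
    field. split; [now apply mob_denom_neq_0 | now apply Cminus_eq_contra]. }
  destruct (Ceq_dec z2 z1) as [-> | N].
  { change (Cmod (F z1) <= Cmod (mob z1 z1))%R. rewrite F1, Cmod_0. apply Cmod_ge_0. }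
  assert (B : (Cmod (g z2) <= 1)%R).
  { apply disc_max_principle; [| exact H2 |].
    - intros z Hz.
      destruct (diff_quot_differentiable unit_disc F z1 l unit_disc_open H1 HF Hl z Hz) as [k Hk].
      eexists. apply Cder_mult; [exact Hk |].
      apply Cder_minus; [apply Cder_const | apply Cder_scal, Cder_id].
    - intros eps Heps.
      assert (Hi : (0 < / (1 + eps) < 1)%R).
      { split; [apply Rinv_0_lt_compat; lra |]. rewrite <- Rinv_1. apply Rinv_lt_contravar; lra. }
      destruct (mob_boundary z1 (/ (1 + eps)) H1 ltac:(lra)) as [s [Hs H]].
      exists s. split; [lra |]. intros z Hz. specialize (H z Hz).
      assert (Hzd : unit_disc z) by (unfold unit_disc; lra).
      assert (Nm : mob z1 z <> 0) by (apply Cmod_gt_0; lra).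
      assert (Nz : z <> z1).
      { intros ->. apply Nm. unfold mob. field. now apply mob_denom_neq_0. }
      rewrite (Hgq z Hzd Nz), Cmod_div by exact Nm.
      assert (BF : (Cmod (F z) <= 1)%R) by (left; apply mob_unit_disc; now apply Hmap).
      rewrite <- (Rmult_1_l (1 + eps)).
      apply Rmult_le_compat; [apply Cmod_ge_0 | left; apply Rinv_0_lt_compat; lra | exact BF |].
      rewrite <- (Rinv_inv (1 + eps)). apply Rinv_le_contravar; lra. }
  assert (Nm : mob z1 z2 <> 0).
  { unfold mob. intros E. apply (Cminus_eq_contra _ _ N).
    replace (z2 - z1) with ((z2 - z1) / (1 - Cconj z1 * z2) * (1 - Cconj z1 * z2))
      by (field; now apply mob_denom_neq_0).
    rewrite E. ring. }
  rewrite (Hgq z2 H2 N), Cmod_div in B by exact Nm.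
  apply Cmod_gt_0 in Nm.
  change (Cmod (F z2) <= Cmod (mob z1 z2))%R.
  apply Rmult_le_compat_r with (r := Cmod (mob z1 z2)) in B; [| lra].
  unfold Rdiv in B. rewrite Rmult_assoc, Rinv_l in B by lra. lra.
Qed.

Lemma hyperbolic_distance_mono (z w z' w' : C) :
  unit_disc z -> unit_disc w -> (Cmod (mob w' z') <= Cmod (mob w z))%R ->
  (0 <= hyperbolic_distance z' w' <= hyperbolic_distance z w)%R.
Proof.
  intros Hz Hw H. unfold hyperbolic_distance. fold (mob w z) (mob w' z').
  pose proof (Cmod_ge_0 (mob w' z')) as P. pose proof (mob_unit_disc w z Hw Hz) as Q.
  unfold unit_disc in Q. set (t := Cmod (mob w z)) in *. set (t' := Cmod (mob w' z')) in *.
  assert (B1 : (1 <= (1 + t') / (1 - t'))%R).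
  { apply Rmult_le_reg_r with (1 - t')%R; [lra |].
    unfold Rdiv. rewrite Rmult_assoc, Rinv_l; lra. }
  assert (B2 : ((1 + t') / (1 - t') <= (1 + t) / (1 - t))%R).
  { apply Rmult_le_compat; [lra | left; apply Rinv_0_lt_compat; lra | lra |].
    apply Rinv_le_contravar; lra. }
  assert (L1 : (0 <= ln ((1 + t') / (1 - t')))%R) by (rewrite <- ln_1; apply ln_le; lra).
  assert (L2 : (ln ((1 + t') / (1 - t')) <= ln ((1 + t) / (1 - t)))%R) by (apply ln_le; lra).
  lra.
Qed.

Lemma iterate_unit_disc (f : C -> C) (n : nat) (z : C) : holomorphic_self_map f ->
  unit_disc z -> unit_disc (iterate n f z).
Proof. intros [_ H] Hz. induction n as [| n IH]; [exact Hz | now apply H]. Qed.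

Lemma hyperbolic_step_dichotomy (f : C -> C) : holomorphic_self_map f ->
  zero_hyperbolic_step f \/ positive_hyperbolic_step f.
Proof.
  intros Hf.
  assert (H0 : unit_disc 0) by (unfold unit_disc; rewrite Cmod_0; lra).
  set (u := fun n => hyperbolic_distance (iterate n f 0) (iterate (n + 1) f 0)).
  assert (Hu : forall n, (0 <= u (S n) <= u n)%R).
  { intros n. unfold u. rewrite !Nat.add_1_r.
    apply hyperbolic_distance_mono; try now apply iterate_unit_disc.
    apply (schwarz_pick f); [exact Hf | now apply (iterate_unit_disc f (S n)) |].
    now apply iterate_unit_disc. }
  assert (Hu0 : forall n, (0 <= u n)%R).
  { intros n. destruct (Hu n). lra. }
  destruct (ex_finite_lim_seq_decr u 0 (fun n => proj2 (Hu n)) Hu0) as [l Hl].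
  assert (Pl : (0 <= l)%R).
  { pose proof (is_lim_seq_le (fun _ => 0%R) u 0 l Hu0 (is_lim_seq_const 0) Hl) as B. exact B. }
  destruct (Rle_lt_or_eq_dec _ _ Pl) as [Hpos | Heq].
  - right. exists 0. split; [exact H0 |]. now exists l.
  - left. exists 0. split; [exact H0 |]. unfold hyperbolic_step_at. rewrite <- Heq in Hl. exact Hl.
Qed.

(** * Commuting maps and the Koenigs function *)

Lemma Cder_semiconj (U : C -> Prop) (b f : C -> C) (z k l k' mu nu : C) :
  open U -> U z -> (forall w, U w -> b (f w) = mu * b w + nu) ->
  Cder f z l -> Cder b (f z) k -> Cder b z k' -> k * l = mu * k'.
Proof.
  intros HU Hz E Hl Hk Hk'. apply (Cder_unique (fun w => b (f w)) z).
  - now apply Cder_comp.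
  - destruct (open_C U z HU Hz) as [d [Hd H]].
    apply Cder_loc with (f := fun w => mu * b w + nu) (d := d); [exact Hd | |].
    + intros w Hw. symmetry. now apply E, H.
    + apply Cder_eq with (mu * k' + 0); [ring |].
      apply Cder_plus; [now apply Cder_scal | apply Cder_const].
Qed.

(** Since [b (f z) = b z + gamma], the map [f] preserves the form [db]. Hence [k db] pulls back to
    [(mu * k + nu) db], which has the primitive [mu * P + nu * b]. *)
Lemma primitive_pullback (P k b b' f : C -> C) (mu nu gamma : C) :
  holomorphic_self_map f ->
  (forall z, unit_disc z -> Cder b z (b' z)) ->
  (forall z, unit_disc z -> Cder P z (k z * b' z)) ->
  (forall z, unit_disc z -> b (f z) = b z + gamma) ->
  (forall z, unit_disc z -> k (f z) = mu * k z + nu) ->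
  exists J, forall z, unit_disc z -> P (f z) = mu * P z + nu * b z + J.
Proof.
  intros [Hf Hmap] Hb HP Eb Ek. apply holomorphic_differentiable in Hf.
  set (D := fun z => P (f z) - (mu * P z + nu * b z)).
  assert (H0 : unit_disc 0) by (unfold unit_disc; rewrite Cmod_0; lra).
  exists (D 0). intros z Hz.
  replace (D 0) with (D z); [unfold D; ring |].
  apply (constant_of_Cder_0 unit_disc D); [apply unit_disc_convex | | exact Hz | exact H0].
  clear z Hz. intros z Hz. destruct (Hf z Hz) as [l Hl].
  assert (E : b' (f z) * l = 1 * b' z).
  { apply (Cder_semiconj unit_disc b f z _ _ _ 1 gamma); try assumption.
    - apply unit_disc_open.
    - intros w Hw. rewrite (Eb w Hw). ring.
    - apply Hb, Hmap, Hz.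
    - apply Hb, Hz. }
  eapply Cder_eq; [| apply Cder_minus; [apply (Cder_comp P f); [exact Hl | apply HP, Hmap, Hz] |
    apply Cder_plus; apply Cder_scal; [apply HP, Hz | apply Hb, Hz]]].
  rewrite (Ek z Hz).
  transitivity ((mu * k z + nu) * (b' (f z) * l) - (mu * (k z * b' z) + nu * b' z)); [ring |].
  rewrite E. ring.
Qed.

(* The Heisenberg relation: comparing the increments of [P] along the two orders of
   composition of the commuting maps leaves only the term [nu]. *)
Lemma commuting_increments (phi psi P k b b' : C -> C) (c mu nu : C) :
  holomorphic_self_map phi -> holomorphic_self_map psi -> commuting phi psi ->
  (forall z, unit_disc z -> Cder b z (b' z)) ->
  (forall z, unit_disc z -> Cder P z (k z * b' z)) ->
  (forall z, unit_disc z -> b (phi z) = b z + 1) ->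
  (forall z, unit_disc z -> b (psi z) = b z + c) ->
  (forall z, unit_disc z -> k (phi z) = k z) ->
  (forall z, unit_disc z -> k (psi z) = mu * k z + nu) ->
  exists I, (forall z, unit_disc z -> P (phi z) = P z + I) /\ (1 - mu) * I = nu.
Proof.
  intros Hphi Hpsi Hcomm Hb HP Ephi Epsi Kphi Kpsi.
  destruct (primitive_pullback P k b b' phi 1 0 1) as [I HI]; try assumption.
  { intros z Hz. rewrite (Kphi z Hz). ring. }
  destruct (primitive_pullback P k b b' psi mu nu c) as [J HJ]; try assumption.
  exists I. split.
  - intros z Hz. rewrite (HI z Hz). ring.
  - assert (H0 : unit_disc 0) by (unfold unit_disc; rewrite Cmod_0; lra).
    pose proof (HI _ (proj2 Hpsi _ H0)) as E1. pose proof (HJ _ (proj2 Hphi _ H0)) as E2.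
    (* The two values of [P] at [phi (psi 0) = psi (phi 0)] give [I = mu * I + nu]; the constant [J]
       cancels. *)
    rewrite (Hcomm 0 H0), E2, (HI 0 H0), (HJ 0 H0), (Ephi 0 H0) in E1.
    apply Ceq_minus. apply (proj1 (Ceq_minus _ _)) in E1.
    match type of E1 with @eq _ ?x _ => transitivity (- x); [ring |] end.
    rewrite E1. ring.
Qed.

Lemma translation_ratio (phi psi b h : C -> C) (c c1 c2 : C) :
  holomorphic_self_map phi -> holomorphic_self_map psi -> commuting phi psi ->
  differentiable_on unit_disc b -> differentiable_on unit_disc h ->
  (forall z, unit_disc z -> b (phi z) = b z + 1) ->
  (forall z, unit_disc z -> b (psi z) = b z + c) ->
  (forall z, unit_disc z -> h (phi z) = h z + c1) ->
  (forall z, unit_disc z -> h (psi z) = h z + c2) ->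
  c2 = c1 * c.
Proof.
  intros Hphi Hpsi Hcomm Hb Hh Bphi Bpsi Ephi Epsi.
  destruct (primitive unit_disc (fun z => (h z - c1 * b z) * Cd b z)) as [P HP].
  - apply unit_disc_open.
  - apply unit_disc_convex.
  - intros z Hz. destruct (Hh z Hz) as [l Hl]. destruct (Hb z Hz) as [k Hk].
    destruct (Cd_differentiable _ _ unit_disc_open Hb z Hz) as [m Hm].
    eexists. apply Cder_mult; [| exact Hm]. apply Cder_minus; [exact Hl | apply Cder_scal, Hk].
  - destruct (commuting_increments phi psi P (fun z => h z - c1 * b z) b (Cd b) c 1 (c2 - c1 * c))
      as [I [_ E]]; try assumption.
    + intros z Hz. now apply (Cd_correct unit_disc).
    + intros z Hz. rewrite (Ephi z Hz), (Bphi z Hz). ring.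
    + intros z Hz. rewrite (Epsi z Hz), (Bpsi z Hz). ring.
    + apply Ceq_minus. rewrite <- E. ring.
Qed.

Lemma iterate_translation (f k : C -> C) (c : C) : holomorphic_self_map f ->
  (forall z, unit_disc z -> k (f z) = k z + c) ->
  forall n z, unit_disc z -> k (iterate n f z) = k z + RtoC (INR n) * c.
Proof.
  intros Hf E n z Hz. induction n as [| n IH].
  - unfold iterate; simpl. ring.
  - change (iterate (S n) f z) with (f (iterate n f z)).
    rewrite E by now apply iterate_unit_disc. rewrite IH, S_INR, RtoC_plus. ring.
Qed.

Lemma iterate_add (f : C -> C) (m n : nat) (z : C) :
  iterate (m + n) f z = iterate m f (iterate n f z).
Proof. apply Nat.iter_add. Qed.

(** [K] takes the value [k z] at every [q z - n]. Moving points by [phi] into the absorbing domain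
    makes [q] injective, which shows both that this is consistent and, through local inverses of
    [q], that [K] is differentiable. *)
Lemma koenigs_factor (phi : C -> C) (U : C -> Prop) (q k : C -> C) :
  holomorphic_self_map phi -> canonical_model phi U q ->
  differentiable_on unit_disc k -> (forall z, unit_disc z -> k (phi z) = k z) ->
  exists K, differentiable_on U K /\ (forall z, unit_disc z -> K (q z) = k z) /\
    (forall w, U w -> K (w + 1) = K w).
Proof.
  intros Hphi [Hq Hinto Habel Hunion [V [[[HVo [_ _]] [HVD [HVphi Habs]]] Hinj]] _ _] Hk Ek.
  apply holomorphic_differentiable in Hq.
  assert (Hki : forall n z, unit_disc z -> k (iterate n phi z) = k z).
  { intros n z Hz. rewrite (iterate_translation phi k 0 Hphi) by (try assumption; intros; rewrite Ek by assumption; ring).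
    ring. }
  pose proof (iterate_translation phi q 1 Hphi Habel) as Hqi.
  assert (HVi : forall n z, V z -> V (iterate n phi z)).
  { intros n z Hz. induction n as [| n IH]; [exact Hz | now apply HVphi]. }
  (* The iterates of order [N2 + N1 + m] of [z] and [N1 + N2 + n] of [z'] both lie in [V] and have
     the same image under [q], hence coincide; [k] is unchanged along orbits. *)
  assert (Hwd : forall n m z z', unit_disc z -> unit_disc z' ->
    q z - RtoC (INR n) = q z' - RtoC (INR m) -> k z = k z').
  { intros n m z z' Hz Hz' E.
    destruct (Habs _ (iterate_unit_disc phi m z Hphi Hz)) as [N1 HN1].
    destruct (Habs _ (iterate_unit_disc phi n z' Hphi Hz')) as [N2 HN2].
    apply (HVi N2) in HN1. apply (HVi N1) in HN2.
    rewrite <- !iterate_add in HN1, HN2.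
    rewrite <- (Hki (N2 + N1 + m)%nat z Hz), <- (Hki (N1 + N2 + n)%nat z' Hz').
    f_equal. apply Hinj; [exact HN1 | exact HN2 |].
    rewrite !Hqi by assumption. rewrite !plus_INR, !RtoC_plus.
    replace (q z) with (q z' - RtoC (INR m) + RtoC (INR n)) by (rewrite <- E; ring). ring. }
  set (K := fun w => epsilon (inhabits (RtoC 0))
    (fun v => exists n z, unit_disc z /\ w = q z - RtoC (INR n) /\ v = k z)).
  assert (HK : forall n z, unit_disc z -> K (q z - RtoC (INR n)) = k z).
  { intros n z Hz. unfold K.
    destruct (epsilon_spec (inhabits (RtoC 0)) (fun v => exists n' z', unit_disc z' /\
      q z - RtoC (INR n) = q z' - RtoC (INR n') /\ v = k z')) as [n' [z' [Hz' [E ->]]]].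
    - exists (k z), n, z. auto.
    - symmetry. now apply (Hwd n n'). }
  exists K. split; [| split].
  - intros w Hw. apply Hunion in Hw as [n [z [Hz ->]]].
    (* Near [w], the function [K] is the translation by [sh = n + N] followed by a local inverse [g]
       of [q] near [q a] and then by [k]. *)
    destruct (Habs z Hz) as [N HN]. set (a := iterate N phi z) in *.
    destruct (open_C V a HVo HN) as [R0 [HR0 Hball]].
    assert (HD : forall v, disc a R0 v -> unit_disc v) by (intros v Hv; apply HVD, Hball, Hv).
    assert (Hqa : differentiable_on (disc a R0) q) by (intros v Hv; apply Hq, HD, Hv).
    assert (Hqinj : injective_on (disc a R0) q)
      by (intros u v Hu Hv E; apply Hinj; [now apply Hball | now apply Hball | exact E]).
    destruct (injective_open q a R0 R0 ltac:(lra) Hqa Hqinj) as [rho [Hrho Hsurj]].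
    set (g := fun v => epsilon (inhabits (RtoC 0)) (fun u => disc a R0 u /\ q u = v)).
    assert (Hg : forall v, (Cmod (v - q a) < rho)%R -> disc a R0 (g v) /\ q (g v) = v).
    { intros v Hv. apply (epsilon_spec (inhabits (RtoC 0)) (fun u => disc a R0 u /\ q u = v)).
      now apply Hsurj. }
    destruct (Hqa a (disc_center a R0 HR0)) as [l Hl].
    pose proof (inverse_Cder q g a l R0 rho HR0 Hrho Hqa Hqinj Hl Hg) as Dg.
    assert (Ega : g (q a) = a).
    { destruct (Hg (q a)) as [G1 G2].
      - replace (q a - q a) with (RtoC 0) by ring. now rewrite Cmod_0.
      - apply Hqinj; [exact G1 | now apply disc_center | exact G2]. }
    destruct (Hk a (HVD a HN)) as [m Hm].
    assert (Ea : q a = q z + RtoC (INR N)) by (unfold a; rewrite Hqi by exact Hz; ring).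
    set (sh := RtoC (INR n) + RtoC (INR N)).
    exists (m * / l).
    apply Cder_loc with (f := fun w => k (g (w + sh))) (d := rho); [exact Hrho | |].
    + intros w Hw. destruct (Hg (w + sh)) as [G1 G2].
      { rewrite Ea. unfold sh.
        now replace (w + (RtoC (INR n) + RtoC (INR N)) - (q z + RtoC (INR N)))
          with (w - (q z - RtoC (INR n))) by ring. }
      rewrite <- (HK (n + N)%nat (g (w + sh))) by now apply HD.
      f_equal. rewrite G2, plus_INR, RtoC_plus. unfold sh. ring.
    + apply (Cder_shift (fun w => k (g w))).
      replace (q z - RtoC (INR n) + sh) with (q a) by (rewrite Ea; unfold sh; ring).
      apply (Cder_comp k g); [exact Dg | now rewrite Ega].
  - intros z Hz. rewrite <- (HK 0%nat z Hz). f_equal. simpl. ring.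
  - intros w Hw. apply Hunion in Hw as [n [z [Hz ->]]].
    rewrite (HK n z Hz), <- (Ek z Hz), <- (HK n (phi z)) by now apply Hphi.
    f_equal. rewrite (Habel z Hz). ring.
Qed.

(** * Periodic functions on half-planes *)

Lemma Cexp_i2pi_eq_1 (d : C) : Cexp (i2pi * d) = 1 -> exists n : Z, d = RtoC (IZR n).
Proof.
  intros E. pose proof PI_RGT_0 as HPI.
  assert (Hre : Re (i2pi * d) = (- (2 * PI * Im d))%R)
    by (unfold i2pi, Ci, Re, Im, RtoC, Cmult; destruct d; simpl; ring).
  assert (Him : Im (i2pi * d) = (2 * (PI * Re d))%R)
    by (unfold i2pi, Ci, Re, Im, RtoC, Cmult; destruct d; simpl; ring).
  pose proof (Cmod_Cexp (i2pi * d)) as Hm. rewrite E, Cmod_1, Hre in Hm.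
  rewrite <- exp_0 in Hm. apply exp_inv in Hm.
  assert (Id : Im d = 0%R) by nra.
  assert (Hc : cos (2 * (PI * Re d)) = 1%R).
  { pose proof (f_equal Re E) as HR. unfold Cexp in HR.
    rewrite Him, Hre, Id in HR. replace (- (2 * PI * 0))%R with 0%R in HR by ring.
    rewrite exp_0, Cmult_1_l in HR. exact HR. }
  rewrite cos_2a_sin in Hc.
  assert (Hs : sin (PI * Re d) = 0%R) by nra.
  apply sin_eq_0_0 in Hs as [n Hn]. exists n.
  destruct d as [x y]. unfold Re, Im in *; simpl in *. unfold RtoC. f_equal; [nra | exact Id].
Qed.

(** Nonreal [c] is included: the value 1 would make [n * c] an integer, hence [c] rational. *)
Lemma Cexp_irrational (c : C) (n : Z) : ~ rational c -> n <> 0%Z ->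
  Cexp (RtoC (IZR n) * i2pi * c) <> 1.
Proof.
  intros Hc Hn E.
  replace (RtoC (IZR n) * i2pi * c) with (i2pi * (RtoC (IZR n) * c)) in E by ring.
  apply Cexp_i2pi_eq_1 in E as [k Hk]. apply Hc.
  exists (inject_Z k / inject_Z n)%Q.
  assert (Nn : IZR n <> 0%R) by now apply not_0_IZR.
  assert (En : Q2R (inject_Z n) = IZR n) by (unfold Q2R, inject_Z; simpl; field).
  assert (Ek : Q2R (inject_Z k) = IZR k) by (unfold Q2R, inject_Z; simpl; field).
  rewrite Q2R_div, En, Ek.
  - rewrite RtoC_div by exact Nn. rewrite <- Hk. field.
    intros E. now apply RtoC_inj in E.
  - intros E. apply Qeq_eqR in E. rewrite En in E. unfold Q2R in E; simpl in E. lra.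
Qed.

Lemma Cexp_i2pi_IZR (n : Z) : Cexp (RtoC (IZR n) * i2pi) = 1.
Proof.
  assert (Hnat : forall k : nat, Cexp (RtoC (INR k) * i2pi) = 1).
  { induction k as [| k IH].
    - simpl. replace (0 * i2pi) with (RtoC 0) by ring. apply Cexp_0.
    - rewrite S_INR, RtoC_plus.
      replace ((RtoC (INR k) + 1) * i2pi) with (RtoC (INR k) * i2pi + i2pi) by ring.
      now rewrite Cexp_period. }
  destruct (Z_le_gt_dec 0 n) as [H | H].
  - rewrite <- (Z2Nat.id n H), <- INR_IZR_INZ. apply Hnat.
  - pose proof (Cexp_opp (RtoC (IZR n) * i2pi)) as E.
    replace (- (RtoC (IZR n) * i2pi)) with (RtoC (INR (Z.to_nat (- n))) * i2pi) in E.
    + now rewrite Hnat, Cmult_1_r in E.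
    + rewrite INR_IZR_INZ, Z2Nat.id, opp_IZR, RtoC_opp by lia. ring.
Qed.

(** The sign [s = 1] or [s = -1] treats the upper and lower half-planes together; [m] measures the
    depth. *)
Definition half_plane (s m : R) (w : C) : Prop := (m < s * Im w)%R.

Lemma half_plane_open (s m : R) : open (half_plane s m).
Proof.
  intros u Hu. unfold half_plane in Hu. apply locally_C_Cmod.
  pose proof (Rabs_pos s) as Ps.
  exists ((s * Im u - m) / (Rabs s + 1))%R. split; [apply Rdiv_lt_0_compat; lra |].
  intros w Hw. unfold half_plane.
  pose proof (im_le_Cmod (w - u)) as H. unfold Cminus in H. rewrite im_plus, im_opp in H.
  fold (w - u) in H.
  assert (B : (Rabs (s * (Im w + - Im u)) < s * Im u - m)%R).
  { rewrite Rabs_mult. apply Rle_lt_trans with ((Rabs s + 1) * Cmod (w - u))%R.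
    - apply Rmult_le_compat; try lra; apply Rabs_pos.
    - apply Rmult_lt_compat_l with (r := (Rabs s + 1)%R) in Hw; [| lra].
      replace ((Rabs s + 1) * ((s * Im u - m) / (Rabs s + 1)))%R with (s * Im u - m)%R in Hw
        by (field; lra). exact Hw. }
  apply Rabs_def2 in B. nra.
Qed.

Lemma half_plane_convex (s m : R) : convex_set (half_plane s m).
Proof.
  intros a b t Ha Hb Ht. unfold half_plane in *. rewrite Im_curve.
  destruct (Req_dec t 0) as [-> | N]; [nra |].
  replace (s * ((1 - t) * Im a + t * Im b))%R with ((1 - t) * (s * Im a) + t * (s * Im b))%R by ring.
  nra.
Qed.

Lemma Im_plus_real (w : C) (r : R) : Im (w + RtoC r) = Im w.
Proof. rewrite im_plus, im_RtoC. ring. Qed.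

Lemma half_plane_real_shift (s m : R) (w : C) (r : R) :
  half_plane s m (w + RtoC r) <-> half_plane s m w.
Proof. unfold half_plane. now rewrite Im_plus_real. Qed.

Lemma translation_IZR (s m : R) (f : C -> C) (c : C) :
  (forall w, half_plane s m w -> f (w + 1) = f w + c) ->
  forall (n : Z) w, half_plane s m w -> f (w + RtoC (IZR n)) = f w + RtoC (IZR n) * c.
Proof.
  intros H.
  assert (Hnat : forall (k : nat) w, half_plane s m w -> f (w + RtoC (INR k)) = f w + RtoC (INR k) * c).
  { intros k w Hw. induction k as [| k IH].
    - simpl. replace (w + 0) with w by ring. ring.
    - rewrite S_INR, RtoC_plus. replace (w + (RtoC (INR k) + 1)) with (w + RtoC (INR k) + 1) by ring.
      rewrite H by now apply half_plane_real_shift. rewrite IH. ring. }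
  intros n w Hw. destruct (Z_le_gt_dec 0 n) as [Hn | Hn].
  - rewrite <- (Z2Nat.id n Hn), <- INR_IZR_INZ. now apply Hnat.
  - assert (Hw' : half_plane s m (w + RtoC (IZR n))) by now apply half_plane_real_shift.
    pose proof (Hnat (Z.to_nat (- n)) _ Hw') as E.
    rewrite INR_IZR_INZ, Z2Nat.id, opp_IZR, RtoC_opp in E by lia.
    replace (w + RtoC (IZR n) + - RtoC (IZR n)) with w in E by ring.
    rewrite E. ring.
Qed.

Lemma Cd_translation (s m : R) (f : C -> C) (c w : C) :
  differentiable_on (half_plane s m) f ->
  (forall w, half_plane s m w -> f (w + 1) = f w + c) -> half_plane s m w -> Cd f (w + 1) = Cd f w.
Proof.
  intros Hf E Hw. apply (Cder_unique (fun w => f (w + 1)) w).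
  - apply Cder_shift, (Cd_correct (half_plane s m)); [exact Hf |].
    now apply half_plane_real_shift.
  - destruct (open_C _ w (half_plane_open s m) Hw) as [d [Hd H]].
    apply Cder_loc with (f := fun w => f w + c) (d := d); [exact Hd | |].
    + intros v Hv. symmetry. now apply E, H.
    + apply Cder_eq with (Cd f w + 0); [ring |].
      apply Cder_plus; [now apply (Cd_correct (half_plane s m)) | apply Cder_const].
Qed.

(** The integral of a function of period 1 over a horizontal period does not depend on its starting
    point, so means and Fourier modes may be computed at any height. *)
Lemma increment_constant (s m : R) (P p : C -> C) (u v : C) :
  (forall w, half_plane s m w -> Cder P w (p w)) ->
  (forall w, half_plane s m w -> p (w + 1) = p w) ->
  half_plane s m u -> half_plane s m v -> P (u + 1) - P u = P (v + 1) - P v.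
Proof.
  intros HP Hp Hu Hv.
  apply (constant_of_Cder_0 (half_plane s m) (fun w => P (w + 1) - P w));
    [apply half_plane_convex | | exact Hu | exact Hv].
  intros w Hw. eapply Cder_eq; [| apply Cder_minus; [apply Cder_shift, HP | apply HP, Hw]].
  - rewrite (Hp w Hw). ring.
  - now apply half_plane_real_shift.
Qed.

Lemma seg_bounded (f : C -> C) (a b : C) : Ccont_seg f a b ->
  exists M, forall t, (0 <= t <= 1)%R -> (Cmod (f (a + RtoC t * (b - a))%C) <= M)%R.
Proof.
  intros Hf.
  destruct (continuity_ab_maj (fun t => Cmod (f (a + RtoC t * (b - a)))) 0 1) as [t0 [H0 _]].
  - lra.
  - intros t Ht eps Heps. destruct (Hf t Ht eps Heps) as [d [Hd H]].
    pose proof (Cmod_ge_0 (b - a)) as P.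
    exists (d / (Cmod (b - a) + 1))%R. split; [apply Rdiv_lt_0_compat; lra |].
    intros s [_ Hs]. simpl in *. unfold Rdist in *.
    specialize (H _ (curve_small a b s t d Hd Hs)).
    apply Rle_lt_trans with (2 := H), Rabs_le.
    pose proof (Cmod_triangle_inv (f (a + RtoC s * (b - a))) (f (a + RtoC t * (b - a)))).
    pose proof (Cmod_triangle_inv (f (a + RtoC t * (b - a))) (f (a + RtoC s * (b - a)))) as H2.
    rewrite Cmod_minus_sym in H2. lra.
  - eexists. exact H0.
Qed.

Lemma geometric_decay (z : C) (C0 q : R) : (0 <= q < 1)%R ->
  (forall n : nat, (Cmod z <= C0 * q ^ n)%R) -> z = 0.
Proof.
  intros Hq H. apply Ceq_small with C0. intros eps Heps.
  replace (z - 0) with z by ring.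
  destruct (pow_lt_1_zero q) with (y := eps) as [N HN].
  - rewrite Rabs_right; lra.
  - exact Heps.
  - specialize (HN N (le_n N)). rewrite Rabs_right in HN by (apply Rle_ge, pow_le; lra).
    pose proof (H 0%nat) as H0. simpl in H0. specialize (H N). pose proof (Cmod_ge_0 z).
    apply Rle_trans with (1 := H), Rmult_le_compat_l; lra.
Qed.

(** The characters of the cylinder [C / Z]. *)
Definition character (n : Z) (b : C) : C := Cexp (RtoC (IZR n) * i2pi * b).

Lemma character_plus (n : Z) (a b : C) : character n (a + b) = character n a * character n b.
Proof. unfold character. rewrite <- Cexp_plus. f_equal. ring. Qed.

Lemma character_succ (n : Z) (b : C) : character (n + 1) b = character n b * Cexp (i2pi * b).
Proof. unfold character. rewrite <- Cexp_plus. f_equal. rewrite plus_IZR, RtoC_plus. ring. Qed.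

Lemma character_0 (b : C) : character 0 b = 1.
Proof. unfold character. replace (RtoC (IZR 0) * i2pi * b) with (RtoC 0) by ring. apply Cexp_0. Qed.

Lemma character_one (n : Z) : character n 1 = 1.
Proof. unfold character. rewrite Cmult_1_r. apply Cexp_i2pi_IZR. Qed.

Lemma Cder_character (n : Z) (f : C -> C) (z l : C) : Cder f z l ->
  Cder (fun w => character n (f w)) z (RtoC (IZR n) * i2pi * character n (f z) * l).
Proof.
  intros H. eapply Cder_eq; [| apply (Cder_Cexp_comp (fun w => RtoC (IZR n) * i2pi * f w)), Cder_scal, H].
  unfold character. ring.
Qed.

Lemma Cmod_character (n : Z) (b : C) : Cmod (character n b) = exp (- (2 * PI * IZR n * Im b)).
Proof.
  unfold character. rewrite Cmod_Cexp. f_equal.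
  unfold i2pi, Ci, Re, Im, RtoC, Cmult; destruct b; simpl. ring.
Qed.

(** * Cauchy's formula on a cylinder *)

Section Kernel.

Variables (s m : R) (K beta : C -> C) (w0 : C).
Hypothesis HK : differentiable_on (half_plane s m) K.
Hypothesis Hbeta : differentiable_on (half_plane s m) beta.
Hypothesis EK : forall w, half_plane s m w -> K (w + 1) = K w.
Hypothesis Ebeta : forall w, half_plane s m w -> beta (w + 1) = beta w + 1.
Hypothesis Hpole : forall w, half_plane s m w -> Cexp (i2pi * (beta w - beta w0)) = 1 ->
  K w = K w0 /\ Cd beta w <> 0.

Let x (w : C) : C := Cexp (i2pi * (beta w - beta w0)).

Lemma x_Cder (w : C) : half_plane s m w -> Cder x w (i2pi * x w * Cd beta w).
Proof.
  intros Hw. eapply Cder_eq;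
    [| apply (Cder_Cexp_comp (fun w => i2pi * (beta w - beta w0))), Cder_scal, Cder_minus;
       [now apply (Cd_correct (half_plane s m)) | apply Cder_const]].
  unfold x. ring.
Qed.

(** Where [x w = 1], [Hpole] makes a zero of [K w - K w0] meet a simple zero of [x - 1]. As
    [x' = i2pi * beta'] there, the factor [beta'] cancels and the limit is [Cd K w / i2pi]. *)
Definition kernel_quot (w : C) : C :=
  if Ceq_dec (x w) 1 then Cd K w / i2pi else (K w - K w0) * Cd beta w / (x w - 1).

Lemma kernel_quot_spec (w : C) : half_plane s m w ->
  kernel_quot w * (x w - 1) = (K w - K w0) * Cd beta w.
Proof.
  intros Hw. unfold kernel_quot. destruct (Ceq_dec (x w) 1) as [E | N].
  - destruct (Hpole w Hw E) as [-> _]. rewrite E. ring.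
  - field. now apply Cminus_eq_contra.
Qed.

(** Around a point where [x = 1], numerator and denominator are replaced by their difference
    quotients; that of [x] does not vanish nearby because [Cd beta w <> 0]. *)
Lemma kernel_quot_differentiable : differentiable_on (half_plane s m) kernel_quot.
Proof.
  intros w Hw.
  destruct (Cd_differentiable _ _ (half_plane_open s m) Hbeta w Hw) as [b2 Hb2].
  pose proof (x_Cder w Hw) as Dx.
  destruct (HK w Hw) as [k Hk].
  destruct (Ceq_dec (x w) 1) as [E | N].
  - destruct (Hpole w Hw E) as [EKw Nb].
    set (lx := i2pi * x w * Cd beta w) in *.
    assert (Nl : lx <> 0).
    { unfold lx. rewrite E. apply Cmult_neq_0; [apply Cmult_neq_0 |]; [apply i2pi_neq_0 | apply C1_nz | exact Nb]. }
    assert (Hxd : differentiable_on (half_plane s m) x) by (intros v Hv; eexists; now apply x_Cder).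
    destruct (diff_quot_differentiable _ x w lx (half_plane_open s m) Hw Hxd Dx w Hw) as [qx Hqx].
    pose proof (Cd_correct _ K w HK Hw) as DK.
    destruct (diff_quot_differentiable _ K w _ (half_plane_open s m) Hw HK DK w Hw) as [qk Hqk].
    assert (Nq : diff_quot x w lx w <> 0) by now rewrite diff_quot_center.
    destruct (Ccont_neq_0 _ _ (Cder_cont _ _ _ Hqx) Nq) as [d [Hd H]].
    eexists. apply Cder_loc with
      (f := fun v => diff_quot K w (Cd K w) v * Cd beta v / diff_quot x w lx v) (d := d).
    + exact Hd.
    + intros v Hv. specialize (H v Hv). pose proof (Cmod_ge_0 (diff_quot x w lx w)).
      assert (Nv : diff_quot x w lx v <> 0) by (apply Cmod_gt_0; lra). clear H.
      unfold kernel_quot. destruct (Ceq_dec v w) as [-> | Nvw].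
      * rewrite !diff_quot_center. destruct (Ceq_dec (x w) 1) as [_ | n]; [| now contradiction n].
        unfold lx. rewrite E. field. split; [apply i2pi_neq_0 | exact Nb].
      * rewrite (diff_quot_neq K) by exact Nvw.
        rewrite (diff_quot_neq x) in Nv |- * by exact Nvw. rewrite E in Nv |- *.
        pose proof (Cminus_eq_contra _ _ Nvw) as nz.
        assert (N1 : x v - 1 <> 0).
        { intros E1. apply Nv. rewrite E1. field. exact nz. }
        destruct (Ceq_dec (x v) 1) as [E1 | _]; [apply Ceq_minus in E1; contradiction |].
        rewrite EKw. field. split; assumption.
    + apply Cder_div; [exact Nq | apply Cder_mult; [exact Hqk | exact Hb2] | exact Hqx].
  - pose proof (Cminus_eq_contra _ _ N) as N1.
    assert (Dx1 : Cder (fun v => x v - 1) w (i2pi * x w * Cd beta w - 0))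
      by (apply Cder_minus; [exact Dx | apply Cder_const]).
    destruct (Ccont_neq_0 _ _ (Cder_cont _ _ _ Dx1) N1) as [d [Hd H]].
    eexists. apply Cder_loc with (f := fun v => (K v - K w0) * Cd beta v / (x v - 1)) (d := d).
    + exact Hd.
    + intros v Hv. specialize (H v Hv). pose proof (Cmod_ge_0 (x w - 1)).
      assert (Nv : x v - 1 <> 0) by (apply Cmod_gt_0; lra).
      unfold kernel_quot. destruct (Ceq_dec (x v) 1) as [E1 | _]; [| reflexivity].
      apply Ceq_minus in E1. contradiction.
    + apply Cder_div; [exact N1 | | exact Dx1].
      apply Cder_mult; [| exact Hb2]. apply Cder_minus; [exact Hk | apply Cder_const].
Qed.

Lemma kernel_quot_periodic (w : C) : half_plane s m w -> kernel_quot (w + 1) = kernel_quot w.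
Proof.
  intros Hw. unfold kernel_quot.
  assert (Ex : x (w + 1) = x w).
  { unfold x. rewrite Ebeta by exact Hw. rewrite <- (Cexp_period (i2pi * (beta w - beta w0))).
    f_equal. ring. }
  rewrite Ex, EK by exact Hw.
  rewrite (Cd_translation s m K 0) by (try assumption; intros; rewrite EK by assumption; ring).
  now rewrite (Cd_translation s m beta 1).
Qed.

Hypothesis Hmodes : forall n : Z, n <> 0%Z -> exists P,
  (forall w, half_plane s m w -> Cder P w (K w * character n (beta w) * Cd beta w)) /\
  (forall w, half_plane s m w -> P (w + 1) = P w).

Variable P0 : C -> C.
Hypothesis HP0 : forall w, half_plane s m w -> Cder P0 w (K w * Cd beta w).
(** Starting points of two horizontal periods, above and below [w0] in the coordinate [beta]:
    [Cmod x] is at most [exp (- 2 pi d)] on the first and at least [exp (2 pi d)] on the second. *)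
Variable wa wb : C.
Variable d : R.
Hypothesis Hd : (0 < d)%R.
Hypothesis Hwa : half_plane s m wa.
Hypothesis Hwb : half_plane s m wb.
Hypothesis Htop : forall t : R, (0 <= t <= 1)%R -> (d <= Im (beta (wa + RtoC t)%C - beta w0))%R.
Hypothesis Hbot : forall t : R, (0 <= t <= 1)%R -> (Im (beta (wb + RtoC t)%C - beta w0) <= - d)%R.

Let incr (P : C -> C) (v : C) : Prop :=
  forall w, half_plane s m w -> P (w + 1) - P w = v.

(** Subtracting the constant [K w0] changes only the mean: for [n <> 0] its contribution is the
    derivative of a multiple of the periodic function [character n (beta w - beta w0)]. *)
Lemma mode_primitive (n : Z) : exists T,
  (forall w, half_plane s m w ->
     Cder T w ((K w - K w0) * Cd beta w * character n (beta w - beta w0))) /\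
  incr T (if Z.eq_dec n 0 then P0 (wa + 1) - P0 wa - K w0 else 0).
Proof.
  destruct (Z.eq_dec n 0) as [-> | Nn].
  - exists (fun w => P0 w - K w0 * beta w). split.
    + intros w Hw. eapply Cder_eq; [| apply Cder_minus; [now apply HP0 |
        apply Cder_scal, (Cd_correct (half_plane s m)); assumption]].
      rewrite character_0. ring.
    + intros w Hw. rewrite Ebeta by exact Hw.
      rewrite <- (increment_constant s m P0 _ w wa HP0); try assumption; [ring |].
      intros v Hv. rewrite EK by exact Hv. now rewrite (Cd_translation s m beta 1).
  - destruct (Hmodes n Nn) as [P [HP EP]].
    assert (NZ : RtoC (IZR n) <> 0)
      by (intros E; apply RtoC_inj in E; now apply eq_IZR in E).
    exists (fun w => character n (- beta w0) * P w
      - K w0 / (RtoC (IZR n) * i2pi) * character n (beta w - beta w0)). split.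
    + intros w Hw. eapply Cder_eq; [| apply Cder_minus; [apply Cder_scal, HP, Hw |
        apply Cder_scal, (Cder_character n (fun w => beta w - beta w0)), Cder_minus;
        [apply (Cd_correct (half_plane s m)); assumption | apply Cder_const]]].
      cbv beta. replace (character n (beta w - beta w0)) with (character n (beta w) * character n (- beta w0))
        by (rewrite <- character_plus; reflexivity).
      field. split; [apply i2pi_neq_0 | exact NZ].
    + intros w Hw. rewrite Ebeta, EP by exact Hw.
      replace (beta w + 1 - beta w0) with (beta w - beta w0 + 1) by ring.
      rewrite (character_plus n (beta w - beta w0)), character_one. ring.
Qed.

Variable Q : C -> C.
Hypothesis HQ : forall w, half_plane s m w -> Cder Q w (kernel_quot w).

Let kappa : C := Q (wa + 1) - Q wa.

Lemma Q_incr : incr Q kappa.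
Proof.
  intros w Hw. apply (increment_constant s m Q kernel_quot); try assumption.
  apply kernel_quot_periodic.
Qed.

(* [kernel_quot * x ^ n] is the remainder of the expansion of [1 / (x - 1)] valid for [|x| < 1]
   (used on the line through [wa]); only its mode of index [0] has a nonzero increment. *)
Lemma upper_remainder (n : nat) : exists R,
  (forall w, half_plane s m w ->
     Cder R w (kernel_quot w * character (Z.of_nat n) (beta w - beta w0))) /\
  incr R (if Nat.eq_dec n 0 then kappa else kappa + (P0 (wa + 1) - P0 wa - K w0)).
Proof.
  induction n as [| n [R [HR ER]]].
  - exists Q. split; [| exact Q_incr]. intros w Hw. simpl. rewrite character_0, Cmult_1_r.
    now apply HQ.
  - destruct (mode_primitive (Z.of_nat n)) as [T [HT ET]].
    exists (fun w => R w + T w). split.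
    + intros w Hw. eapply Cder_eq; [| apply Cder_plus; [now apply HR | now apply HT]].
      rewrite <- kernel_quot_spec by exact Hw.
      rewrite Nat2Z.inj_succ, <- Z.add_1_r, character_succ. unfold x. ring.
    + intros w Hw.
      replace (R (w + 1) + T (w + 1) - (R w + T w)) with ((R (w + 1) - R w) + (T (w + 1) - T w)) by ring.
      rewrite ER, ET by exact Hw. simpl.
      destruct (Nat.eq_dec n 0) as [-> | Nn]; [reflexivity |].
      destruct (Z.eq_dec (Z.of_nat n) 0) as [E | _]; [lia |]. ring.
Qed.

(** The expansion of [1 / (x - 1)] for [Cmod x > 1] contains only negative powers of [x], so the
    mean never enters and the increment stays [kappa]. *)
Lemma lower_remainder (n : nat) : exists R,
  (forall w, half_plane s m w ->
     Cder R w (kernel_quot w * character (- Z.of_nat n) (beta w - beta w0))) /\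
  incr R kappa.
Proof.
  induction n as [| n [R [HR ER]]].
  - exists Q. split; [| exact Q_incr]. intros w Hw. simpl. rewrite character_0, Cmult_1_r.
    now apply HQ.
  - destruct (mode_primitive (- Z.of_nat (S n))) as [T [HT ET]].
    exists (fun w => R w - T w). split.
    + intros w Hw. eapply Cder_eq; [| apply Cder_minus; [now apply HR | now apply HT]].
      rewrite <- kernel_quot_spec by exact Hw.
      replace (- Z.of_nat n)%Z with (- Z.of_nat (S n) + 1)%Z by lia.
      rewrite character_succ. unfold x. ring.
    + intros w Hw.
      replace (R (w + 1) - T (w + 1) - (R w - T w)) with ((R (w + 1) - R w) - (T (w + 1) - T w)) by ring.
      rewrite ER, ET by exact Hw.
      destruct (Z.eq_dec (- Z.of_nat (S n)) 0) as [E | _]; [lia |]. ring.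
Qed.

(** The increment [v] is the same for all [n], while on the period starting at [w1] the integrand is
    at most a constant times [exp (- 2 pi d (n + 1))]. The sign [e] selects the upper or the lower
    period. *)
Lemma remainder_decay (e : Z) (v w1 : C) : half_plane s m w1 ->
  (forall t : R, (0 <= t <= 1)%R -> (d <= IZR e * Im (beta (w1 + RtoC t)%C - beta w0))%R) ->
  (forall n : nat, exists T,
     (forall w, half_plane s m w ->
        Cder T w (kernel_quot w * character (e * Z.of_nat (S n)) (beta w - beta w0))) /\
     incr T v) ->
  v = 0.
Proof.
  intros Hw1 Hdt HT.
  assert (Hcurve : forall t, w1 + RtoC t * (w1 + 1 - w1) = w1 + RtoC t) by (intros; ring).
  destruct (seg_bounded kernel_quot w1 (w1 + 1)) as [M HM].
  { intros t Ht. rewrite Hcurve.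
    destruct (kernel_quot_differentiable (w1 + RtoC t)) as [l Hl].
    - now apply half_plane_real_shift.
    - exact (Cder_cont _ _ _ Hl). }
  pose proof PI_RGT_0 as HPI.
  set (q := exp (- (2 * PI * d))).
  assert (Hq : (0 <= q < 1)%R).
  { split; [left; apply exp_pos |]. unfold q. rewrite <- exp_0. apply exp_increasing. nra. }
  apply geometric_decay with (M * q)%R q; [exact Hq |]. intros n.
  destruct (HT n) as [T [DT ET]]. rewrite <- (ET w1 Hw1).
  apply Rle_trans with (M * q * q ^ n * Cmod (w1 + 1 - w1))%R.
  2: { replace (w1 + 1 - w1) with (RtoC 1) by ring. rewrite Cmod_1. lra. }
  apply (mean_value_ineq T (fun w => kernel_quot w * character (e * Z.of_nat (S n)) (beta w - beta w0))).
  intros t Ht. specialize (HM t Ht). specialize (Hdt t Ht). rewrite Hcurve in HM |- *. split.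
  - apply DT. now apply half_plane_real_shift.
  - rewrite Cmod_mult, Cmod_character.
    rewrite (Rmult_assoc M).
    apply Rmult_le_compat; [apply Cmod_ge_0 | left; apply exp_pos | exact HM |].
    replace (q * q ^ n)%R with (exp (- (2 * PI * d * INR (S n)))).
    + rewrite mult_IZR, <- INR_IZR_INZ.
      assert (B : (- (2 * PI * (IZR e * INR (S n)) * Im (beta (w1 + RtoC t)%C - beta w0))
        <= - (2 * PI * d * INR (S n)))%R).
      { pose proof (pos_INR (S n)).
        assert (INR (S n) * d <= INR (S n) * (IZR e * Im (beta (w1 + RtoC t)%C - beta w0)))%R
          by (apply Rmult_le_compat_l; assumption). nra. }
      destruct (Rle_lt_or_eq_dec _ _ B) as [B' | ->]; [left; now apply exp_increasing | lra].
    + change (q * q ^ n)%R with (q ^ S n)%R. unfold q.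
      rewrite <- Rpower_pow by apply exp_pos. unfold Rpower. rewrite ln_exp. f_equal. ring.
Qed.

Lemma kernel_average_aux : P0 (wa + 1) - P0 wa = K w0.
Proof.
  (* The lower period gives [kappa = 0] and the upper one [kappa + mean - K w0 = 0]; together they
     identify the mean with [K w0]. *)
  assert (Eb : kappa = 0).
  { apply (remainder_decay (-1) kappa wb Hwb).
    - intros t Ht. specialize (Hbot t Ht). lra.
    - intros n. replace (-1 * Z.of_nat (S n))%Z with (- Z.of_nat (S n))%Z by lia.
      apply lower_remainder. }
  assert (Ea : kappa + (P0 (wa + 1) - P0 wa - K w0) = 0).
  { apply (remainder_decay 1 _ wa Hwa).
    - intros t Ht. specialize (Htop t Ht). lra.
    - intros n. rewrite Z.mul_1_l. apply (upper_remainder (S n)). }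
  rewrite Eb, Cplus_0_l in Ea. now apply Ceq_minus.
Qed.

End Kernel.

(* [K] is compared with its mean through the Cauchy kernel [1 / (x - 1)],
   [x = exp (2 i pi (beta - beta w0))], of the cylinder with coordinate [beta]. *)
Lemma kernel_average (s m : R) (K beta P0 : C -> C) (w0 wa wb : C) (d : R) :
  differentiable_on (half_plane s m) K -> differentiable_on (half_plane s m) beta ->
  (forall w, half_plane s m w -> K (w + 1) = K w) ->
  (forall w, half_plane s m w -> beta (w + 1) = beta w + 1) ->
  (forall w, half_plane s m w -> Cexp (i2pi * (beta w - beta w0)) = 1 ->
     K w = K w0 /\ Cd beta w <> 0) ->
  (forall n : Z, n <> 0%Z -> exists P,
     (forall w, half_plane s m w -> Cder P w (K w * character n (beta w) * Cd beta w)) /\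
     (forall w, half_plane s m w -> P (w + 1) = P w)) ->
  (forall w, half_plane s m w -> Cder P0 w (K w * Cd beta w)) ->
  (0 < d)%R -> half_plane s m wa -> half_plane s m wb ->
  (forall t : R, (0 <= t <= 1)%R -> (d <= Im (beta (wa + RtoC t)%C - beta w0))%R) ->
  (forall t : R, (0 <= t <= 1)%R -> (Im (beta (wb + RtoC t)%C - beta w0) <= - d)%R) ->
  P0 (wa + 1) - P0 wa = K w0.
Proof.
  intros HK Hbeta EK Ebeta Hpole Hmodes HP0 Hd Hwa Hwb Htop Hbot.
  destruct (primitive _ _ (half_plane_open s m) (half_plane_convex s m)
    (kernel_quot_differentiable s m K beta w0 HK Hbeta Hpole)) as [Q HQ].
  now apply (kernel_average_aux s m K beta w0 HK Hbeta EK Ebeta Hpole Hmodes P0 HP0 wa wb d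
    Hd Hwa Hwb Htop Hbot Q).
Qed.

(** * Constancy of periodic functions without nonzero modes *)

Lemma half_plane_sub (s m m' : R) (w : C) : (m <= m')%R -> half_plane s m' w -> half_plane s m w.
Proof. unfold half_plane. lra. Qed.

Lemma half_plane_disc (s m r : R) (w v : C) : (s * s = 1)%R ->
  half_plane s (m + r) w -> (Cmod (v - w) <= r)%R -> half_plane s m v.
Proof.
  unfold half_plane. intros Hs Hw Hv.
  pose proof (im_le_Cmod (v - w)) as B. unfold Cminus in B at 1. rewrite im_plus, im_opp in B.
  assert (B' : (Rabs (s * (Im v + - Im w)) <= r)%R).
  { rewrite Rabs_mult. replace (Rabs s) with 1%R; [lra |].
    assert (E : (Rabs s * Rabs s = 1)%R) by (rewrite <- Rabs_mult, Hs; apply Rabs_R1).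
    pose proof (Rabs_pos s). nra. }
  apply Rabs_le_between in B'. lra.
Qed.

(** Cauchy's estimate for [beta v - v] on the circle of radius 1 around [w]; the depth [m + 2]
    leaves room for a disc of radius 2. *)
Lemma near_identity_deriv (s m : R) (beta : C -> C) (w : C) : (s * s = 1)%R ->
  differentiable_on (half_plane s m) beta ->
  (forall v, half_plane s m v -> (Cmod (beta v - v) <= / 4)%R) ->
  half_plane s (m + 2) w -> (Cmod (Cd beta w - 1) <= / 4)%R.
Proof.
  intros Hs Hb Hid Hw.
  assert (Hsub : forall v, disc w 2 v -> half_plane s m v)
    by (intros v Hv; apply (half_plane_disc s m 2 w); [exact Hs | exact Hw | now left]).
  replace (/ 4)%R with (/ 4 / 1)%R by field.
  apply cauchy_estimate with (f := fun v => beta v - v) (a := w) (R0 := 2%R).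
  - lra.
  - intros v Hv. destruct (Hb v (Hsub v Hv)) as [l Hl].
    eexists. apply Cder_minus; [exact Hl | apply Cder_id].
  - apply Cder_minus; [| apply Cder_id].
    apply (Cd_correct (half_plane s m)); [exact Hb | apply Hsub, disc_center; lra].
  - intros t Ht. apply Hid, Hsub. unfold disc. rewrite circle_pt_dist; lra.
Qed.

(** At this depth [beta w - w] is Lipschitz with constant [/ 4], too small to compensate the
    difference of two distinct points. *)
Lemma near_identity_injective (s m : R) (beta : C -> C) (u v : C) : (s * s = 1)%R ->
  differentiable_on (half_plane s m) beta ->
  (forall v, half_plane s m v -> (Cmod (beta v - v) <= / 4)%R) ->
  half_plane s (m + 2) u -> half_plane s (m + 2) v -> beta u = beta v -> u = v.
Proof.
  intros Hs Hb Hid Hu Hv E.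
  assert (B : (Cmod (beta v - v - (beta u - u)) <= / 4 * Cmod (v - u))%R).
  { apply (mean_value_ineq (fun w => beta w - w) (fun w => Cd beta w - 1)). intros t Ht.
    pose proof (half_plane_convex s (m + 2) u v t Hu Hv Ht) as Hw. split.
    - apply Cder_minus; [| apply Cder_id].
      apply (Cd_correct (half_plane s m)); [exact Hb | revert Hw; apply half_plane_sub; lra].
    - now apply (near_identity_deriv s m). }
  rewrite E in B. replace (beta v - v - (beta v - u)) with (- (v - u)) in B by ring.
  rewrite Cmod_opp in B. pose proof (Cmod_ge_0 (v - u)).
  symmetry. apply Ceq_minus, Cmod_eq_0. lra.
Qed.

(** Injectivity of [beta] places the poles of the kernel at the points [u + n], where [K] equals
    [K u] by periodicity; so [K u] is a mean that does not depend on [u]. Of the depth 3, 2 serves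
    [near_identity_injective] and 1 the shifts by [Ci]. *)
Lemma constant_deep (s m : R) (K beta : C -> C) : (s * s = 1)%R ->
  differentiable_on (half_plane s m) beta ->
  (forall w, half_plane s m w -> (Cmod (beta w - w) <= / 4)%R) ->
  (forall w, half_plane s m w -> beta (w + 1) = beta w + 1) ->
  differentiable_on (half_plane s m) K ->
  (forall w, half_plane s m w -> K (w + 1) = K w) ->
  (forall n : Z, n <> 0%Z -> exists P,
     (forall w, half_plane s m w -> Cder P w (K w * character n (beta w) * Cd beta w)) /\
     (forall w, half_plane s m w -> P (w + 1) = P w)) ->
  forall u v, half_plane s (m + 3) u -> half_plane s (m + 3) v -> K u = K v.
Proof.
  intros Hs Hb Hid Eb HK EK Hmodes.
  assert (Hsub : forall w, half_plane s (m + 2) w -> half_plane s m w)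
    by (intros w; apply half_plane_sub; lra).
  assert (HK2 : differentiable_on (half_plane s (m + 2)) K) by (intros w Hw; apply HK, Hsub, Hw).
  assert (Hb2 : differentiable_on (half_plane s (m + 2)) beta) by (intros w Hw; apply Hb, Hsub, Hw).
  assert (EK2 : forall w, half_plane s (m + 2) w -> K (w + 1) = K w)
    by (intros w Hw; apply EK, Hsub, Hw).
  assert (Eb2 : forall w, half_plane s (m + 2) w -> beta (w + 1) = beta w + 1)
    by (intros w Hw; apply Eb, Hsub, Hw).
  destruct (primitive _ (fun w => K w * Cd beta w)
    (half_plane_open s (m + 2)) (half_plane_convex s (m + 2))) as [P0 HP0].
  { intros w Hw. destruct (HK2 w Hw) as [k Hk].
    destruct (Cd_differentiable _ _ (half_plane_open s (m + 2)) Hb2 w Hw) as [b Hb'].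
    eexists. now apply Cder_mult; [exact Hk | exact Hb']. }
  assert (Hi : Cmod Ci = 1%R) by apply Cmod_Ci.
  assert (Hup : forall u, half_plane s (m + 3) u -> half_plane s (m + 2) (u + Ci)).
  { intros u Hu. apply (half_plane_disc s _ 1 u); [exact Hs | |].
    - revert Hu. apply half_plane_sub. lra.
    - replace (u + Ci - u) with Ci by ring. lra. }
  assert (Hdown : forall u, half_plane s (m + 3) u -> half_plane s (m + 2) (u - Ci)).
  { intros u Hu. apply (half_plane_disc s _ 1 u); [exact Hs | |].
    - revert Hu. apply half_plane_sub. lra.
    - replace (u - Ci - u) with (- Ci) by ring. rewrite Cmod_opp. lra. }
  assert (HIm : forall a b, half_plane s m a -> half_plane s m b ->
    (Rabs (Im (beta a - beta b) - (Im a - Im b)) <= / 2)%R).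
  { intros a b Ha Hb'.
    replace (Im (beta a - beta b) - (Im a - Im b))%R with (Im ((beta a - a) - (beta b - b)))
      by (unfold Cminus; rewrite !im_plus, !im_opp, im_plus, im_opp; ring).
    eapply Rle_trans; [apply im_le_Cmod |].
    pose proof (Cmod_triangle (beta a - a) (- (beta b - b))) as T. rewrite Cmod_opp in T.
    specialize (Hid a Ha) as Ia. specialize (Hid b Hb') as Ib. unfold Cminus at 1. lra. }
  assert (main : forall u, half_plane s (m + 3) u -> P0 (u + Ci + 1) - P0 (u + Ci) = K u).
  { intros u Hu.
    assert (Hu2 : half_plane s (m + 2) u) by (revert Hu; apply half_plane_sub; lra).
    (* A shift by [Ci] changes [Im] by 1, and [beta] differs from the identity by at most [/ 4] at
       each of the two points; this leaves [/ 2]. *)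
    apply (kernel_average s (m + 2) K beta P0 u (u + Ci) (u - Ci) (/ 2)); try assumption; auto.
    - intros w Hw E. split.
      + apply Cexp_i2pi_eq_1 in E as [n En].
        assert (Ew : w = u + RtoC (IZR n)).
        { apply (near_identity_injective s m beta); try assumption.
          - now apply half_plane_real_shift.
          - rewrite (translation_IZR s (m + 2) beta 1) by assumption.
            replace (beta w) with (beta w - beta u + beta u) by ring. rewrite En. ring. }
        rewrite Ew, (translation_IZR s (m + 2) K 0) by
          (try assumption; intros; rewrite EK2 by assumption; ring). ring.
      + intros E0. pose proof (near_identity_deriv s m beta w Hs Hb Hid Hw) as B.
        rewrite E0 in B. replace (0 - 1) with (- RtoC 1) in B by ring.
        rewrite Cmod_opp, Cmod_1 in B. lra.
    - intros n Hn. destruct (Hmodes n Hn) as [P [DP EP]]. exists P. auto.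
    - lra.
    - intros t _.
      assert (Ha : half_plane s m (u + Ci + RtoC t)) by (apply half_plane_real_shift, Hsub, Hup, Hu).
      pose proof (HIm _ u Ha (Hsub u Hu2)) as B. apply Rabs_le_between in B.
      rewrite (Im_plus_real (u + Ci)), im_plus in B. change (Im Ci) with 1%R in B. lra.
    - intros t _.
      assert (Ha : half_plane s m (u - Ci + RtoC t)) by (apply half_plane_real_shift, Hsub, Hdown, Hu).
      pose proof (HIm _ u Ha (Hsub u Hu2)) as B. apply Rabs_le_between in B.
      rewrite (Im_plus_real (u - Ci)) in B.
      replace (Im (u - Ci)) with (Im u - 1)%R in B; [lra |].
      unfold Cminus. rewrite im_plus, im_opp. reflexivity. }
  intros u v Hu Hv. rewrite <- (main u Hu), <- (main v Hv).
  apply (increment_constant s (m + 2) P0 _ _ _ HP0); auto.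
  intros w Hw. rewrite EK2 by exact Hw. now rewrite (Cd_translation s (m + 2) beta 1).
Qed.

Lemma Cd_id (w : C) : Cd (fun z => z) w = 1.
Proof.
  apply (Cder_unique (fun z => z) w); [| apply Cder_id].
  apply (Cd_correct (fun _ => True)); [| exact I]. intros z _. exists 1. apply Cder_id.
Qed.

(* The nonzero Fourier modes of [K] do not depend on the height, hence vanish at every
   height once they vanish high up. *)
Lemma constant_propagates (s m : R) (K : C -> C) : (s * s = 1)%R -> (0 <= m)%R ->
  differentiable_on (half_plane s 0) K ->
  (forall w, half_plane s 0 w -> K (w + 1) = K w) ->
  (forall u v, half_plane s m u -> half_plane s m v -> K u = K v) ->
  forall u v, half_plane s 0 u -> half_plane s 0 v -> K u = K v.
Proof.
  intros Hs Hm HK EK Hconst.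
  assert (Hid : forall U : C -> Prop, differentiable_on U (fun z => z))
    by (intros U z _; exists 1; apply Cder_id).
  destruct (primitive _ (fun w => K w * Cd (fun z => z) w)
    (half_plane_open s 0) (half_plane_convex s 0)) as [P0 HP0].
  { intros w Hw. destruct (HK w Hw) as [k Hk].
    destruct (Cd_differentiable _ _ (half_plane_open s 0) (Hid _) w Hw) as [b Hb].
    eexists. now apply Cder_mult; [exact Hk | exact Hb]. }
  (* A reference point in the region where [K] is already known to be constant. *)
  set (wd := RtoC (s * (m + 1)) * Ci).
  assert (Hwd : half_plane s m wd).
  { unfold half_plane, wd. rewrite im_scal_l. unfold Im, Ci; simpl.
    replace (s * (s * (m + 1) * 1))%R with (s * s * (m + 1))%R by ring. rewrite Hs. lra. }
  assert (Hwd0 : half_plane s 0 wd) by (revert Hwd; apply half_plane_sub; exact Hm).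
  assert (main : forall u, half_plane s 0 u -> P0 (wd + 1) - P0 wd = K u).
  (* Half the distance from [u] to the real axis, so that the periods at heights [Im u + y] and
     [Im u - y] both stay in the half-plane. *)
  { intros u Hu. set (y := (s * Im u / 2)%R). unfold half_plane in Hu.
    assert (Hy : (0 < y)%R) by (unfold y; lra).
    assert (Hya : half_plane s 0 (u + RtoC y * Ci)).
    { apply (half_plane_disc s 0 y u); [exact Hs | unfold half_plane, y; lra |].
      replace (u + RtoC y * Ci - u) with (RtoC y * Ci) by ring.
      rewrite Cmod_mult, Cmod_R, Cmod_Ci, Rabs_right; lra. }
    assert (Hyb : half_plane s 0 (u + RtoC (- y) * Ci)).
    { apply (half_plane_disc s 0 y u); [exact Hs | unfold half_plane, y; lra |].
      replace (u + RtoC (- y) * Ci - u) with (RtoC (- y) * Ci) by ring.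
      rewrite Cmod_mult, Cmod_R, Cmod_Ci, Rabs_Ropp, Rabs_right; lra. }
    assert (Himy : forall r t, Im (u + RtoC r * Ci + RtoC t - u) = r).
    { intros r t. replace (u + RtoC r * Ci + RtoC t - u) with (RtoC r * Ci + RtoC t) by ring.
      rewrite Im_plus_real, im_scal_l. unfold Im, Ci; simpl. ring. }
    rewrite (increment_constant s 0 P0 (fun w => K w * Cd (fun z => z) w) wd (u + RtoC y * Ci));
      try assumption.
    2: { intros w Hw. rewrite !Cd_id. now rewrite EK. }
    (* The identity is injective with derivative 1 on the whole half-plane, which is not known of
       [beta]. *)
    apply (kernel_average s 0 K (fun z => z) P0 u (u + RtoC y * Ci) (u + RtoC (- y) * Ci) y);
      try assumption.
    - apply Hid.
    - reflexivity.
    - intros w Hw E. split; [| rewrite Cd_id; apply C1_nz].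
      apply Cexp_i2pi_eq_1 in E as [n En].
      replace w with (u + RtoC (IZR n)) by (rewrite <- En; ring).
      rewrite (translation_IZR s 0 K 0); [ring | | exact Hu].
      intros v Hv. rewrite EK by exact Hv. ring.
    - intros n Hn.
      assert (NZ : RtoC (IZR n) <> 0)
        by (intros E; apply RtoC_inj in E; now apply eq_IZR in E).
      destruct (primitive _ (fun w => K w * character n w * Cd (fun z => z) w)
        (half_plane_open s 0) (half_plane_convex s 0)) as [P HP].
      { intros w Hw. destruct (HK w Hw) as [k Hk].
        destruct (Cd_differentiable _ _ (half_plane_open s 0) (Hid _) w Hw) as [b Hb].
        eexists. apply Cder_mult; [apply Cder_mult; [exact Hk |] | exact Hb].
        apply (Cder_character n (fun z => z)), Cder_id. }
      exists P. split; [exact HP |]. intros w Hw.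
      apply Ceq_minus.
      rewrite (increment_constant s 0 P _ w wd HP); try assumption.
      2: { intros v Hv. rewrite !Cd_id, (character_plus n v 1), character_one, EK by exact Hv. ring. }
      (* At depth [m] the integrand is [K wd * character n v], so [P] differs there by a constant
         from an explicit periodic primitive. *)
      set (E := fun v => P v - K wd / (RtoC (IZR n) * i2pi) * character n v).
      assert (EE : E (wd + 1) = E wd).
      { apply (constant_of_Cder_0 (half_plane s m) E); [apply half_plane_convex | | | exact Hwd].
        - intros v Hv. eapply Cder_eq; [| apply Cder_minus; [apply HP |
            apply Cder_scal, (Cder_character n (fun z => z)), Cder_id]].
          + rewrite Cd_id, (Hconst v wd Hv Hwd). field. split; [apply i2pi_neq_0 | exact NZ].
          + revert Hv. now apply half_plane_sub.
        - now apply half_plane_real_shift. }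
      unfold E in EE. rewrite (character_plus n wd 1), character_one, Cmult_1_r in EE.
      transitivity ((P (wd + 1) - K wd / (RtoC (IZR n) * i2pi) * character n wd)
        - (P wd - K wd / (RtoC (IZR n) * i2pi) * character n wd)); [ring | rewrite EE; ring].
    - intros t _. rewrite Himy. lra.
    - intros t _. rewrite Himy. lra. }
  intros u v Hu Hv. now rewrite <- (main u Hu), <- (main v Hv).
Qed.

(** The modes of [K] are increments of primitives on the half-plane; composed with [q], these
    primitives fall under [commuting_increments] on the disc, where [psi] acts. *)
Lemma invariant_constant (phi psi : C -> C) (U : C -> Prop) (q beta k : C -> C) (c : C) (s : R) :
  holomorphic_self_map phi -> holomorphic_self_map psi -> commuting phi psi ->
  canonical_model phi U q -> (s * s = 1)%R -> (forall w, U w <-> half_plane s 0 w) ->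
  ~ rational c -> linearization_function phi psi U q c beta ->
  differentiable_on unit_disc k ->
  (forall z, unit_disc z -> k (phi z) = k z) -> (forall z, unit_disc z -> k (psi z) = k z) ->
  exists c0, forall z, unit_disc z -> k z = c0.
Proof.
  intros Hphi Hpsi Hcomm Hmodel Hs HU Hc [[Hb Eb Bphi Bpsi] Hlim] Hk Kphi Kpsi.
  apply holomorphic_differentiable in Hb.
  destruct (koenigs_factor phi U q k Hphi Hmodel Hk Kphi) as [K [HK [EKq EK]]].
  destruct Hmodel as [Hq Hinto Habel _ _ _ _]. apply holomorphic_differentiable in Hq.
  assert (HbS : differentiable_on (half_plane s 0) beta) by (intros w Hw; now apply Hb, HU).
  assert (HKS : differentiable_on (half_plane s 0) K) by (intros w Hw; now apply HK, HU).
  assert (EbS : forall w, half_plane s 0 w -> beta (w + 1) = beta w + 1)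
    by (intros w Hw; now apply Eb, HU).
  assert (EKS : forall w, half_plane s 0 w -> K (w + 1) = K w)
    by (intros w Hw; now apply EK, HU).
  assert (HqS : forall z, unit_disc z -> half_plane s 0 (q z)) by (intros z Hz; now apply HU, Hinto).
  assert (H0 : unit_disc 0) by (unfold unit_disc; rewrite Cmod_0; lra).
  assert (Hmodes : forall n : Z, n <> 0%Z -> exists P,
    (forall w, half_plane s 0 w -> Cder P w (K w * character n (beta w) * Cd beta w)) /\
    (forall w, half_plane s 0 w -> P (w + 1) = P w)).
  { intros n Hn.
    destruct (primitive _ (fun w => K w * character n (beta w) * Cd beta w)
      (half_plane_open s 0) (half_plane_convex s 0)) as [P HP].
    { intros w Hw. destruct (HKS w Hw) as [l Hl]. destruct (HbS w Hw) as [b1 Hb1].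
      destruct (Cd_differentiable _ _ (half_plane_open s 0) HbS w Hw) as [b2 Hb2].
      eexists. apply Cder_mult; [apply Cder_mult; [exact Hl | apply Cder_character, Hb1] | exact Hb2]. }
    exists P. split; [exact HP |]. intros w Hw. apply Ceq_minus.
    (* Here [mu = character n c] differs from 1 and [nu = 0], so the relation [(1 - mu) * I = nu]
       forces [I = 0]. *)
    destruct (commuting_increments phi psi (fun z => P (q z))
      (fun z => k z * character n (beta (q z))) (fun z => beta (q z))
      (fun z => Cd beta (q z) * Cd q z) c (character n c) 0) as [I [HI EI]]; try assumption.
    - intros z Hz. apply (Cder_comp beta q).
      + now apply (Cd_correct unit_disc).
      + apply (Cd_correct (half_plane s 0)); [exact HbS | now apply HqS].
    - intros z Hz. eapply Cder_eq; [| apply (Cder_comp P q);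
        [now apply (Cd_correct unit_disc) | now apply HP, HqS]].
      rewrite (EKq z Hz). ring.
    - intros z Hz. rewrite (Kphi z Hz), (Bphi z Hz), character_plus, character_one. ring.
    - intros z Hz. rewrite (Kpsi z Hz), (Bpsi z Hz), character_plus. ring.
    - assert (I0 : I = 0).
      { destruct (Ceq_dec I 0) as [| N]; [assumption |]. exfalso.
        assert (N1 : 1 - character n c <> 0)
          by (apply Cminus_eq_contra; intros E; now apply (Cexp_irrational c n Hc Hn)).
        now apply (Cmult_neq_0 _ _ N1 N). }
      (* The increment is read off at [q 0], where translation by 1 is the action of [phi]. *)
      rewrite (increment_constant s 0 P _ w (q 0) HP); [| | exact Hw | now apply HqS].
      + rewrite <- (Habel 0 H0), (HI 0 H0), I0. ring.
      + intros v Hv. rewrite EKS, EbS, character_plus, character_one by exact Hv.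
        rewrite (Cd_translation s 0 beta 1) by assumption. ring. }
  (* [/ 4] is the closeness required by [constant_deep]; [Rabs M] below makes the depth
     nonnegative. *)
  destruct (Hlim (/ 4)%R ltac:(lra)) as [M HM].
  pose proof (Rabs_pos M) as PM. pose proof (Rle_abs M) as PM'.
  assert (Habs : forall w, half_plane s (Rabs M) w -> (M < Rabs (Im w))%R).
  { intros w Hw. unfold half_plane in Hw.
    assert (E : (Rabs s = 1)%R).
    { assert (E2 : (Rabs s * Rabs s = 1)%R) by (rewrite <- Rabs_mult, Hs; apply Rabs_R1).
      pose proof (Rabs_pos s). nra. }
    pose proof (Rle_abs (s * Im w)) as B. rewrite Rabs_mult, E in B. lra. }
  assert (Hsub : forall w, half_plane s (Rabs M) w -> half_plane s 0 w)
    by (intros w; apply half_plane_sub; exact PM).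
  exists (K (q 0)). intros z Hz. rewrite <- (EKq z Hz).
  apply (constant_propagates s (Rabs M + 3) K Hs ltac:(lra) HKS EKS); [| now apply HqS | now apply HqS].
  apply (constant_deep s (Rabs M) K beta Hs).
  - intros w Hw. apply HbS, Hsub, Hw.
  - intros w Hw. left. apply HM; [now apply HU, Hsub | now apply Habs].
  - intros w Hw. apply EbS, Hsub, Hw.
  - intros w Hw. apply HKS, Hsub, Hw.
  - intros w Hw. apply EKS, Hsub, Hw.
  - intros n Hn. destruct (Hmodes n Hn) as [P [HP EP]]. exists P. auto.
Qed.

Theorem corollary4p9
  (phi psi : C -> C)
  (Hphi : parabolic phi) (Hpsi : parabolic psi)
  (Hcomm : commuting phi psi)
  (S_phi : C -> Prop) (h_phi : C -> C)
  (Hmodel : canonical_model phi S_phi h_phi)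
  (c_phi_psi : C)
  (Hcoef : linearization_coefficient phi psi S_phi h_phi c_phi_psi)
  (h : C -> C) (Hh : holomorphic_on unit_disc h)
  (c1 c2 : C) (Hc : (c1, c2) <> (RtoC 0, RtoC 0))
  (Hh_phi : forall z, unit_disc z -> h (phi z) = h z + c1)
  (Hh_psi : forall z, unit_disc z -> h (psi z) = h z + c2) :
  c1 <> 0 /\
  c2 / c1 = c_phi_psi /\
  (positive_hyperbolic_step phi -> ~ rational c_phi_psi ->
   forall beta_phi_psi : C -> C,
     linearization_function phi psi S_phi h_phi c_phi_psi beta_phi_psi ->
     exists c0 : C, forall z, unit_disc z -> h z = c1 * beta_phi_psi (h_phi z) + c0).
Proof.
  destruct Hphi as [Sphi _], Hpsi as [Spsi _].
  apply holomorphic_differentiable in Hh.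
  pose proof (holomorphic_differentiable _ _ (koenigs_holomorphic _ _ _ Hmodel)) as Hq.
  assert (Hcomp : forall beta, linearization_system phi psi S_phi h_phi c_phi_psi beta ->
    differentiable_on unit_disc (fun z => beta (h_phi z))).
  { intros beta [Hb _ _ _] z Hz. apply holomorphic_differentiable in Hb.
    destruct (Hq z Hz) as [l Hl].
    destruct (Hb _ (koenigs_into _ _ _ Hmodel z Hz)) as [k Hk].
    eexists. apply (Cder_comp beta h_phi); [exact Hl | exact Hk]. }
  assert (E : c2 = c1 * c_phi_psi).
  (* The coefficient is specified separately for each kind of step, so the dichotomy decides which
     function linearizes both maps. *)
  { destruct Hcoef as [Hzero Hpos].
    destruct (hyperbolic_step_dichotomy phi Sphi) as [Z | P].
    - apply (translation_ratio phi psi h_phi h); try assumption.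
      + exact (koenigs_abel _ _ _ Hmodel).
      + now apply Hzero.
    - destruct (Hpos P) as [beta Hbeta].
      apply (translation_ratio phi psi (fun z => beta (h_phi z)) h); try assumption.
      + now apply Hcomp.
      + exact (lin_first _ _ _ _ _ _ Hbeta).
      + exact (lin_second _ _ _ _ _ _ Hbeta). }
  assert (N1 : c1 <> 0).
  { intros E1. apply Hc. rewrite E, E1. f_equal. ring. }
  split; [exact N1 | split; [rewrite E; field; exact N1 |]].
  intros Hpos Hirr beta Hbeta.
  assert (Hs : exists s : R, (s * s = 1)%R /\ forall w, S_phi w <-> half_plane s 0 w).
  { destruct (positive_step_normalization _ _ _ Hmodel Hpos) as [[HU | HU] _].
    - exists 1%R. split; [ring |]. intros w. rewrite HU.
      unfold upper_half_plane, half_plane. now rewrite Rmult_1_l.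
    - exists (-1)%R. split; [ring |]. intros w. rewrite HU.
      unfold lower_half_plane, half_plane. lra. }
  destruct Hs as [s [Hs HU]]. destruct Hbeta as [Hsys Hlim].
  (* The difference [h z - c1 * beta (h_phi z)] is invariant under [psi] because
     [c2 = c1 * c_phi_psi]. *)
  destruct (invariant_constant phi psi S_phi h_phi beta
    (fun z => h z - c1 * beta (h_phi z)) c_phi_psi s) as [c0 Hc0]; try assumption.
  - now split.
  - intros z Hz. destruct (Hh z Hz) as [l Hl]. destruct (Hcomp beta Hsys z Hz) as [k Hk].
    eexists. apply Cder_minus; [exact Hl | apply Cder_scal, Hk].
  - intros z Hz. rewrite (Hh_phi z Hz), (lin_first _ _ _ _ _ _ Hsys z Hz). ring.
  - intros z Hz. rewrite (Hh_psi z Hz), (lin_second _ _ _ _ _ _ Hsys z Hz), E. ring.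
  - exists c0. intros z Hz. rewrite <- (Hc0 z Hz). ring.
Qed.
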